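(* Let $\lambda,\kappa$ be nonzero real numbers with $\lambda\kappa>0$. Then there exist smooth initial data $(u_0,\rho_0)$ on $[0,1]$ satisfying the periodic boundary conditions such that the corresponding solution $(u,\rho)$ of the generalized Hunter–Saxton system has a finite $L^\infty$ blowup time $t_*>0$ and the following hold: (1) if $p\in(1,\infty)$ and $\lambda\in(-\infty,-1/p]\cup(0,\infty)$, then $\lim_{t\nearrow t_*}\|u_x(\cdot,t)\|_p=+\infty$; (2) if $p\in[1,\infty)$ and $\lambda\in(-1/(2p-1),0)$, then $\lim_{t\nearrow t_*}\|u_x(\cdot,t)\|_p<\infty$; (3) if $p\in[1,\infty)$ and $\lambda\in(-\infty,-1/(2p-1)]\cup(0,\infty)$, then $\lim_{t\nearrow t_*}\|\rho(\cdot,t)\|_p=+\infty$; (4) if $p\in[1,\infty)$ and $\lambda\in(-1/(2p-1),0)$, then $\lim_{t\nearrow t_*}\|\rho(\cdot,t)\|_p<\infty$.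
   Context: For nonzero real parameters $\lambda,\kappa$, the generalized Hunter–Saxton system is $$u_{xt}+uu_{xx}-\lambda u_x^2-\kappa\rho^2=I(t),\qquad \rho_t+u\rho_x=2\lambda\rho u_x,\qquad x\in[0,1],\ t>0,$$ with initial data $u(x,0)=u_0(x)$, $\rho(x,0)=\rho_0(x)$, where $$I(t)=-\kappa\int_0^1\rho^2\,dx-(1+\lambda)\int_0^1u_x^2\,dx,$$ and with periodic boundary conditions $u(0,t)=u(1,t)$, $u_x(0,t)=u_x(1,t)$, $\rho(0,t)=\rho(1,t)$. Initial data ''satisfy the periodic boundary conditions'' if these identities hold at $t=0$. The finite $L^\infty$ blowup time $t_*>0$ is the finite time such that the solution is smooth for $0\le t<t_*$, while $\|u_x(\cdot,t)\|_{L^\infty([0,1])}\to\infty$ and $\|\rho(\cdot,t)\|_{L^\infty([0,1])}\to\infty$ as $t\nearrow t_*$. Here $\|\cdot\|_p$ denotes the norm of $L^p([0,1])$ in the variable $x$. *)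

(* Defs.v *)
From mathcomp Require Import all_boot all_order all_algebra.
From mathcomp Require Import all_classical all_reals all_analysis.

Set Implicit Arguments.
Unset Strict Implicit.
Unset Printing Implicit Defensive.

Import Order.TTheory GRing.Theory Num.Theory.
Import numFieldNormedType.Exports.

Local Open Scope classical_set_scope.
Local Open Scope ring_scope.

(* The library's [derivable] and [f^`()] are two-sided; [x] ranges over a closed
   interval and [t] starts at 0, so boundary derivatives are one-sided: the
   difference quotient only samples points of [A]. *)
Definition quot_within (R : realType) (A : set R) (f : R -> R) (x : R) :=
  (fun y => (f y - f x) / (y - x)) @ within A x^'.

Definition derivable_within (R : realType) (A : set R) (f : R -> R) (x : R) :=
  cvg (quot_within A f x).

Definition derive_within (R : realType) (A : set R) (f : R -> R) : R -> R :=
  fun x => lim (quot_within A f x).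

(* Smooth = C^infinity up to the endpoints. *)
Definition smooth01 (R : realType) (f : R -> R) :=
  forall n (x : R), x \in `[0, 1] ->
    derivable_within `[0, 1] (iter n (derive_within `[0, 1]) f) x.

(* Functions of space and time are written [f x t].  A derivative is local, so
   the ray [0, +oo[ gives the right time derivative at every t < T for a
   function that is only meaningful on [0, T[. *)
Definition dx (R : realType) (f : R -> R -> R) : R -> R -> R :=
  fun x t => derive_within `[0, 1] (fun y => f y t) x.

Definition dt (R : realType) (f : R -> R -> R) : R -> R -> R :=
  fun x t => derive_within `[0, +oo[ (fun s => f x s) t.

Fixpoint Ck (R : realType) (T : R) (k : nat) (f : R -> R -> R) : Prop :=
  {within `[0, 1] `*` `[0, T[, continuous (fun z : R * R => f z.1 z.2)} /\
  if k is k'.+1 then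
    [/\ forall x t : R, x \in `[0, 1] -> t \in `[0, T[ ->
          derivable_within `[0, 1] (fun y => f y t) x /\
          derivable_within `[0, +oo[ (fun s => f x s) t,
        Ck T k' (dx f)
      & Ck T k' (dt f)]
  else True.

Definition smooth (R : realType) (T : R) (f : R -> R -> R) :=
  forall k, Ck T k f.

Definition periodic_data (R : realType) (u0 rho0 : R -> R) :=
  [/\ u0 0 = u0 1,
      derive_within `[0, 1] u0 0 = derive_within `[0, 1] u0 1
    & rho0 0 = rho0 1].

Definition nonlocal (R : realType) (lambda kappa : R) (u rho : R -> R -> R)
    (t : R) : R :=
  - kappa * \int[lebesgue_measure]_(x in `[0, 1]) (rho x t ^+ 2)
  - (1 + lambda) * \int[lebesgue_measure]_(x in `[0, 1]) (dx u x t ^+ 2).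

(* [(u, rho)] is a smooth solution on [0, 1] x [0, T[.  The system determines
   [u] only up to a Galilean change u(x, t) -> u(x - c(t), t) + c'(t), which
   leaves the norms of [dx u] and [rho] unchanged. *)
Record is_solution (R : realType) (lambda kappa : R) (u0 rho0 : R -> R) (T : R)
    (u rho : R -> R -> R) : Prop := IsSolution {
  sol_smooth_u : smooth T u;
  sol_smooth_rho : smooth T rho;
  sol_periodic : forall t : R, t \in `[0, T[ ->
    [/\ u 0 t = u 1 t, dx u 0 t = dx u 1 t & rho 0 t = rho 1 t];
  sol_init : forall x : R, x \in `[0, 1] -> u x 0 = u0 x /\ rho x 0 = rho0 x;
  sol_eq_u : forall x t : R, x \in `[0, 1] -> t \in `]0, T[ ->
    dt (dx u) x t + u x t * dx (dx u) x t
      - lambda * dx u x t ^+ 2 - kappa * rho x t ^+ 2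
    = nonlocal lambda kappa u rho t;
  sol_eq_rho : forall x t : R, x \in `[0, 1] -> t \in `]0, T[ ->
    dt rho x t + u x t * dx rho x t = 2 * lambda * rho x t * dx u x t }.

(* The L^p([0, 1]) norm, 1 <= p <= +oo, of a time slice: [\_] extends it by 0. *)
Definition Lp01 (R : realType) (p : \bar R) (f : R -> R -> R) (t : R) : \bar R :=
  ('N[@lebesgue_measure R]_p[(EFin \o f^~ t) \_ `[0%R, 1%R]])%E.

Definition Linfty_blowup (R : realType) (u rho : R -> R -> R) (T : R) :=
  (Lp01 +oo (dx u) t @[t --> T^'-] --> +oo%E) /\
  (Lp01 +oo rho t @[t --> T^'-] --> +oo%E).

Definition has_finite_lim_left (R : realType) (g : R -> \bar R) (T : R) :=
  exists l : R, g t @[t --> T^'-] --> l%:E.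

(* Main.v *)
Require Import Defs.
From mathcomp Require Import all_boot all_order all_algebra.
From mathcomp Require Import all_classical all_reals all_analysis.
From mathcomp Require Import ring lra measurable_realfun ess_sup_inf.

(** The initial data are [u0 = 0] and [rho0 x = sigma * cos (2 * pi * x)] with
[sigma ^+ 2 = 1 / (lambda * kappa)].  In Lagrangian variables the solution is
explicit.  Put [a = 1 / (2 * lambda)] and let [q al s = 1 + s^2 sin^2 (2 pi al)],
where [al] is the label of a particle and [s >= 0] a parameter replacing time.
Then the Jacobian of the flow map is [q^(-a) / k] with [k s] the mean of
[q^(-a)] over the labels, the density is [sigma cos (2 pi al) k^(-1/a) / q], and
[ds/dt = sqrt (1 + s^2) k^(-1/a)].  Inserting these in the equations is a
computation in which every dependence on the label cancels
([grad_equation]); periodicity then identifies what remains with the nonlocal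
term ([source_nonlocal], [explicit_solution]).

The equations determine [u] only up to a change of Galilean frame.  An energy
estimate for the difference of two solutions with equal mean velocities
([energy_estimate], [strong_unique]) shows that every solution with these data is
a translate of the explicit one, at each time ([solution_shift]).  The norms of
[rho] and of the derivative of [u] are therefore those of the explicit solution,
and a change of variables expresses their p-th powers as integrals [dens_int] and
[grad_int] over the labels ([int01_flow], [Lp01_cvgy], [Lp01_has_lim]).

As [s] grows, [q] stays of order 1 at the scale [1 / s] around the zeros of the
sine and is of order [s^2] elsewhere, and the time converges to a finite limit
[Tmax] ([tau_bounded]).  The small scale alone contributes [k^(-1 - p/a) / s] to
the p-th power of both norms ([dens_int_ge], [grad_int_ge]), while [k^(1/a)]
decays at least like [s^(-2)] if [lambda < 0] and like [s^(-2 / (2 a + 1))] if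
[lambda > 0] ([k_rate]).  Hence both norms blow up for all [p >= 1] if
[lambda > 0], and for [p + a > 1/2] if [lambda < 0]; this covers
[lambda <= - 1/p] with [p > 1], and [lambda < - 1/(2 p - 1)], which is the same as
[p + a > 1/2].  In the equality case [p + a = 1/2] the density norm still gains a
logarithm ([dens_int_ge_log]).

If [lambda < 0] and [p + a < 1/2], all powers of the maximum [1 + s^2] of [q]
cancel in the two integrals.  What is left are integrals of bounded weights
against powers [Q^(-e)] of [Q = q / (1 + s^2)] with [e < 1/2].  Since [Q] tends to
[sin^2] and these powers are uniformly integrable ([int_qpow_le]), dominated
convergence gives finite limits ([dens_int_cvg], [grad_int_cvg]).

Finally the supremum norm dominates the norm of any finite exponent, and one
exponent with blowup is available for each sign of [lambda]. *)

Import Order.TTheory GRing.Theory Num.Theory.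
Import numFieldNormedType.Exports.

Local Open Scope classical_set_scope.
Local Open Scope ring_scope.

Set Implicit Arguments.
Unset Strict Implicit.
Unset Printing Implicit Defensive.

(** * Calculus on the line *)

Section Calculus.
Context {R : realType}.
Implicit Types (f g F G : R -> R) (a b c x y t : R).
Local Notation mu := (@lebesgue_measure R).

Lemma is_derive1_cst c x : is_derive x 1 (fun _ : R => c) 0.
Proof. exact: is_derive_cst. Qed.

Lemma is_derive1_id x : is_derive x 1 (fun y : R => y) 1.
Proof. exact: is_derive_id. Qed.

Lemma is_derive1N f x a :
  is_derive x 1 f a -> is_derive x 1 (fun y => - f y) (- a).
Proof. by move=> fa; exact: is_deriveN. Qed.

Lemma is_derive1D f g x a b : is_derive x 1 f a -> is_derive x 1 g b ->
  is_derive x 1 (fun y => f y + g y) (a + b).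
Proof. by move=> fa gb; exact: is_deriveD. Qed.

Lemma is_derive1B f g x a b : is_derive x 1 f a -> is_derive x 1 g b ->
  is_derive x 1 (fun y => f y - g y) (a - b).
Proof. by move=> fa gb; exact: is_deriveB. Qed.

Lemma is_derive1M f g x a b : is_derive x 1 f a -> is_derive x 1 g b ->
  is_derive x 1 (fun y => f y * g y) (a * g x + f x * b).
Proof.
move=> fa gb; apply: (is_derive_eq (is_deriveM fa gb)).
by rewrite /GRing.scale /= addrC mulrC.
Qed.

Lemma is_derive1Z c f x a :
  is_derive x 1 f a -> is_derive x 1 (fun y => c * f y) (c * a).
Proof.
move=> fa; apply: (is_derive_eq (is_derive1M (is_derive1_cst c x) fa)).
by rewrite mul0r add0r.
Qed.

Lemma is_derive1_chain f g x a b : is_derive (g x) 1 f a ->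
  is_derive x 1 g b -> is_derive x 1 (fun y => f (g y)) (a * b).
Proof. by move=> fa gb; exact: is_derive1_comp. Qed.

Lemma is_derive_continuous f x a : is_derive x 1 f a -> {for x, continuous f}.
Proof.
by move=> [df _]; apply: differentiable_continuous; apply/derivable1_diffP.
Qed.

Lemma is_derive1_unique f x a b :
  is_derive x 1 f a -> is_derive x 1 f b -> a = b.
Proof. by move=> [_ <-] [_ <-]. Qed.

(** Carathéodory's criterion, with the slope function only constrained near
    the point, where the difference quotients to be studied make sense. *)
Lemma is_derive1_near f (g : R -> R) x a :
  (\forall y \near x^', f y - f x = g y * (y - x)) ->
  g y @[y --> x^'] --> a -> is_derive x 1 f a.
Proof.
move=> fg ga; apply/is_derive1_caratheodory.
exists (fun y => if y == x then a else (f y - f x) / (y - x)); split.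
- move=> y; case: eqVneq => [->|yx]; first by rewrite !subrr mulr0.
  by rewrite divfK// subr_eq0.
- apply/continuous_withinNx; rewrite eqxx.
  apply: cvg_trans ga; apply: near_eq_cvg.
  near=> y; have yx : y != x by near: y; exact: nbhs_dnbhs_neq.
  rewrite (negbTE yx); have -> : f y - f x = g y * (y - x) by near: y.
  by rewrite mulfK// subr_eq0.
- by rewrite eqxx.
Unshelve. all: by end_near. Qed.

Lemma is_derive1_quot f x a : is_derive x 1 f a ->
  (f y - f x) / (y - x) @[y --> x^'] --> a.
Proof.
move=> /is_derive1_caratheodory[g [fg gx <-]].
have /continuous_withinNx : {for x, continuous g} by [].
apply: cvg_trans; apply: near_eq_cvg; near=> y.
have yx : y != x by near: y; exact: nbhs_dnbhs_neq.
by rewrite fg mulfK// subr_eq0.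
Unshelve. all: by end_near. Qed.

Lemma integrable_continuous f a b :
  continuous f -> mu.-integrable `[a, b] (EFin \o f).
Proof.
move=> cf; apply: continuous_compact_integrable; first exact: segment_compact.
exact: continuous_subspaceT.
Qed.

(** Both signs of [x] are covered because the flow map, an antiderivative of a
    periodic Jacobian, is inverted on the whole line. *)
Definition prim f x : R :=
  if 0 <= x then \int[mu]_(y in `[0, x]) f y
  else - \int[mu]_(y in `[x, 0]) f y.

Lemma Rintegral_itvcc_split f a b c : continuous f -> a <= b -> b <= c ->
  \int[mu]_(y in `[a, c]) f y =
  \int[mu]_(y in `[a, b]) f y + \int[mu]_(y in `[b, c]) f y.
Proof.
move=> cf ab bc; have icf := @integrable_continuous f a c cf.
have := @Rintegral_itvB _ f (BLeft a) (BRight c) b icf.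
rewrite !bnd_simp => /(_ ab bc).
rewrite Rintegral_itv_obnd_cbnd; first by move=> <-; rewrite addrC subrK.
apply: (integrableS _ _ _ icf) => //.
by apply: subset_itv; rewrite bnd_simp.
Qed.

Lemma primE f a x : continuous f -> a <= 0 -> a <= x ->
  prim f x = \int[mu]_(y in `[a, x]) f y - \int[mu]_(y in `[a, 0]) f y.
Proof.
move=> cf a0 ax; rewrite /prim; case: leP => x0.
  by rewrite (@Rintegral_itvcc_split f a 0 x)// addrC addKr.
by rewrite (@Rintegral_itvcc_split f a x 0) ?(ltW x0)// opprD addNKr.
Qed.

Lemma is_derive_prim f x : continuous f -> is_derive x 1 (prim f) (f x).
Proof.
move=> cf; pose a := - `|x| - 1.
have a0 : a < 0 by have := normr_ge0 x; rewrite /a; lra.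
have ax : a < x by have := ler_norm (- x); rewrite normrN /a; lra.
pose F y := \int[mu]_(z in `[a, y]) f z.
have [dF F'] : derivable F x 1 /\ F^`()%classic x = f x.
  apply: (@continuous_FTC1_closed _ f a x (x + 1)) => //; first by lra.
    exact: integrable_continuous.
  exact: cf.
have dF' : is_derive x 1 F (f x).
  by apply: (DeriveDef dF); rewrite -derive1E.
apply: (@near_eq_is_derive _ _ _ (fun y => F y - F 0)).
  have : \forall y \near x, a < y by exact: lt_nbhsr.
  by apply: filterS => y ay; rewrite (@primE f a)// ltW.
apply: (is_derive_eq (is_derive1B dF' (is_derive1_cst (F 0) x))).
by rewrite subr0.
Unshelve. all: by end_near. Qed.

Lemma prim0 f : prim f 0 = 0.
Proof. by rewrite /prim lexx set_itv1 Rintegral_set1. Qed.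

Lemma MVTW F (dF : R -> R) a b :
  (forall x, is_derive x 1 F (dF x)) ->
  exists c, (Num.min a b <= c <= Num.max a b) /\ F b - F a = dF c * (b - a).
Proof.
move=> dFF; wlog ab : a b / a <= b.
  move=> H; have [ab|ba] := boolP (a <= b); first exact: H.
  have {}ba : b <= a by rewrite ltW// ltNge.
  have [c [cab E]] := H b a ba.
  by exists c; rewrite minC maxC; split => //; lra.
have [|c cab E] := MVT_segment ab (fun x _ => dFF x).
  by apply: continuous_subspaceT => x; exact: is_derive_continuous (dFF x).
by exists c; rewrite (min_idPl ab) (max_idPr ab); move: cab; rewrite in_itv.
Qed.

Lemma derive_ge0_le F (dF : R -> R) a b : a <= b ->
  (forall x, x \in `]a, b[ -> is_derive x 1 F (dF x)) ->
  {within `[a, b], continuous F} ->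
  (forall x, x \in `]a, b[ -> 0 <= dF x) -> F a <= F b.
Proof.
rewrite le_eqVlt => /predU1P[->//|ab] dFF cF dF0.
have [c cab E] := MVT ab dFF cF.
by rewrite -subr_ge0 E mulr_ge0 ?dF0// subr_ge0 ltW.
Qed.

Lemma prim_unique f F x : (forall y, is_derive y 1 F (f y)) -> continuous f ->
  prim f x = F x - F 0.
Proof.
move=> dF cf; pose G y := prim f y - F y.
have : G x = G 0.
  apply: is_derive_0_is_cst => y.
  apply: (is_derive_eq (is_derive1B (is_derive_prim y cf) (dF y))).
  by rewrite subrr.
by rewrite /G prim0; lra.
Qed.

End Calculus.

(** * Integrals over the unit interval, with a parameter *)

Section UnitIntegral.
Context {R : realType}.
Implicit Types (f g F G : R -> R) (a b c x y t : R).
Local Notation mu := (@lebesgue_measure R).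

Definition int01 f : R := \int[mu]_(x in `[0, 1]) f x.

Lemma int01E f : int01 f = prim f 1.
Proof. by rewrite /prim ler01. Qed.

Lemma eq_int01 f g : (forall x, 0 <= x <= 1 -> f x = g x) -> int01 f = int01 g.
Proof.
by move=> fg; apply: eq_Rintegral => x; rewrite inE /= in_itv /=; exact: fg.
Qed.

Lemma int01_FTC f F : continuous f -> continuous F ->
  (forall x, 0 < x < 1 -> is_derive x 1 F (f x)) -> int01 f = F 1 - F 0.
Proof.
move=> cf cF dF; pose G x := prim f x - F x.
have cp : continuous (prim f).
  by move=> x; apply: is_derive_continuous (is_derive_prim x cf).
have [||c _ E] := @MVT _ G (fun _ => 0) 0 1 ltr01.
- move=> x; rewrite in_itv /= => x01.
  apply: (is_derive_eq (is_derive1B (is_derive_prim x cf) (dF x x01))).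
  by rewrite subrr.
- by apply: continuous_subspaceT => x; exact: (continuousB (cp x) (cF x)).
- by rewrite int01E; move: E; rewrite /G prim0; lra.
Qed.

Lemma int01D f g : continuous f -> continuous g ->
  int01 (fun x => f x + g x) = int01 f + int01 g.
Proof. by move=> cf cg; apply: RintegralD => //; exact: integrable_continuous. Qed.

Lemma int01B f g : continuous f -> continuous g ->
  int01 (fun x => f x - g x) = int01 f - int01 g.
Proof. by move=> cf cg; apply: RintegralB => //; exact: integrable_continuous. Qed.

Lemma int01Z c f : continuous f -> int01 (fun x => c * f x) = c * int01 f.
Proof. by move=> cf; apply: RintegralZl => //; exact: integrable_continuous. Qed.

Lemma int01_cst c : int01 (fun _ => c) = c.
Proof.
transitivity (c * 1 - c * 0); last by rewrite mulr1 mulr0 subr0.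
apply: (@int01_FTC (fun=> c) (fun x => c * x)).
- by move=> x; exact: cvg_cst.
- by move=> x; exact: mulrl_continuous.
- move=> x _; apply: (is_derive_eq (is_derive1Z c (is_derive1_id x))).
  by rewrite mulr1.
Qed.

Lemma ler_int01 f g : continuous f -> continuous g ->
  (forall x, 0 <= x <= 1 -> f x <= g x) -> int01 f <= int01 g.
Proof.
move=> cf cg fg; apply: le_Rintegral => //; try exact: integrable_continuous.
Qed.

Lemma int01_ge0 f : (forall x, 0 <= x <= 1 -> 0 <= f x) -> 0 <= int01 f.
Proof.
by move=> f0; apply: Rintegral_ge0 => x /=; rewrite in_itv /=; exact: f0.
Qed.

Lemma continuous_norm f : continuous f -> continuous (fun x => `|f x|).
Proof. by move=> cf x; apply: cvg_norm; exact: cf. Qed.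

Lemma ler_norm_int01 f : continuous f ->
  `|int01 f| <= int01 (fun x => `|f x|).
Proof.
by move=> cf; apply: le_normr_Rintegral => //; exact: integrable_continuous.
Qed.

Lemma int01_ge_cst f c : continuous f ->
  (forall x, 0 <= x <= 1 -> c <= f x) -> c <= int01 f.
Proof.
move=> cf cle; rewrite -[c]int01_cst; apply: ler_int01 => //.
by move=> x; exact: cvg_cst.
Qed.

Lemma int01_gt0 f : continuous f -> (forall x, 0 < f x) -> 0 < int01 f.
Proof.
move=> cf f0; have [c _ cmin] := EVT_min (@ler01 R) (continuous_subspaceT cf).
by apply: lt_le_trans (f0 c) (int01_ge_cst cf _) => x; exact: cmin.
Qed.

Lemma int01_ge_prim f x y : continuous f ->
  (forall z, 0 <= z <= 1 -> 0 <= f z) -> 0 <= x -> x <= y -> y <= 1 ->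
  prim f y - prim f x <= int01 f.
Proof.
move=> cf f0 x0 xy y1; rewrite int01E.
have H u v : 0 <= u -> u <= v -> v <= 1 -> prim f u <= prim f v.
  move=> u0 uv v1; apply: (derive_ge0_le uv (fun z _ => is_derive_prim z cf)).
    apply: continuous_subspaceT => z.
    exact: is_derive_continuous (is_derive_prim z cf).
  by move=> z; rewrite in_itv /= => /andP[? ?]; apply: f0; lra.
have := H 0 x (lexx _) x0 ltac:(lra); have := H y 1 ltac:(lra) y1 (lexx _).
by rewrite prim0; lra.
Qed.

Lemma int01_ge_itv f c x y : continuous f ->
  (forall z, 0 <= z <= 1 -> 0 <= f z) -> 0 <= x -> x <= y -> y <= 1 ->
  (forall z, x <= z <= y -> c <= f z) -> c * (y - x) <= int01 f.
Proof.
move=> cf f0 x0 xy y1 cle.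
apply: le_trans (int01_ge_prim cf f0 x0 xy y1).
have [d dxy ->] := MVT_segment xy (fun z _ => is_derive_prim z cf)
  (continuous_subspaceT (fun z => is_derive_continuous (is_derive_prim z cf))).
by rewrite ler_wpM2r ?subr_ge0//; apply: cle; move: dxy; rewrite in_itv.
Qed.

Lemma cvg_int01 (T : Type) (F : set_system T) (FF : Filter F)
    (h : T -> R -> R) (h0 : R -> R) :
  continuous h0 -> (\forall z \near F, continuous (h z)) ->
  (forall e, 0 < e -> \forall z \near F,
    forall x, 0 <= x <= 1 -> `|h0 x - h z x| <= e) ->
  int01 (h z) @[z --> F] --> int01 h0.
Proof.
move=> ch0 ch hh; apply/cvgrPdist_le => e e0; near=> z.
have chz : continuous (h z) by near: z.
rewrite -int01B//; apply: le_trans (ler_norm_int01 _) _.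
  by move=> x; exact: (continuousB (ch0 x) (chz x)).
rewrite -[leRHS]int01_cst; apply: ler_int01.
- by apply: continuous_norm => x; exact: (continuousB (ch0 x) (chz x)).
- by move=> x; exact: cvg_cst.
- by near: z; exact: hh.
Unshelve. all: by end_near. Qed.

Lemma near_unit_uniform (T : topologicalType) (h : R -> T -> R) z0 :
  (forall x, 0 <= x <= 1 ->
    {for (x, z0), continuous (fun w : R * T => h w.1 w.2)}) ->
  forall e, 0 < e -> \forall z \near z0,
    forall x, 0 <= x <= 1 -> `|h x z0 - h x z| < e.
Proof.
move=> ch e e0.
have /compact_near_coveringP/(_ T (nbhs z0)
  (fun z x => `|h x z0 - h x z| < e) _) := @segment_compact R 0 1.
move=> /(_ _) H; apply: filterS (H _) => [z Az x x01|x].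
  by apply: Az; rewrite /= in_itv.
rewrite /= in_itv /= => x01; have /cvgrPdist_lt/(_ (e / 2)) := ch x x01.
move=> /(_ ltac:(lra)) [[U V] /= [Ux Vz] UV].
exists (U, V) => //= -[y z] /= [Uy Vz'].
have := UV (y, z0) (conj Uy (nbhs_singleton Vz)).
have := UV (y, z) (conj Uy Vz') => /=.
by rewrite !ltr_norml => /andP[? ?] /andP[? ?]; apply/andP; split; lra.
Qed.

Lemma continuous_pair_l (T : topologicalType) (h : R -> T -> R) x z :
  {for (x, z), continuous (fun w : R * T => h w.1 w.2)} ->
  {for x, continuous (h ^~ z)}.
Proof.
move=> ch; exact: (continuous2_cvg _ ch cvg_id (cvg_cst z)).
Qed.

Lemma continuous_pair_r (T : topologicalType) (h : R -> T -> R) x z :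
  {for (x, z), continuous (fun w : R * T => h w.1 w.2)} ->
  {for z, continuous (h x)}.
Proof.
move=> ch; exact: (continuous2_cvg _ ch (cvg_cst x) cvg_id).
Qed.

Lemma continuous_int01 (T : topologicalType) (h : R -> T -> R) :
  continuous (fun w : R * T => h w.1 w.2) ->
  continuous (fun z => int01 (h ^~ z)).
Proof.
move=> ch z0; apply: cvg_int01.
- by move=> x; exact: continuous_pair_l (ch (x, z0)).
- by near=> z => x; exact: continuous_pair_l (ch (x, z)).
- move=> e e0; have := @near_unit_uniform T h z0 (fun x _ => ch _) e e0.
  by apply: filterS => z hz x /hz/ltW.
Unshelve. all: by end_near. Qed.

(** Differentiation under the integral sign: by the mean value theorem the
    difference quotients are values of [d], hence uniformly close to [d t]. *)
Lemma is_derive_int01 (h d : R -> R -> R) t :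
  (\forall s \near t, continuous (h ^~ s)) ->
  (forall x, {for (x, t), continuous (fun w : R * R => d w.1 w.2)}) ->
  (\forall s \near t, forall x, 0 <= x <= 1 -> is_derive (s : R) 1 (h x) (d x s)) ->
  is_derive t 1 (fun s => int01 (h ^~ s)) (int01 (d ^~ t)).
Proof.
move=> ch cd dh.
pose q s x := (h x s - h x t) / (s - t).
apply: (@is_derive1_near _ _ (fun s => int01 (q s))).
  have : \forall s \near t^', continuous (h ^~ s) by exact: nbhs_dnbhs.
  apply: filterS2 (@nbhs_dnbhs_neq _ t) => s st cs.
  have ct : continuous (h ^~ t) by exact: nbhs_singleton ch.
  rewrite -int01B// mulrC -int01Z.
    apply: eq_int01 => x _; rewrite /q mulrC divfK// subr_eq0//.
  by move=> x; exact: (continuousM (continuousB (cs x) (ct x)) (cvg_cst _)).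
apply: cvg_int01.
- by move=> x; exact: continuous_pair_l (cd x).
- have : \forall s \near t^', continuous (h ^~ s) by exact: nbhs_dnbhs.
  apply: filterS => s cs x.
  have ct : continuous (h ^~ t) by exact: nbhs_singleton ch.
  exact: (continuousM (continuousB (cs x) (ct x)) (cvg_cst _)).
- move=> e e0.
  have := @near_unit_uniform R d t (fun x _ => cd x) e e0.
  move=> /(filterI dh) /nbhs_ballP[r /= r0 rd].
  near=> s => x x01.
  have st : s != t by near: s; exact: nbhs_dnbhs_neq.
  have str : `|t - s| < r by near: s; apply: nbhs_dnbhs; exact: nbhsx_ballx.
  have inb c : Num.min t s <= c <= Num.max t s -> ball t r c.
    rewrite /ball /=; move: str; rewrite !ltr_norml => /andP[? ?].
    by case: (leP t s) => ? /andP[? ?]; apply/andP; split; lra.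
  have [c [cts E]] : exists c, Num.min t s <= c <= Num.max t s /\
      h x s - h x t = d x c * (s - t).
    have D u : Num.min t s <= u <= Num.max t s -> is_derive u 1 (h x) (d x u).
      by move=> /inb/rd[+ _]; exact.
    case: (leP t s) => ts in D *.
      have [u||c] := @MVT_segment _ (h x) (d x) t s ts.
      - by rewrite in_itv /= => /andP[? ?]; apply: D; lra.
      - by apply: derivable_within_continuous => u; rewrite in_itv /= => /D[].
      - by rewrite in_itv /=; exists c.
    have [u||c] := @MVT_segment _ (h x) (d x) s t (ltW ts).
    - by rewrite in_itv /= => /andP[? ?]; apply: D; lra.
    - by apply: derivable_within_continuous => u; rewrite in_itv /= => /D[].
    - by rewrite in_itv /=; exists c; split => //; lra.
  rewrite /q E mulfK ?subr_eq0//.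
  by have [_ /(_ x x01)/ltW] := rd c (inb c cts).
Unshelve. all: by end_near. Qed.

End UnitIntegral.

(** * Functions of two variables *)

Section TwoVariables.
Context {R : realType}.
Implicit Types (f g B : R -> R) (G H : R -> R -> R) (x y s t al : R).

Definition continuous2 H := continuous (fun w : R * R => H w.1 w.2).

Lemma continuous2_comp (T : topologicalType) H (f g : T -> R) :
  continuous2 H -> continuous f -> continuous g ->
  continuous (fun z => H (f z) (g z)).
Proof.
by move=> cH cf cg z; exact: (continuous2_cvg _ (cH (f z, g z)) (cf z) (cg z)).
Qed.

Lemma continuous_add (T : topologicalType) (f g : T -> R) :
  continuous f -> continuous g -> continuous (fun z => f z + g z).
Proof. by move=> cf cg z; exact: (cvgD (cf z) (cg z)). Qed.

Lemma continuous_mul (T : topologicalType) (f g : T -> R) :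
  continuous f -> continuous g -> continuous (fun z => f z * g z).
Proof. by move=> cf cg z; exact: (cvgM (cf z) (cg z)). Qed.

Lemma continuous_cst (T : topologicalType) (c : R) :
  continuous (fun _ : T => c).
Proof. by move=> z; exact: cvg_cst. Qed.

Lemma continuous_fst (T U : topologicalType) : continuous (@fst T U).
Proof. by move=> z; exact: cvg_fst. Qed.

Lemma continuous_snd (T U : topologicalType) : continuous (@snd T U).
Proof. by move=> z; exact: cvg_snd. Qed.

Lemma continuous2_l H s : continuous2 H -> continuous (H ^~ s).
Proof. by move=> cH x; exact: continuous_pair_l (cH (x, s)). Qed.

Lemma continuous2_r H x : continuous2 H -> continuous (H x).
Proof. by move=> cH s; exact: continuous_pair_r (cH (x, s)). Qed.

(** A moving endpoint becomes a parameter of the integrand, so that the results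
    on integrals over the unit interval apply to antiderivatives. *)
Lemma prim_scale f x : continuous f ->
  prim f x = x * int01 (fun y => f (x * y)).
Proof.
move=> cf; have cx : continuous (fun y => f (x * y)).
  by move=> y; apply: continuous_comp; [exact: mulrl_continuous|exact: cf].
rewrite -int01Z//.
have dp y : is_derive y 1 (fun z => prim f (x * z)) (x * f (x * y)).
  apply: (is_derive_eq (is_derive1_chain (is_derive_prim (x * y) cf)
    (is_derive1Z x (is_derive1_id y)))).
  by rewrite mulr1 mulrC.
rewrite (@int01_FTC _ _ (fun z => prim f (x * z))).
- by rewrite mulr1 mulr0 prim0 subr0.
- by move=> y; apply: continuousM; [exact: cvg_cst|exact: cx].
- by move=> y; exact: is_derive_continuous (dp y).
Qed.

Lemma continuous2_prim H :
  continuous2 H -> continuous2 (fun x s => prim (H ^~ s) x).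
Proof.
move=> cH; rewrite /continuous2; have -> : (fun w : R * R => prim (H ^~ w.2) w.1) =
    (fun w : R * R => w.1 * int01 (fun y => H (w.1 * y) w.2)).
  by apply/funext => w; rewrite prim_scale//; exact: continuous2_l.
move=> w; apply: continuousM; first exact: cvg_fst.
apply: (@continuous_int01 _ _ (fun y (w : R * R) => H (w.1 * y) w.2)) => //.
have c1 : continuous (fun z : R * (R * R) => z.2.1).
  by move=> z; apply: continuous_comp; [exact: cvg_snd|exact: cvg_fst].
have c2 : continuous (fun z : R * (R * R) => z.2.2).
  by move=> z; apply: continuous_comp; [exact: cvg_snd|exact: cvg_snd].
apply: continuous2_comp => // z.
exact: (continuous_mul c1 (@continuous_fst _ _)).
Qed.

Lemma is_derive_prim_param H H2 x s : continuous2 H -> continuous2 H2 ->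
  (forall al t, is_derive t 1 (H al) (H2 al t)) ->
  is_derive s 1 (fun t => prim (H ^~ t) x) (prim (H2 ^~ s) x).
Proof.
move=> cH cH2 dH.
have cK K : continuous2 K -> continuous2 (fun y t => K (x * y) t).
  move=> cK; apply: (@continuous2_comp _ K (fun w => x * w.1) snd cK).
    exact: (continuous_mul (@continuous_cst _ x) (@continuous_fst _ _)).
  exact: continuous_snd.
have -> : (fun t => prim (H ^~ t) x) =
    (fun t => x * int01 (fun y => H (x * y) t)).
  by apply/funext => t; rewrite prim_scale//; exact: continuous2_l.
rewrite prim_scale; last exact: continuous2_l.
apply: is_derive1Z.
apply: (@is_derive_int01 _ (fun y => H (x * y)) (fun y => H2 (x * y))).
- by near=> t; exact: (@continuous2_l (fun y => H (x * y)) t (cK _ cH)).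
- by move=> y; exact: (cK _ cH2).
- by near=> t => y _; exact: dH.
Unshelve. all: by end_near. Qed.

Lemma derive_gt0_lt f f' : (forall x, is_derive x 1 f (f' x)) ->
  (forall x, 0 < f' x) -> {homo f : x y / x < y}.
Proof.
move=> df f'0 x y xy; have [c [_ E]] := MVTW x y df.
by rewrite -subr_gt0 E mulr_gt0// subr_gt0.
Qed.

(** Both the chain rule and implicit differentiation below start from
    [H (B s) s - H (B s0) s0 = H1 c s * (B s - B s0) + (H (B s0) s - H (B s0) s0)]
    with [c] between [B s0] and [B s]. *)
Lemma mean_value_fst H H1 B s0 : continuous2 H1 ->
  (forall al s, is_derive al 1 (H ^~ s) (H1 al s)) ->
  {for s0, continuous B} ->
  exists2 M : R -> R, {for s0, continuous M} /\ M s0 = H1 (B s0) s0 &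
    forall s, H (B s) s - H (B s0) s = M s * (B s - B s0).
Proof.
move=> cH1 dH cB.
have /choice[c Hc] s : exists c, Num.min (B s0) (B s) <= c <=
    Num.max (B s0) (B s) /\ H (B s) s - H (B s0) s = H1 c s * (B s - B s0).
  exact: (MVTW (B s0) (B s) (fun al => dH al s)).
have cs s : `|B s0 - c s| <= `|B s0 - B s|.
  have [+ _] := Hc s; case: (leP (B s0) (B s)) => BB /andP[? ?].
    by rewrite distrC ger0_norm ?subr_ge0// distrC ger0_norm ?subr_ge0//; lra.
  by rewrite ger0_norm ?subr_ge0// ger0_norm ?subr_ge0 ?(ltW BB)//; lra.
have c0 : c s0 = B s0.
  by apply/eqP; rewrite -subr_eq0 -normr_le0 distrC (le_trans (cs s0))// subrr normr0.
exists (fun s => H1 (c s) s); last by move=> s; have [] := Hc s.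
split; last by rewrite c0.
have cc : c s @[s --> s0] --> c s0.
  apply/cvgrPdist_lt => e e0; rewrite c0.
  move/cvgrPdist_lt : cB => /(_ e e0); apply: filterS => s.
  exact: le_lt_trans (cs s).
exact: (continuous2_cvg _ (cH1 (c s0, s0)) cc cvg_id).
Qed.

Lemma is_derive_chain2 H H1 h2 B b s0 : continuous2 H1 ->
  (forall al s, is_derive al 1 (H ^~ s) (H1 al s)) ->
  is_derive s0 1 (H (B s0)) h2 -> is_derive s0 1 B b ->
  is_derive s0 1 (fun s => H (B s) s) (H1 (B s0) s0 * b + h2).
Proof.
move=> cH1 dH dh2 dB.
have [M [cM <-] HM] := mean_value_fst cH1 dH (is_derive_continuous dB).
apply: (@is_derive1_near _ _ (fun s => M s * ((B s - B s0) / (s - s0)) +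
   (H (B s0) s - H (B s0) s0) / (s - s0))).
  apply: filterS (@nbhs_dnbhs_neq _ s0) => s; rewrite -subr_eq0 => ss0.
  rewrite mulrDl -mulrA !divfK// -HM; ring.
apply: cvgD; last exact: is_derive1_quot.
apply: cvgM; last exact: is_derive1_quot.
by move/continuous_withinNx : cM.
Qed.

Lemma is_derive_implicit H H1 h2 B s0 : continuous2 H1 ->
  (forall al s, is_derive al 1 (H ^~ s) (H1 al s)) ->
  is_derive s0 1 (H (B s0)) h2 -> {for s0, continuous B} ->
  (\forall s \near s0, H (B s) s = H (B s0) s0) -> H1 (B s0) s0 != 0 ->
  is_derive s0 1 B (- h2 / H1 (B s0) s0).
Proof.
move=> cH1 dH dh2 cB HB.
have [M [cM <-] HM] := mean_value_fst cH1 dH cB => M0.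
have Mn0 : \forall s \near s0, M s != 0 by apply: (cvgr_neq0 _ cM).
apply: (@is_derive1_near _ _ (fun s =>
  - ((H (B s0) s - H (B s0) s0) / (s - s0)) / M s)).
  near=> s.
  have ss0 : s - s0 != 0 by rewrite subr_eq0; near: s; exact: nbhs_dnbhs_neq.
  have Ms : M s != 0 by near: s; exact: nbhs_dnbhs.
  have E : H (B s) s = H (B s0) s0 by near: s; exact: nbhs_dnbhs.
  apply: (mulfI Ms); rewrite -HM E.
  by field; rewrite Ms ss0.
apply: cvgM; first by apply: cvgN; exact: is_derive1_quot.
by apply: cvgV => //; move/continuous_withinNx : cM.
Unshelve. all: by end_near. Qed.

End TwoVariables.

(** * A class of smooth functions closed under differentiation *)

Section Tame.
Context {R : realType}.
Implicit Types (f g : R -> R) (H K : R -> R -> R) (x y s t al : R).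

(** The functions of the Lagrangian label [al] and of the parameter [s] from
    which the solution is built.  Smoothness is obtained from the class being
    closed under both partial derivatives, so that no higher derivative has to
    be computed. *)
Inductive tame : (R -> R -> R) -> Prop :=
| tame_cst c : tame (fun _ _ => c)
| tame_cos : tame (fun al _ => cos (2 * pi * al))
| tame_sin : tame (fun al _ => sin (2 * pi * al))
| tame_param : tame (fun _ s => s)
| tame_add H K : tame H -> tame K -> tame (fun al s => H al s + K al s)
| tame_mul H K : tame H -> tame K -> tame (fun al s => H al s * K al s)
| tame_pow H e : tame H -> (forall al s, 0 < H al s) ->
    tame (fun al s => H al s `^ e)
| tame_prim H : tame H -> tame (fun al s => prim (H ^~ s) al)
| tame_at1 H : tame H -> tame (fun _ s => H 1 s).

Lemma is_derive1_cos2pi al :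
  is_derive al 1 (fun x => cos (2 * pi * x)) (- (2 * pi) * sin (2 * pi * al)).
Proof.
apply: (is_derive_eq (is_derive1_chain (is_derive_cos _)
  (is_derive1Z (2 * pi) (is_derive1_id al)))).
by ring.
Qed.

Lemma is_derive1_sin2pi al :
  is_derive al 1 (fun x => sin (2 * pi * x)) (2 * pi * cos (2 * pi * al)).
Proof.
apply: (is_derive_eq (is_derive1_chain (is_derive_sin _)
  (is_derive1Z (2 * pi) (is_derive1_id al)))).
by ring.
Qed.

Lemma is_derive1_pow f x a e : is_derive x 1 f a -> 0 < f x ->
  is_derive x 1 (fun y => f y `^ e) (e * f x `^ (e - 1) * a).
Proof. by move=> dF f0; exact: (is_derive1_chain (is_derive1_powR e f0) dF). Qed.

Lemma tame_continuous H : tame H -> continuous2 H.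
Proof.
elim=> {H}.
- by move=> c; exact: continuous_cst.
- move=> w; apply: (@continuous_comp _ _ _ fst (fun x => cos (2 * pi * x))).
    exact: continuous_fst.
  exact: is_derive_continuous (is_derive1_cos2pi _).
- move=> w; apply: (@continuous_comp _ _ _ fst (fun x => sin (2 * pi * x))).
    exact: continuous_fst.
  exact: is_derive_continuous (is_derive1_sin2pi _).
- exact: continuous_snd.
- by move=> H K _ cH _ cK; exact: continuous_add.
- by move=> H K _ cH _ cK; exact: continuous_mul.
- move=> H e _ cH H0 w.
  apply: (@continuous_comp _ _ _ (fun w : R * R => H w.1 w.2) (@powR R ^~ e)).
    exact: cH.
  exact: is_derive_continuous (is_derive1_powR e (H0 _ _)).
- by move=> H _ cH; exact: continuous2_prim.
- move=> H _ cH; apply: (@continuous2_comp _ _ H (fun=> 1) snd) => //.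
    exact: continuous_cst.
  exact: continuous_snd.
Qed.

Lemma tame_derive H : tame H -> exists H1 H2, [/\ tame H1, tame H2,
  forall al s, is_derive al 1 (H ^~ s) (H1 al s) &
  forall al s, is_derive s 1 (H al) (H2 al s)].
Proof.
have t0 : tame (fun _ _ => 0) by exact: tame_cst.
elim=> {H}.
- move=> c; exists (fun _ _ => 0), (fun _ _ => 0).
  by split => // *; exact: is_derive1_cst.
- exists (fun al _ => - (2 * pi) * sin (2 * pi * al)), (fun _ _ => 0).
  split => //; [|by move=> *; exact: is_derive1_cos2pi|
    by move=> *; exact: is_derive1_cst].
  exact: tame_mul (tame_cst _) tame_sin.
- exists (fun al _ => 2 * pi * cos (2 * pi * al)), (fun _ _ => 0).
  split => //; [|by move=> *; exact: is_derive1_sin2pi|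
    by move=> *; exact: is_derive1_cst].
  exact: tame_mul (tame_cst _) tame_cos.
- exists (fun _ _ => 0), (fun _ _ => 1); split => //; first exact: tame_cst.
  + by move=> *; exact: is_derive1_cst.
  + by move=> *; exact: is_derive1_id.
- move=> H K _ [H1 [H2 [tH1 tH2 dH1 dH2]]] _ [K1 [K2 [tK1 tK2 dK1 dK2]]].
  exists (fun al s => H1 al s + K1 al s), (fun al s => H2 al s + K2 al s).
  split; [exact: tame_add|exact: tame_add| |];
    by move=> al s; apply: is_derive1D.
- move=> H K tH [H1 [H2 [tH1 tH2 dH1 dH2]]] tK [K1 [K2 [tK1 tK2 dK1 dK2]]].
  exists (fun al s => H1 al s * K al s + H al s * K1 al s),
         (fun al s => H2 al s * K al s + H al s * K2 al s).
  split; [by apply: tame_add; exact: tame_mul|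
    by apply: tame_add; exact: tame_mul| |] => al s.
  + exact: (is_derive1M (dH1 al s) (dK1 al s)).
  + exact: (is_derive1M (dH2 al s) (dK2 al s)).
- move=> H e tH [H1 [H2 [tH1 tH2 dH1 dH2]]] H0.
  exists (fun al s => e * H al s `^ (e - 1) * H1 al s),
         (fun al s => e * H al s `^ (e - 1) * H2 al s).
  split.
  + by do 2 apply: tame_mul => //; [exact: tame_cst|exact: tame_pow].
  + by do 2 apply: tame_mul => //; [exact: tame_cst|exact: tame_pow].
  + by move=> al s; exact: is_derive1_pow (dH1 al s) (H0 al s).
  + by move=> al s; exact: is_derive1_pow (dH2 al s) (H0 al s).
- move=> H tH [H1 [H2 [tH1 tH2 dH1 dH2]]].
  exists H, (fun al s => prim (H2 ^~ s) al); split => //.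
  + exact: tame_prim.
  + by move=> al s; apply: is_derive_prim; exact/continuous2_l/tame_continuous.
  + by move=> al s; apply: is_derive_prim_param => //; exact: tame_continuous.
- move=> H tH [H1 [H2 [tH1 tH2 dH1 dH2]]].
  exists (fun _ _ => 0), (fun _ s => H2 1 s); split => //.
  + exact: tame_at1.
  + by move=> *; exact: is_derive1_cst.
Qed.

End Tame.

(** * Inverting a family of increasing diffeomorphisms *)

Section Inverse.
Context {R : realType}.
Implicit Types x y s t al : R.
Variables (D : R -> R -> Prop) (G J : R -> R -> R).
Hypothesis cG : continuous2 G.
Hypothesis cJ : continuous2 J.
Hypothesis dG : forall al s : R, is_derive al 1 (G ^~ s) (J al s).
Hypothesis J0 : forall al s, 0 < J al s.
Hypothesis oD : forall x s, D x s -> \forall w \near (x, s), D w.1 w.2.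
Hypothesis surjG : forall x s, D x s -> exists al, G al s = x.

(** The family may fail to be onto outside [D]; the default value 0 is taken
    there. *)
Definition inverse x s : R := xget 0 [set al | G al s = x].

Lemma inverseK x s : D x s -> G (inverse x s) s = x.
Proof. by move=> Dxs; have := xgetPex 0 (surjG Dxs). Qed.

Lemma incr_fst s : {mono G ^~ s : x y / x < y}.
Proof.
have H : {homo G ^~ s : x y / x < y} by exact: (derive_gt0_lt (dG ^~ s)).
move=> x y; apply/idP/idP; last exact: H.
by case: (ltgtP x y) => // [/H yx /(lt_trans yx)|->]; rewrite ltxx.
Qed.

Lemma inverse_unique al s : inverse (G al s) s = al.
Proof.
have : G (inverse (G al s) s) s = G al s.
  by have := xgetPex 0 (ex_intro (fun be => G be s = G al s) al erefl).
case: (ltgtP (inverse (G al s) s) al) => //;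
  by rewrite -(incr_fst s) => + E; rewrite E ltxx.
Qed.

(** Monotonicity traps the inverse image between [al - e] and [al + e] as soon as
    [G] at these two points stays on either side of [y]. *)
Lemma continuous2_inverse x s : D x s ->
  {for (x, s), continuous (fun w : R * R => inverse w.1 w.2)}.
Proof.
move=> Dxs; apply/cvgrPdist_lt => e e0 /=; set al := inverse x s.
have lo : G (al - e) s < x by rewrite -[ltRHS](inverseK Dxs) incr_fst -/al; lra.
have hi : x < G (al + e) s by rewrite -[ltLHS](inverseK Dxs) incr_fst -/al; lra.
have c1 (be : R) : continuous (fun w : R * R => G be w.2 - w.1).
  move=> w; apply: cvgB; last exact: cvg_fst.
  apply: (continuous2_comp cG (f := fun=> be) (g := snd)).
    exact: continuous_cst.
  exact: continuous_snd.
have L : \forall w \near (x, s), G (al - e) w.2 - w.1 < 0.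
  by apply: (cvgr_lt _ (c1 (al - e) (x, s))); rewrite subr_lt0.
have U : \forall w \near (x, s), 0 < G (al + e) w.2 - w.1.
  by apply: (cvgr_gt _ (c1 (al + e) (x, s))); rewrite subr_gt0.
apply: filterS3 (oD Dxs) L U => -[y t] /= Dyt; rewrite subr_lt0 subr_gt0.
rewrite -{1 2}(inverseK Dyt) !incr_fst => ? ?.
by rewrite ltr_norml; apply/andP; split; lra.
Qed.

Lemma inverse_near_fst x s : D x s -> \forall y \near x, D y s.
Proof.
move=> /oD[[U V] /= [Ux Vs] UV]; apply: filterS Ux => y Uy.
exact: (UV (y, s) (conj Uy (nbhs_singleton Vs))).
Qed.

Lemma is_derive_inverse_fst x s : D x s ->
  is_derive x 1 (inverse ^~ s) (J (inverse x s) s)^-1.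
Proof.
move=> Dxs; apply: (is_derive_eq (@is_derive_implicit _ (fun al y => G al s - y)
  (fun al _ => J al s) (-1) (inverse ^~ s) x _ _ _ _ _ _)).
- apply: (@continuous2_comp _ _ J fst (fun=> s)) => //.
    exact: continuous_fst.
  exact: continuous_cst.
- move=> al y; apply: (is_derive_eq (is_derive1B (dG al s) (is_derive1_cst y al))).
  by rewrite subr0.
- apply: (is_derive_eq (is_derive1B (is_derive1_cst _ x) (is_derive1_id x))).
  by rewrite sub0r.
- exact: (continuous_pair_l (continuous2_inverse Dxs)).
- by apply: filterS (inverse_near_fst Dxs) => y Dy; rewrite !inverseK// !subrr.
- by rewrite gt_eqF.
- by rewrite opprK mul1r.
Qed.

Lemma is_derive_inverse_snd x s g2 : D x s ->
  (\forall t \near s, D x t) -> is_derive s 1 (G (inverse x s)) g2 ->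
  is_derive s 1 (inverse x) (- g2 / J (inverse x s) s).
Proof.
move=> Dxs Dxt dg2; apply: (@is_derive_implicit _ G) => //.
- exact: (continuous_pair_r (continuous2_inverse Dxs)).
- by apply: filterS Dxt => t Dt; rewrite !inverseK.
- by rewrite gt_eqF.
Qed.

End Inverse.

(** * The explicit solution in Lagrangian variables *)

Section Profile.
Context {R : realType}.
Implicit Types (f : R -> R) (x y s t al e : R).

Lemma sin2piD1 al : sin (2 * pi * (al + 1)) = sin (2 * pi * al) :> R.
Proof. by rewrite mulrDr mulr1 (mulr_natl pi 2) sinD2pi. Qed.

Lemma cos2piD1 al : cos (2 * pi * (al + 1)) = cos (2 * pi * al) :> R.
Proof. by rewrite mulrDr mulr1 (mulr_natl pi 2) cosD2pi. Qed.

Lemma prim_periodic f x : continuous f -> (forall y, f (y + 1) = f y) ->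
  prim f (x + 1) = prim f x + prim f 1.
Proof.
move=> cf pf; pose g y := prim f (y + 1) - prim f y.
suff : g x = g 0 by rewrite /g add0r prim0; lra.
apply: is_derive_0_is_cst => y.
have dp : is_derive y 1 (fun z => z + 1) 1.
  by apply: (is_derive_eq (is_derive1D (is_derive1_id y) (is_derive1_cst 1 y)));
    rewrite addr0.
have D := is_derive1_chain (f := prim f) (g := fun z => z + 1) (is_derive_prim (y + 1) cf) dp.
apply: (is_derive_eq (is_derive1B D (is_derive_prim y cf))).
by rewrite mulr1 pf subrr.
Qed.

Variable a : R.

(** The whole solution is built from this function of the label and of a
    parameter [s] replacing time: powers of [1 / q] give the Jacobian of the flow
    and the density.  As [s] grows, [q] stays near 1 only within a distance of
    order [1 / s] of the zeros of the sine. *)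
Definition q al s := 1 + s * s * (sin (2 * pi * al) * sin (2 * pi * al)).

Definition q_s al s := 2 * s * (sin (2 * pi * al) * sin (2 * pi * al)).

Lemma q_ge1 al s : 1 <= q al s.
Proof. by rewrite lerDl mulr_ge0// -expr2 sqr_ge0. Qed.

Lemma q_gt0 al s : 0 < q al s.
Proof. exact: lt_le_trans ltr01 (q_ge1 al s). Qed.

Lemma qD1 al s : q (al + 1) s = q al s.
Proof. by rewrite /q sin2piD1. Qed.

Lemma is_derive_q al s : is_derive s 1 (q al) (q_s al s).
Proof.
apply: (is_derive_eq (is_derive1D (is_derive1_cst 1 s) (is_derive1M
  (is_derive1M (is_derive1_id s) (is_derive1_id s)) (is_derive1_cst _ s)))).
by rewrite /q_s; ring.
Qed.

Lemma tame_sin2 :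
  tame (fun al _ : R => sin (2 * pi * al) * sin (2 * pi * al)).
Proof.
exact: tame_mul tame_sin tame_sin.
Qed.

Lemma tame_q : tame q.
Proof.
exact: tame_add (tame_cst 1) (tame_mul (tame_mul tame_param tame_param)
  tame_sin2).
Qed.

Lemma tame_q_s : tame q_s.
Proof.
exact: tame_mul (tame_mul (tame_cst 2) tame_param) tame_sin2.
Qed.

Lemma tame_qpow e : tame (fun al s => q al s `^ e).
Proof. exact: tame_pow tame_q q_gt0. Qed.

Lemma continuous_qpow e s : continuous (fun al => q al s `^ e).
Proof. exact: (@continuous2_l _ _ s (tame_continuous (tame_qpow e))). Qed.

(** Normalises the Jacobian so that the flow maps a period onto a period. *)
Definition k s := int01 (fun al => q al s `^ (- a)).

Definition k_s s := int01 (fun al => - a * q al s `^ (- a - 1) * q_s al s).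

Lemma k_gt0 s : 0 < k s.
Proof.
by apply: int01_gt0 => [|al]; [exact: continuous_qpow|rewrite powR_gt0 ?q_gt0].
Qed.

Lemma tame_k : tame (fun _ s => k s).
Proof.
have -> : (fun _ s : R => k s) =
    (fun _ s : R => (fun al t => prim (fun be => q be t `^ (- a)) al) 1 s).
  by apply/funext => al; apply/funext => s; rewrite /k int01E.
exact: tame_at1 (tame_prim (tame_qpow _)).
Qed.

Lemma tame_kpow e : tame (fun _ s => k s `^ e).
Proof. exact: (tame_pow e tame_k (fun _ s => k_gt0 s)). Qed.

Lemma tame_qpow_s : tame (fun al s => - a * q al s `^ (- a - 1) * q_s al s).
Proof.
exact: tame_mul (tame_mul (tame_cst (- a)) (tame_qpow _)) tame_q_s.
Qed.

Lemma tame_k_s : tame (fun _ s => k_s s).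
Proof.
have -> : (fun _ s : R => k_s s) = (fun _ s : R => (fun al t =>
    prim (fun be => - a * q be t `^ (- a - 1) * q_s be t) al) 1 s).
  by apply/funext => al; apply/funext => s; rewrite /k_s int01E.
exact: tame_at1 (tame_prim tame_qpow_s).
Qed.

Lemma is_derive_k s : is_derive s 1 k (k_s s).
Proof.
rewrite /k_s int01E; have -> : k = fun t => prim (fun al => q al t `^ (- a)) 1.
  by apply/funext => t; rewrite /k int01E.
apply: (@is_derive_prim_param _ (fun al s => q al s `^ (- a))
  (fun al s => - a * q al s `^ (- a - 1) * q_s al s)).
- exact: tame_continuous (tame_qpow _).
- exact: tame_continuous tame_qpow_s.
- by move=> al t; exact: is_derive1_pow (is_derive_q al t) (q_gt0 al t).
Qed.

Definition m s := k_s s * k s `^ (-1).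

Lemma tame_m : tame (fun _ s => m s).
Proof. exact: tame_mul tame_k_s (tame_kpow _). Qed.

Lemma powRN1 x : 0 < x -> x `^ (-1) = x^-1.
Proof. by move=> x0; rewrite powR_inv1// ltW. Qed.

Lemma powRB1 e x : 0 < x -> x `^ (e - 1) = x `^ e / x.
Proof. by move=> x0; rewrite powRB ?(gt_eqF x0) ?implybT ?powRr1 ?ltW. Qed.

(** The Jacobian of the flow map, and the flow map itself. *)
Definition jac al s := q al s `^ (- a) * k s `^ (-1).

Lemma jacE al s : jac al s = q al s `^ (- a) * k s `^ (-1). Proof. by []. Qed.

Definition flow al s := prim (jac ^~ s) al.

Definition jac_s al s := jac al s * (- a * (q_s al s * q al s `^ (-1)) - m s).

Definition flow_s al s := prim (jac_s ^~ s) al.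

Lemma jac_gt0 al s : 0 < jac al s.
Proof. by rewrite mulr_gt0// powR_gt0 ?q_gt0 ?k_gt0. Qed.

Lemma tame_jac : tame jac.
Proof. exact: tame_mul (tame_qpow _) (tame_kpow _). Qed.

(** The logarithmic derivative of the Jacobian with respect to [s], that is, the
    velocity gradient per unit of the parameter. *)
Definition strain al s := - a * (q_s al s * q al s `^ (-1)) - m s.

Lemma tame_strain : tame strain.
Proof.
have -> : strain = fun al s =>
    - a * (q_s al s * q al s `^ (-1)) + (-1) * m s.
  by apply/funext => al; apply/funext => s; rewrite /strain mulN1r.
apply: (tame_add (H := fun al s => - a * (q_s al s * q al s `^ (-1)))
  (K := fun _ s => -1 * m s)); last exact: tame_mul (tame_cst _) tame_m.
exact: (tame_mul (tame_cst (- a)) (tame_mul tame_q_s (tame_qpow _))).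
Qed.

Lemma tame_jac_s : tame jac_s.
Proof. exact: tame_mul tame_jac tame_strain. Qed.

Lemma tame_flow : tame flow.
Proof. exact: tame_prim tame_jac. Qed.

Lemma tame_flow_s : tame flow_s.
Proof. exact: tame_prim tame_jac_s. Qed.

Lemma is_derive_jac al s : is_derive s 1 (jac al) (jac_s al s).
Proof.
apply: (is_derive_eq (is_derive1M
  (is_derive1_pow (- a) (is_derive_q al s) (q_gt0 al s))
  (is_derive1_pow (-1) (is_derive_k s) (k_gt0 s)))).
rewrite /jac_s /jac /m.
have q0 := q_gt0 al s; have k0 := k_gt0 s.
rewrite (powRB1 (- a) q0) (powRB1 (-1) k0) !powRN1//; field.
by rewrite !gt_eqF.
Qed.

Lemma is_derive_flow al s : is_derive al 1 (flow ^~ s) (jac al s).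
Proof.
by apply: is_derive_prim; exact: (@continuous2_l _ _ s (tame_continuous tame_jac)).
Qed.

Lemma is_derive_flow_param al s : is_derive s 1 (flow al) (flow_s al s).
Proof.
apply: is_derive_prim_param; first exact: tame_continuous tame_jac.
  exact: tame_continuous tame_jac_s.
exact: is_derive_jac.
Qed.

Lemma jacD1 al s : jac (al + 1) s = jac al s.
Proof. by rewrite /jac qD1. Qed.

Lemma flow1 s : flow 1 s = 1.
Proof.
rewrite /flow -int01E /jac.
rewrite (@eq_int01 _ _ (fun al => k s `^ (-1) * q al s `^ (- a))); last first.
  by move=> al _; rewrite mulrC.
rewrite int01Z; last exact: continuous_qpow.
by rewrite -/(k s) powRN1 ?k_gt0// mulVf// gt_eqF// k_gt0.
Qed.

Lemma flowD1 al s : flow (al + 1) s = flow al s + 1.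
Proof.
have cj : continuous (jac ^~ s).
  exact: (@continuous2_l _ _ s (tame_continuous tame_jac)).
by have := prim_periodic al cj (jacD1 ^~ s); rewrite -!/(flow _ _) flow1.
Qed.

Lemma flow0 s : flow 0 s = 0.
Proof. exact: prim0. Qed.

(** Read off from [flowD1], whose additive constant does not depend on [s]. *)
Lemma flow_sD1 al s : flow_s (al + 1) s = flow_s al s.
Proof.
have E : flow (al + 1) = fun t => flow al t + 1.
  by apply/funext => t; exact: flowD1.
apply: (is_derive1_unique (is_derive_flow_param (al + 1) s)); rewrite E.
apply: (is_derive_eq (is_derive1D (is_derive_flow_param al s) (is_derive1_cst 1 s))).
by rewrite addr0.
Qed.

Lemma flow_nat n s : flow n%:R s = n%:R /\ flow (- n%:R) s = - n%:R.
Proof.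
elim: n => [|n [IH1 IH2]]; first by rewrite oppr0 flow0.
have nS : n.+1%:R = n%:R + 1 :> R by rewrite -addn1 natrD.
split; first by rewrite nS flowD1 IH1.
have := flowD1 (- n.+1%:R) s; rewrite nS opprD addrNK IH2; lra.
Qed.

Lemma flow_surj x s : exists al, flow al s = x.
Proof.
have [n xn] : exists n : nat, `|x| < n%:R.
  by exists (Num.bound `|x|); exact: archi_boundP (normr_ge0 x).
move: xn; rewrite ltr_norml => /andP[nx xn].
have n0 : (- n%:R : R) <= n%:R by lra.
have [f1 f2] := flow_nat n s.
have [||al _ E] := IVT (f := flow ^~ s) (v := x) n0.
- apply: continuous_subspaceT => al.
  exact: is_derive_continuous (is_derive_flow al s).
- by rewrite f1 f2 (min_idPl n0) (max_idPr n0) !ltW.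
- by exists al.
Qed.

End Profile.

(** * The explicit solution in Eulerian variables *)

Section Eulerian.
Context {R : realType}.
Implicit Types (f : R -> R) (H : R -> R -> R) (x y s t al e : R).
Variables (a sigma : R).
Hypothesis a_neq0 : a != 0.
Local Notation k := (k a).
Local Notation m := (m a).
Local Notation jac := (jac a).
Local Notation flow := (flow a).
Local Notation flow_s := (flow_s a).
Local Notation strain := (strain a).

(** [speed] is ds/dt, the rate of the parameter with respect to time, and
    [tau] is the time as a function of the parameter. *)
Definition speed s := (1 + s * s) `^ 2^-1 * k s `^ (- a^-1).

Definition tau_s s := (1 + s * s) `^ (- 2^-1) * k s `^ a^-1.

Definition tau s := prim tau_s s.

Definition Tmax := sup (range tau).

Lemma sq1_gt0 s : 0 < 1 + s * s.
Proof. by rewrite ltr_pwDl// -expr2 sqr_ge0. Qed.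

Lemma speed_gt0 s : 0 < speed s.
Proof. by rewrite mulr_gt0// powR_gt0 ?sq1_gt0 ?k_gt0. Qed.

Lemma tau_sE s : tau_s s = (speed s)^-1.
Proof. by rewrite /tau_s /speed invfM -!powRN opprK. Qed.

Lemma tau_s_gt0 s : 0 < tau_s s.
Proof. by rewrite tau_sE invr_gt0 speed_gt0. Qed.

Lemma tame_sq1 e : tame (fun _ s : R => (1 + s * s) `^ e).
Proof.
exact: tame_pow e (tame_add (tame_cst 1) (tame_mul tame_param tame_param))
  (fun _ s => sq1_gt0 s).
Qed.

Lemma tame_speed : tame (fun _ s => speed s).
Proof. exact: tame_mul (tame_sq1 _) (tame_kpow _ _). Qed.

Lemma continuous_tau_s : continuous tau_s.
Proof.
have ct := tame_continuous (tame_mul (tame_sq1 (- 2^-1)) (tame_kpow a a^-1)).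
exact: (@continuous2_r _ _ 0 ct).
Qed.

Lemma is_derive_tau s : is_derive s 1 tau (tau_s s).
Proof. exact: is_derive_prim continuous_tau_s. Qed.

Lemma tau_incr : {mono tau : x y / x < y}.
Proof.
exact: (@incr_fst _ (fun s _ => tau s) (fun s _ => tau_s s)
  (fun s _ => is_derive_tau s) (fun s _ => tau_s_gt0 s) 0).
Qed.

Lemma tau0 : tau 0 = 0. Proof. exact: prim0. Qed.

Hypothesis tau_bounded : has_ubound (range tau).

Lemma tau_lt_Tmax s : tau s < Tmax.
Proof.
apply: (@lt_le_trans _ _ (tau (s + 1))); first by rewrite tau_incr; lra.
by apply: sup_upper_bound; [split => //; exists (tau 0), 0|exists (s + 1)].
Qed.

Lemma Tmax_gt0 : 0 < Tmax.
Proof. by rewrite -tau0 tau_lt_Tmax. Qed.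

(** The times at which the explicit solution is defined; negative times are
    included so that all time derivatives below are two-sided. *)
Definition lifespan t := tau (-1) < t < Tmax.

Lemma lifespanW t : 0 <= t < Tmax -> lifespan t.
Proof.
move=> /andP[t0 tT]; rewrite /lifespan tT andbT (lt_le_trans _ t0)//.
by rewrite -[ltRHS]tau0 tau_incr; lra.
Qed.

Lemma near_lifespan t : lifespan t -> \forall t' \near t, lifespan t'.
Proof.
move=> /andP[t1 t2]; near=> t'; apply/andP; split; near: t'.
  exact: lt_nbhsr.
exact: lt_nbhsl.
Unshelve. all: by end_near. Qed.

Lemma tau_surj t : lifespan t -> exists s, tau s = t.
Proof.
move=> /andP[t1 t2].
have [_ [s _ <-] ts] : exists2 y, range tau y & t < y.
  by apply: sup_gt => //; exists (tau 0), 0.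
have s1 : -1 <= s by apply: ltW; rewrite -tau_incr (lt_trans t1).
have tts : tau (-1) <= tau s by rewrite ltW// (lt_trans t1).
have [||s' _ E] := @IVT _ tau (-1) s t s1.
- by apply: continuous_subspaceT => y; exact: is_derive_continuous (is_derive_tau y).
- by rewrite (min_idPl tts) (max_idPr tts) !ltW.
- by exists s'.
Qed.

Definition param t : R := inverse (fun s _ => tau s) t 0.

Let D2 (t _ : R) := lifespan t.

Let D2_open t y : D2 t y -> \forall w \near (t, y), D2 w.1 w.2.
Proof.
move=> /near_lifespan N; exact: (@continuous_fst R R (t, y) _ N).
Qed.

Let tau_surj2 t y : D2 t y -> exists s, (fun s _ => tau s) s y = t.
Proof. exact: tau_surj. Qed.

Let c2tau : continuous2 (fun s (_ : R) => tau s).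
Proof.
move=> w; apply: (@continuous_comp _ _ _ fst tau); first exact: continuous_fst.
exact: is_derive_continuous (is_derive_tau _).
Qed.

Let c2tau_s : continuous2 (fun s (_ : R) => tau_s s).
Proof.
move=> w; apply: (@continuous_comp _ _ _ fst tau_s); first exact: continuous_fst.
exact: continuous_tau_s.
Qed.

Lemma paramK t : lifespan t -> tau (param t) = t.
Proof. exact: (@inverseK _ D2 _ tau_surj2 t 0). Qed.

Lemma tauK s : param (tau s) = s.
Proof.
exact: (@inverse_unique _ _ _
  (fun s _ => is_derive_tau s) (fun s _ => tau_s_gt0 s) s 0).
Qed.

Lemma param0 : param 0 = 0.
Proof. by rewrite -[X in param X]tau0 tauK. Qed.

Lemma is_derive_param t : lifespan t -> is_derive t 1 param (speed (param t)).
Proof.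
move=> Dt.
have := @is_derive_inverse_fst _ D2 _ _ c2tau c2tau_s
  (fun s _ => is_derive_tau s) (fun s _ => tau_s_gt0 s) D2_open tau_surj2 t 0 Dt.
by rewrite tau_sE invrK.
Qed.

(** Back-to-labels map. *)
Definition label x s : R := inverse flow x s.

Let labelD (x s : R) : exists al, flow al s = x := flow_surj a x s.

Lemma labelK x s : flow (label x s) s = x.
Proof. exact: (@inverseK _ (fun _ _ => True) flow (fun x s _ => labelD x s) x s I). Qed.

Lemma label_unique al s : label (flow al s) s = al.
Proof. exact: (inverse_unique (is_derive_flow a) (jac_gt0 a)). Qed.

Lemma labelD1 x s : label (x + 1) s = label x s + 1.
Proof. by rewrite -[RHS](label_unique _ s) flowD1 labelK. Qed.

Let openT (x s : R) : True -> \forall w \near (x, s), True.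
Proof. by move=> _; exact: filterT. Qed.

Let cflow : continuous2 flow. Proof. exact: tame_continuous (tame_flow a). Qed.
Let cjac : continuous2 jac. Proof. exact: tame_continuous (tame_jac a). Qed.

Lemma continuous2_label : continuous2 label.
Proof.
move=> [x s]; exact: (@continuous2_inverse _ (fun _ _ => True) _ _ cflow
  (is_derive_flow a) (jac_gt0 a) openT (fun x s _ => labelD x s) x s I).
Qed.

Lemma is_derive_label x s :
  is_derive x 1 (label ^~ s) (jac (label x s) s)^-1.
Proof.
exact: (@is_derive_inverse_fst _ (fun _ _ => True) _ _ cflow cjac
  (is_derive_flow a) (jac_gt0 a) openT (fun x s _ => labelD x s) x s I).
Qed.

Lemma is_derive_label_param x s : is_derive s 1 (label x)
  (- flow_s (label x s) s / jac (label x s) s).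
Proof.
apply: (@is_derive_inverse_snd _ (fun _ _ => True) _ _ cflow cjac
  (is_derive_flow a) (jac_gt0 a) openT (fun x s _ => labelD x s) x s _ I).
  exact: filterT.
exact: is_derive_flow_param.
Qed.

(** The passage from Lagrangian to Eulerian variables. *)
Definition eul H x t := H (label x (param t)) (param t).

Lemma eulE H x t : eul H x t = H (label x (param t)) (param t). Proof. by []. Qed.

Lemma eulD1 H x t : (forall al s, H (al + 1) s = H al s) ->
  eul H (x + 1) t = eul H x t.
Proof. by move=> pH; rewrite /eul labelD1 pH. Qed.

Lemma continuous_eul H x t : continuous2 H -> lifespan t ->
  {for (x, t), continuous (fun w : R * R => eul H w.1 w.2)}.
Proof.
move=> cH Dt.
have cp : {for (x, t), continuous (fun w : R * R => param w.2)}.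
  apply: (@continuous_comp _ _ _ snd param); first exact: continuous_snd.
  exact: is_derive_continuous (is_derive_param Dt).
have cl : {for (x, t), continuous (fun w : R * R => label w.1 (param w.2))}.
  exact: (continuous2_cvg _ (@continuous2_label (x, param t)) cvg_fst cp).
exact: (continuous2_cvg _ (cH (label x (param t), param t)) cl cp).
Qed.

Lemma is_derive_eul_x H H1 x t :
  (forall al s, is_derive al 1 (H ^~ s) (H1 al s)) ->
  is_derive x 1 (eul H ^~ t)
    (eul (fun al s => H1 al s * jac al s `^ (-1)) x t).
Proof.
move=> dH; rewrite /eul powRN1 ?jac_gt0//.
exact: (is_derive1_chain (f := H ^~ (param t)) (dH _ _) (is_derive_label x (param t))).
Qed.

(** The label of a fixed point [x] moves with velocity [- flow_s / jac]. *)
Lemma is_derive_eul_t H H1 H2 x t : lifespan t -> continuous2 H1 ->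
  (forall al s, is_derive al 1 (H ^~ s) (H1 al s)) ->
  (forall al s, is_derive s 1 (H al) (H2 al s)) ->
  is_derive t 1 (eul H x)
    (eul (fun al s => speed s *
       (H2 al s + (-1) * (H1 al s * (flow_s al s * jac al s `^ (-1))))) x t).
Proof.
move=> Dt cH1 dH1 dH2.
have dB := is_derive_chain2 cH1 dH1 (dH2 _ _) (is_derive_label_param x (param t)).
apply: (is_derive_eq (is_derive1_chain (f := fun s => H (label x s) s) dB
  (is_derive_param Dt))).
rewrite /eul powRN1 ?jac_gt0//; ring.
Qed.

Lemma tame_jacV : tame (fun al s => jac al s `^ (-1)).
Proof. exact: tame_pow (-1) (tame_jac a) (jac_gt0 a). Qed.

(** Closure of the class under the Eulerian derivatives: smoothness of the
    solution of every order follows by induction. *)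
Lemma tame_eul_derive H : tame H -> exists HX HT, [/\ tame HX, tame HT,
  forall x t, is_derive x 1 (eul H ^~ t) (eul HX x t) &
  forall x t, lifespan t -> is_derive t 1 (eul H x) (eul HT x t)].
Proof.
move=> /tame_derive[H1 [H2 [tH1 tH2 dH1 dH2]]].
eexists; eexists; split; last first.
- move=> x t Dt; exact: (is_derive_eul_t x Dt (tame_continuous tH1) dH1 dH2).
- by move=> x t; exact: (is_derive_eul_x x t dH1).
- apply: (tame_mul tame_speed); apply: (tame_add tH2).
  apply: (tame_mul (tame_cst (-1))); apply: (tame_mul tH1).
  exact: (tame_mul (tame_flow_s a) tame_jacV).
- exact: (tame_mul tH1 tame_jacV).
Qed.

Definition vel al s := flow_s al s * speed s.

Definition grad al s := strain al s * speed s.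

(** Along particle paths [rho / jac `^ (2 * lambda)] is constant by the second
    equation, and [2 * lambda = a^-1]. *)
Definition dens al s :=
  sigma * cos (2 * pi * al) * (k s `^ (- a^-1) * q al s `^ (-1)).

Lemma tame_vel : tame vel.
Proof. exact: tame_mul (tame_flow_s a) tame_speed. Qed.

Lemma tame_grad : tame grad.
Proof. exact: tame_mul (tame_strain a) tame_speed. Qed.

Lemma tame_dens : tame dens.
Proof.
exact: tame_mul (tame_mul (tame_cst sigma) tame_cos)
  (tame_mul (tame_kpow _ _) (tame_qpow _)).
Qed.

(** Along particle paths only the parameter moves. *)
Lemma material_derivative H H2 hx ht x t : lifespan t -> tame H ->
  (forall al s, is_derive s 1 (H al) (H2 al s)) ->
  is_derive x 1 (eul H ^~ t) hx -> is_derive t 1 (eul H x) ht ->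
  ht + eul vel x t * hx = eul (fun al s => speed s * H2 al s) x t.
Proof.
move=> Dt tH dH2 dhx dht.
have [H1 [_ [tH1 _ dH1 _]]] := tame_derive tH.
rewrite (is_derive1_unique dhx (is_derive_eul_x x t dH1)).
rewrite (is_derive1_unique dht (is_derive_eul_t x Dt (tame_continuous tH1) dH1 dH2)).
by rewrite /eul /vel; ring.
Qed.

Lemma is_derive_vel x t : is_derive x 1 (eul vel ^~ t) (eul grad x t).
Proof.
have dv al s : is_derive al 1 (vel ^~ s) (jac_s a al s * speed s).
  have df : is_derive al 1 (flow_s ^~ s) (jac_s a al s).
    apply: is_derive_prim.
    exact: (@continuous2_l _ _ s (tame_continuous (tame_jac_s a))).
  apply: (is_derive_eq (is_derive1M df (is_derive1_cst (speed s) al))).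
  by rewrite mulr0 addr0.
apply: (is_derive_eq (is_derive_eul_x x t dv)).
rewrite /eul /grad /jac_s -/(strain _ _) powRN1 ?jac_gt0//; field.
by rewrite gt_eqF ?jac_gt0.
Qed.

End Eulerian.

(** * One-sided derivatives *)

Section Within.
Context {R : realType}.
Implicit Types (f g : R -> R) (A : set R) (x y t a : R).

Lemma proper_within A x : (forall e, 0 < e -> exists y, [/\ A y, y != x & `|x - y| < e]) ->
  ProperFilter (within A x^').
Proof.
move=> H; apply: Build_ProperFilter => /nbhs_ballP[e /= e0 eP].
by have [y [Ay yx xy]] := H e e0; exact: (eP y).
Qed.

Lemma proper_within01 x : 0 <= x <= 1 -> ProperFilter (within `[0, 1] x^').
Proof.
move=> /andP[x0 x1]; apply: proper_within => e e0.
pose d := Num.min (e / 2) (1 / 2).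
have d0 : 0 < d by rewrite lt_min; apply/andP; split; lra.
have de : d < e by rewrite gt_min; apply/orP; left; lra.
have d1 : d <= 1 / 2 by rewrite ge_min lexx orbT.
have [x2|x2] := leP x (1 / 2).
  exists (x + d); split; first by rewrite /= in_itv /=; apply/andP; split; lra.
    by rewrite gt_eqF//; lra.
  by rewrite opprD addNKr normrN gtr0_norm.
exists (x - d); split; first by rewrite /= in_itv /=; apply/andP; split; lra.
  by rewrite lt_eqF//; lra.
by rewrite opprB addrC subrK gtr0_norm.
Qed.

Lemma proper_within0y t : 0 <= t -> ProperFilter (within `[0, +oo[ t^').
Proof.
move=> t0; apply: proper_within => e e0; exists (t + e / 2); split.
- by rewrite /= in_itv /= andbT; lra.
- by rewrite gt_eqF//; lra.
- by rewrite opprD addNKr normrN gtr0_norm; lra.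
Qed.

(** One-sided derivatives of a function are computed from a two-sided derivative
    of an extension of it beyond the endpoints. *)
Lemma derive_withinP A f g x a : ProperFilter (within A x^') -> A x ->
  (\forall y \near x, A y -> f y = g y) -> is_derive x 1 g a ->
  derivable_within A f x /\ derive_within A f x = a.
Proof.
move=> PF Ax fg dg.
have fa : quot_within A f x --> a.
  have ga : (g y - g x) / (y - x) @[y --> within A x^'] --> a.
    exact: cvg_within_filter (is_derive1_quot dg).
  apply: cvg_trans ga; apply: near_eq_cvg.
  have fgx : f x = g x by exact: (nbhs_singleton fg).
  rewrite /within /=; apply: nbhs_dnbhs.
  by apply: filterS fg => y /[swap] Ay ->//; rewrite fgx.
by split; [apply/cvg_ex; exists a|apply: cvg_lim fa].
Qed.

(** In the other direction, needed for the solutions of which nothing is known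
    but the equations. *)
Lemma is_derive_within A f x : nbhs x A -> derivable_within A f x ->
  is_derive x 1 f (derive_within A f x).
Proof.
move=> Ax df; apply: (@is_derive1_near _ _ (fun y => (f y - f x) / (y - x))).
  near=> y; rewrite divfK// subr_eq0; near: y; exact: nbhs_dnbhs_neq.
have /= H : quot_within A f x --> derive_within A f x by exact: df.
move=> P /H wP; have Ax' : x^' A by exact: nbhs_dnbhs.
change (x^' (fun y => A y -> P ((f y - f x) / (y - x)))) in wP.
change (x^' (fun y => P ((f y - f x) / (y - x)))).
by apply: filterS (filterI wP Ax') => y [PA Ay]; exact: PA.
Unshelve. all: by end_near. Qed.

End Within.

(** * The explicit functions solve the system *)

Section Solution.
Context {R : realType}.
Implicit Types (f : R -> R -> R) (H : R -> R -> R) (x y s t al e : R).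
Variable a : R.
Local Notation T := (Tmax a).
Local Notation eul := (eul a).

Lemma lifespan_itv t : t \in `[0, T[ -> lifespan a t.
Proof. by rewrite in_itv /=; exact: lifespanW. Qed.

Lemma eul_dx H HX f x t : (forall x, is_derive x 1 (eul H ^~ t) (eul HX x t)) ->
  (forall x, x \in `[0, 1] -> f x t = eul H x t) -> x \in `[0, 1] ->
  derivable_within `[0, 1] (fun y => f y t) x /\ dx f x t = eul HX x t.
Proof.
move=> dH fH x01; apply: derive_withinP (dH x) => //.
  by apply: proper_within01; move: x01; rewrite in_itv.
by near=> y; exact: fH.
Unshelve. all: by end_near. Qed.

Lemma eul_dt H HT f x t : 0 <= t < T ->
  is_derive t 1 (eul H x) (eul HT x t) ->
  (forall t, t \in `[0, T[ -> f x t = eul H x t) ->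
  derivable_within `[0, +oo[ (fun s => f x s) t /\ dt f x t = eul HT x t.
Proof.
move=> /andP[t0 tT] dH fH; apply: derive_withinP dH => //.
- exact: proper_within0y.
- by rewrite /= in_itv /= t0.
- have : \forall s \near t, s < T by exact: lt_nbhsl.
  apply: filterS => s sT; rewrite /= in_itv /= andbT => s0.
  by apply: fH; rewrite in_itv /= s0.
Qed.

Lemma continuous_within_eul H f : tame H ->
  (forall x t, x \in `[0, 1] -> t \in `[0, T[ -> f x t = eul H x t) ->
  {within `[0, 1] `*` `[0, T[, continuous (fun z : R * R => f z.1 z.2)}.
Proof.
move=> tH fH.
have cE : {within `[0, 1] `*` `[0, T[,
    continuous (fun z : R * R => eul H z.1 z.2)}.
  apply: continuous_in_subspaceT => -[x t].
  rewrite inE /= => -[_ /lifespan_itv Dt].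
  by apply: continuous_eul => //; exact: tame_continuous.
apply: subspace_eq_continuous cE => -[x t]; rewrite inE /= => -[? ?].
by rewrite /from_subspace /= fH.
Qed.

Lemma Ck_eul n H f : tame H ->
  (forall x t, x \in `[0, 1] -> t \in `[0, T[ -> f x t = eul H x t) -> Ck T n f.
Proof.
elim: n H f => [|n IH] H f tH fH.
- by split => //; exact: continuous_within_eul fH.
- split; first exact: continuous_within_eul fH.
  have [HX [HT [tX tT dX dT]]] := tame_eul_derive a tH.
  have DX x t : x \in `[0, 1] -> t \in `[0, T[ ->
      derivable_within `[0, 1] (fun y => f y t) x /\ dx f x t = eul HX x t.
    by move=> x01 t0T; exact: (eul_dx (dX^~ t) (fun y y01 => fH y t y01 t0T) x01).
  have DT x t : x \in `[0, 1] -> t \in `[0, T[ ->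
      derivable_within `[0, +oo[ (fun s => f x s) t /\ dt f x t = eul HT x t.
    move=> x01 t0T; have t0T' : 0 <= t < T by move: t0T; rewrite in_itv.
    exact: (eul_dt t0T' (dT x t (lifespan_itv t0T)) (fun s s0T => fH x s x01 s0T)).
  split.
  + by move=> x t x01 t0T; split; [exact: (DX x t x01 t0T).1|exact: (DT x t x01 t0T).1].
  + exact: (IH HX _ tX (fun x t x01 t0T => (DX x t x01 t0T).2)).
  + exact: (IH HT _ tT (fun x t x01 t0T => (DT x t x01 t0T).2)).
Qed.

Lemma smooth_eul H : tame H -> smooth T (eul H).
Proof. by move=> tH n; exact: Ck_eul tH _. Qed.

End Solution.

Section Equations.
Context {R : realType}.
Implicit Types (f : R -> R -> R) (H : R -> R -> R) (x y s t al e : R).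
Variables (lambda kappa a sigma : R).
Hypothesis a_neq0 : a != 0.
Hypothesis lambdaE : lambda = (2 * a)^-1.
Hypothesis kappaE : kappa * (sigma * sigma) = 2 * a.
Local Notation T := (Tmax a).
Local Notation eul := (eul a).
Local Notation k := (k a).
Local Notation m := (m a).
Local Notation speed := (speed a).
Local Notation strain := (strain a).
Local Notation vel := (vel a).
Local Notation grad := (grad a).
Local Notation dens := (dens a sigma).

Definition m_s s : R := 'D_1 m s.

Lemma is_derive_m s : is_derive s 1 m (m_s s).
Proof.
have [_ [H2 [_ _ _ d]]] := tame_derive (tame_m a).
by have [dm _] := d 0 s; exact: DeriveDef.
Qed.

Lemma is_derive_speed s :
  is_derive s 1 speed (speed s * (s / (1 + s * s) - m s / a)).
Proof.
have s0 := sq1_gt0 s; have k0 := k_gt0 a s.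
have dsq : is_derive s 1 (fun x => 1 + x * x) (2 * s).
  apply: (is_derive_eq (is_derive1D (is_derive1_cst 1 s)
    (is_derive1M (is_derive1_id s) (is_derive1_id s)))).
  by ring.
apply: (is_derive_eq (is_derive1M (is_derive1_pow 2^-1 dsq s0)
  (is_derive1_pow (- a^-1) (is_derive_k a s) k0))).
rewrite (powRB1 _ s0) (powRB1 _ k0) /speed /m powRN1//; field.
by rewrite a_neq0 !gt_eqF.
Qed.

Definition strain_s al s :=
  - a * (2 * (sin (2 * pi * al) * sin (2 * pi * al)) / q al s -
         q_s al s * q_s al s / (q al s * q al s)) - m_s s.

Lemma is_derive_strain al s : is_derive s 1 (strain al) (strain_s al s).
Proof.
have q0 := q_gt0 al s.
have dqs : is_derive s 1 (q_s al) (2 * (sin (2 * pi * al) * sin (2 * pi * al))).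
  apply: (is_derive_eq (is_derive1M (is_derive1Z 2 (is_derive1_id s))
    (is_derive1_cst (sin (2 * pi * al) * sin (2 * pi * al)) s))).
  by ring.
apply: (is_derive_eq (is_derive1B (is_derive1Z (- a) (is_derive1M dqs
  (is_derive1_pow (-1) (is_derive_q al s) q0))) (is_derive_m s))).
rewrite (powRB1 _ q0) powRN1// /strain_s; field.
by rewrite gt_eqF.
Qed.

Definition grad_s al s := strain_s al s * speed s +
  strain al s * (speed s * (s / (1 + s * s) - m s / a)).

Lemma is_derive_grad al s : is_derive s 1 (grad al) (grad_s al s).
Proof. exact: is_derive1M (is_derive_strain al s) (is_derive_speed s). Qed.

(** The value of the nonlocal term along the flow: all that remains of the left
    side of the equation once the dependence on the label has cancelled. *)
Definition source s := speed s * speed s *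
  (- (s * m s) / (1 + s * s) + m s * m s / (2 * a) - m_s s -
   2 * a / (1 + s * s)).

(** The label enters through the squared sine, in [strain_s], in [grad ^+ 2] and,
    by [cos ^+ 2 = 1 - sin ^+ 2], in the density: the normalisations
    [kappa * sigma ^+ 2 = 2 * a] and [2 * a * lambda = 1] make these terms combine
    to a function of [s]. *)
Lemma grad_equation al s :
  speed s * grad_s al s - lambda * grad al s ^+ 2 - kappa * dens al s ^+ 2 =
  source s.
Proof.
have q0 := q_gt0 al s; have s0 := sq1_gt0 s.
have hh : (1 + s * s) `^ 2^-1 * (1 + s * s) `^ 2^-1 = 1 + s * s.
  rewrite -powRD; last by rewrite (gt_eqF s0) implybT.
  by rewrite (_ : 2^-1 + 2^-1 = 1) ?powRr1 ?(ltW s0)//; lra.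
have cc : cos (2 * pi * al) * cos (2 * pi * al) =
    1 - sin (2 * pi * al) * sin (2 * pi * al) :> R.
  by have := cos2Dsin2 (2 * pi * al); rewrite !expr2; lra.
have -> : kappa * dens al s ^+ 2 = (2 * a) *
    (1 - sin (2 * pi * al) * sin (2 * pi * al)) *
    (k s `^ (- a^-1) * k s `^ (- a^-1)) / (q al s * q al s).
  rewrite -kappaE -cc /dens powRN1//; field.
  by rewrite gt_eqF.
rewrite /source /grad /grad_s /strain_s /strain lambdaE powRN1//.
have -> : speed s * ((- a * (2 * (sin (2 * pi * al) * sin (2 * pi * al)) / q al s -
         q_s al s * q_s al s / (q al s * q al s)) - m_s s) * speed s +
  (- a * (q_s al s * (q al s)^-1) - m s) * (speed s * (s / (1 + s * s) - m s / a))) =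
  (speed s * speed s) * ((- a * (2 * (sin (2 * pi * al) * sin (2 * pi * al)) / q al s -
         q_s al s * q_s al s / (q al s * q al s)) - m_s s) +
  (- a * (q_s al s * (q al s)^-1) - m s) * (s / (1 + s * s) - m s / a)) by ring.
rewrite exprMn (expr2 (speed s)).
have -> : speed s * speed s = (1 + s * s) * (k s `^ (- a^-1) * k s `^ (- a^-1)).
  transitivity ((1 + s * s) `^ 2^-1 * (1 + s * s) `^ 2^-1 *
    (k s `^ (- a^-1) * k s `^ (- a^-1))); last by rewrite hh.
  by rewrite /speed; ring.
move: q0; rewrite /q /q_s; set S := sin _ => q0.
field.
by rewrite a_neq0 !gt_eqF.
Qed.

Definition dens_s al s :=
  dens al s * (- (m s / a) - q_s al s / q al s).

Lemma is_derive_dens al s : is_derive s 1 (dens al) (dens_s al s).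
Proof.
have q0 := q_gt0 al s; have k0 := k_gt0 a s.
apply: (is_derive_eq (is_derive1Z (sigma * cos (2 * pi * al)) (is_derive1M
  (is_derive1_pow (- a^-1) (is_derive_k a s) k0)
  (is_derive1_pow (-1) (is_derive_q al s) q0)))).
rewrite (powRB1 _ q0) (powRB1 _ k0) /dens_s /dens /m !powRN1//; field.
by rewrite a_neq0 !gt_eqF.
Qed.

Lemma dens_equation al s :
  speed s * dens_s al s = 2 * lambda * dens al s * grad al s.
Proof.
have q0 := q_gt0 al s.
rewrite /dens_s /grad /strain lambdaE powRN1//; field.
by rewrite a_neq0 gt_eqF.
Qed.

Lemma continuous_eul_x H t : tame H -> lifespan a t -> continuous (eul H ^~ t).
Proof.
by move=> tH Dt x; exact: continuous_pair_l (continuous_eul (tame_continuous tH) Dt).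
Qed.

Lemma grad_eulerian x t hx ht : lifespan a t ->
  is_derive x 1 (eul grad ^~ t) hx -> is_derive t 1 (eul grad x) ht ->
  ht + eul vel x t * hx - lambda * eul grad x t ^+ 2
    - kappa * eul dens x t ^+ 2 = source (param a t).
Proof.
move=> Dt dhx dht.
rewrite (material_derivative Dt (tame_grad a) is_derive_grad dhx dht).
exact: grad_equation.
Qed.

Lemma dens_eulerian x t hx ht : lifespan a t ->
  is_derive x 1 (eul dens ^~ t) hx -> is_derive t 1 (eul dens x) ht ->
  ht + eul vel x t * hx = 2 * lambda * eul dens x t * eul grad x t.
Proof.
move=> Dt dhx dht.
rewrite (material_derivative Dt (tame_dens a sigma) is_derive_dens dhx dht).
exact: dens_equation.
Qed.

Lemma velD1 al s : vel (al + 1) s = vel al s.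
Proof. by rewrite /vel flow_sD1. Qed.

Lemma gradD1 al s : grad (al + 1) s = grad al s.
Proof. by rewrite /grad /strain qD1 /q_s sin2piD1. Qed.

Lemma densD1 al s : dens (al + 1) s = dens al s.
Proof. by rewrite /dens qD1 cos2piD1. Qed.

(** Integrating the equation over a period identifies the source term, which
    the Lagrangian computation only shows to be independent of the label. *)
Lemma source_nonlocal t : lifespan a t ->
  source (param a t) =
  - kappa * int01 (fun x => eul dens x t ^+ 2)
  - (1 + lambda) * int01 (fun x => eul grad x t ^+ 2).
Proof.
move=> Dt.
have [HX [HT [tX tT dX dT]]] := tame_eul_derive a (tame_grad a).
have cv := continuous_eul_x (tame_vel a) Dt.
have cg := continuous_eul_x (tame_grad a) Dt.
have cd := continuous_eul_x (tame_dens a sigma) Dt.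
have cX := continuous_eul_x tX Dt.
have cT := continuous_eul_x tT Dt.
have per H : (forall al s, H (al + 1) s = H al s) -> forall t, eul H 1 t = eul H 0 t.
  by move=> pH t'; rewrite -[X in eul H X]add0r eulD1.
have cg2 : continuous (fun x => eul grad x t ^+ 2).
  by move=> x; under eq_fun do rewrite expr2; exact: (cvgM (cg x) (cg x)).
have cd2 : continuous (fun x => eul dens x t ^+ 2).
  by move=> x; under eq_fun do rewrite expr2; exact: (cvgM (cd x) (cd x)).
have cvX := continuous_mul cv cX.
have IT : int01 (eul HT ^~ t) = 0.
  have D : is_derive t 1 (fun t => int01 (eul grad ^~ t)) (int01 (eul HT ^~ t)).
    apply: (@is_derive_int01 _ (eul grad) (eul HT)).
    - by apply: filterS (near_lifespan Dt) => t' Dt'; exact: (continuous_eul_x (tame_grad a) Dt').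
    - by move=> x; apply: continuous_eul => //; exact: tame_continuous.
    - by apply: filterS (near_lifespan Dt) => t' Dt' x _; exact: dT.
  apply: (is_derive1_unique D).
  refine (near_eq_is_derive _ (is_derive1_cst 0 t)).
  apply: filterS (near_lifespan Dt) => t' Dt'.
  symmetry; transitivity (eul vel 1 t' - eul vel 0 t'); last first.
    by rewrite (per _ velD1) subrr.
  apply: (int01_FTC (f := eul grad ^~ t') (F := eul vel ^~ t')).
  - exact: continuous_eul_x (tame_grad a) Dt'.
  - exact: continuous_eul_x (tame_vel a) Dt'.
  - by move=> x _; exact: is_derive_vel.
have IX : int01 (fun x => eul vel x t * eul HX x t) =
    - int01 (fun x => eul grad x t ^+ 2).
  have dF x : 0 < x < 1 -> is_derive x 1 (fun x => eul vel x t * eul grad x t)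
      (eul vel x t * eul HX x t + eul grad x t ^+ 2).
    move=> _.
    apply: (is_derive_eq (is_derive1M (is_derive_vel a x t) (dX x t))).
    by rewrite expr2 addrC.
  have := int01_FTC (continuous_add cvX cg2) (continuous_mul cv cg) dF.
  rewrite (per _ velD1) (per _ gradD1) subrr int01D// => /eqP.
  by rewrite addr_eq0 => /eqP.
rewrite -(int01_cst (source _)).
rewrite (@eq_int01 _ _ (fun x => eul HT x t + (eul vel x t * eul HX x t +
  (- lambda * eul grad x t ^+ 2 + - kappa * eul dens x t ^+ 2)))); last first.
  by move=> x _; rewrite -(grad_eulerian Dt (dX x t) (dT x t Dt)); ring.
have cl : continuous (fun x => - lambda * eul grad x t ^+ 2).
  exact: continuous_mul (@continuous_cst _ _ _) cg2.
have ck : continuous (fun x => - kappa * eul dens x t ^+ 2).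
  exact: continuous_mul (@continuous_cst _ _ _) cd2.
have c1 := continuous_add cl ck; have c2 := continuous_add cvX c1.
rewrite (int01D cT c2) (int01D cvX c1) (int01D cl ck) (int01Z _ cg2) (int01Z _ cd2).
rewrite IT IX.
have fin (A B : R) : 0 + (- A + (- lambda * A + - kappa * B)) =
    - kappa * B - (1 + lambda) * A by ring.
exact: fin.
Qed.

Lemma label0 x : label a x 0 = x.
Proof.
have f0 al : flow a al 0 = al.
  have k0 : k 0 = 1.
    rewrite -[RHS](int01_cst 1); apply: eq_int01 => be _.
    by rewrite /q !mul0r addr0 powR1.
  rewrite /flow -[RHS]subr0; apply: (prim_unique (F := id)); last first.
    exact: (@continuous2_l _ _ 0 (tame_continuous (tame_jac a))).
  move=> y; apply: (is_derive_eq (is_derive1_id y)).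
  by rewrite /jac k0 /q !mul0r addr0 !powR1 mulr1.
by rewrite -{1}(f0 x) label_unique.
Qed.

Lemma m0 : m 0 = 0.
Proof.
rewrite /m (_ : k_s a 0 = 0) ?mul0r// -[RHS](int01_cst 0).
by apply: eq_int01 => al _; rewrite /q_s !mulr0 !mul0r mulr0.
Qed.

Lemma strain0 al : strain al 0 = 0.
Proof. by rewrite /strain m0 /q_s mulr0 !mul0r mulr0 subr0. Qed.

Lemma vel0 al : vel al 0 = 0.
Proof.
have -> : vel al 0 = prim (fun=> 0) al * speed 0.
  rewrite /vel /flow_s; congr (prim _ _ * _); apply/funext => be.
  by rewrite /jac_s -/(strain be 0) strain0 mulr0.
have d0 (y : R) : is_derive y 1 (fun _ : R => 0 : R) (0 : R).
  exact: is_derive1_cst.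
by rewrite (prim_unique al d0 (@continuous_cst _ _ 0)) subrr mul0r.
Qed.

Lemma dens0 al : dens al 0 = sigma * cos (2 * pi * al).
Proof.
have k0 : k 0 = 1.
  rewrite -[RHS](int01_cst 1); apply: eq_int01 => be _.
  by rewrite /q !mul0r addr0 powR1.
by rewrite /dens k0 /q !mul0r addr0 !powR1 !mulr1.
Qed.

Theorem explicit_solution : is_solution lambda kappa
  (fun=> 0) (fun x => sigma * cos (2 * pi * x)) T (eul vel) (eul dens).
Proof.
have z01 : (0 : R) \in `[0, 1] by rewrite in_itv /= lexx ler01.
have o01 : (1 : R) \in `[0, 1] by rewrite in_itv /= lexx ler01.
have per H : (forall al s, H (al + 1) s = H al s) -> forall t, eul H 0 t = eul H 1 t.
  by move=> pH t'; rewrite -[X in _ = eul H X _]add0r eulD1.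
have dxv x t : x \in `[0, 1] -> dx (eul vel) x t = eul grad x t.
  by move=> x01; have [] := eul_dx (fun x => is_derive_vel a x t)
    (fun x _ => erefl) x01.
have [GX [GT [_ _ dGX dGT]]] := tame_eul_derive a (tame_grad a).
have [DX [DT [_ _ dDX dDT]]] := tame_eul_derive a (tame_dens a sigma).
have W t : t \in `]0, T[ -> 0 <= t < T.
  by rewrite in_itv /= => /andP[/ltW -> ->].
split.
- exact: smooth_eul (tame_vel a).
- exact: smooth_eul (tame_dens a sigma).
- by move=> t _; rewrite !dxv// !(per _ velD1) (per _ gradD1) (per _ densD1).
- move=> x _; rewrite !eulE param0 label0 vel0 dens0 //.
- move=> x t x01 /W t0T; have Dt := lifespanW t0T.
  have [_ ->] := eul_dx (f := dx (eul vel)) (fun x => dGX x t) (fun x x01 => dxv x t x01) x01.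
  have [_ ->] := eul_dt (f := dx (eul vel)) t0T (dGT x t Dt) (fun t _ => dxv x t x01).
  rewrite dxv// (grad_eulerian Dt (dGX x t) (dGT x t Dt)) source_nonlocal//.
  rewrite /nonlocal /int01; congr (_ - _ * _).
  by apply: eq_Rintegral => y; rewrite inE /= => y01; rewrite dxv.
- move=> x t x01 /W t0T; have Dt := lifespanW t0T.
  have [_ ->] := eul_dx (fun x => dDX x t) (fun x _ => erefl) x01.
  have [_ ->] := eul_dt t0T (dDT x t Dt) (fun t _ => erefl).
  by rewrite dxv// (dens_eulerian Dt (dDX x t) (dDT x t Dt)).
Qed.

End Equations.

(** * Uniqueness up to a moving frame *)

Section Energy.
Context {R : realType}.
Implicit Types (f g F : R -> R) (H : R -> R -> R) (x y t e : R).

Lemma continuous_sqr f : continuous f -> continuous (fun x => f x ^+ 2).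
Proof.
by move=> cf; under eq_fun do rewrite expr2; exact: continuous_mul.
Qed.

Lemma continuous_sub (T : topologicalType) (f g : T -> R) :
  continuous f -> continuous g -> continuous (fun z => f z - g z).
Proof. by move=> cf cg z; exact: (cvgB (cf z) (cg z)). Qed.

Lemma bounded_rectangle H t1 : continuous2 H -> exists M, 0 <= M /\
  forall x t, 0 <= x <= 1 -> 0 <= t <= t1 -> `|H x t| <= M.
Proof.
move=> cH; have [t10|t10] := leP 0 t1; last first.
  by exists 0; split => // x t _ /andP[t0 tt]; exfalso; lra.
have cK : compact (`[0%R, 1%R] `*` `[0%R, t1] : set (R * R)).
  by apply: compact_setX; exact: segment_compact.
have cN : continuous (fun w : R * R => `|H w.1 w.2|).
  by move=> w; apply: cvg_norm; exact: cH.
have [||[c1 c2] _ cmax] :=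
  @compact_EVT_max _ _ (fun w : R * R => `|H w.1 w.2|) _ _ cK.
- by exists (0, 0); split; rewrite /= in_itv /= lexx ?ler01.
- by apply: continuous_subspaceT.
- exists `|H c1 c2|; split => // x t x01 t01.
  by apply: (cmax (x, t)); rewrite inE; split; rewrite /= in_itv.
Qed.

Lemma int01_eq0 f x : continuous f -> (forall y, 0 <= y <= 1 -> 0 <= f y) ->
  int01 f <= 0 -> 0 <= x <= 1 -> f x = 0.
Proof.
move=> cf f0 If x01; apply/eqP; apply: contraT => fx.
have {}fx : 0 < f x by rewrite lt_neqAle eq_sym fx f0.
have /cvgrPdist_lt/(_ (f x / 2)) := cf x.
move=> /(_ ltac:(lra))/nbhs_ballP[e /= e0 eP].
pose d := Num.min (e / 2) (1 / 2).
have d0 : 0 < d by rewrite lt_min; apply/andP; split; lra.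
have de : d < e by rewrite gt_min; apply/orP; left; lra.
have d1 : d <= 1 / 2 by rewrite ge_min lexx orbT.
have lo y : `|x - y| <= d -> f x / 2 <= f y.
  move=> xy; have := eP y (le_lt_trans xy de); rewrite ltr_norml => /andP[? ?].
  lra.
have [x2|x2] := leP x (1 / 2).
  have := @int01_ge_itv _ f (f x / 2) x (x + d) cf f0.
  move: x01 => /andP[? ?] /(_ _ _ _ _) H.
  have := H ltac:(lra) ltac:(lra) ltac:(lra).
  have lo' z : x <= z <= x + d -> f x / 2 <= f z.
    by move=> /andP[? ?]; apply: lo; rewrite ler_norml; apply/andP; split; lra.
  move=> /(_ lo'); nra.
have := @int01_ge_itv _ f (f x / 2) (x - d) x cf f0.
move: x01 => /andP[? ?] /(_ _ _ _ _) H.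
have := H ltac:(lra) ltac:(lra) ltac:(lra).
have lo' z : x - d <= z <= x -> f x / 2 <= f z.
  by move=> /andP[? ?]; apply: lo; rewrite ler_norml; apply/andP; split; lra.
move=> /(_ lo'); nra.
Qed.

(** The variance of [`|f|] is nonnegative. *)
Lemma sqr_int01_norm f : continuous f ->
  int01 (fun x => `|f x|) ^+ 2 <= int01 (fun x => f x ^+ 2).
Proof.
move=> cf; have cn := continuous_norm cf; set c := int01 _.
have cs := continuous_sqr cf.
have := @int01_ge0 _ (fun x => (`|f x| - c) ^+ 2) (fun x _ => sqr_ge0 _).
have c1 : continuous (fun x => (- 2 * c) * `|f x|).
  exact: continuous_mul (@continuous_cst _ _ _) cn.
have c2 : continuous (fun x => (- 2 * c) * `|f x| + c ^+ 2).
  exact: continuous_add c1 (@continuous_cst _ _ _).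
rewrite (@eq_int01 _ _ (fun x => f x ^+ 2 + ((- 2 * c) * `|f x| + c ^+ 2))).
  rewrite int01D// int01D//; last exact: continuous_cst.
  by rewrite int01Z// int01_cst -/c expr2; lra.
by move=> x _; rewrite -[f x ^+ 2]real_normK ?num_real//; ring.
Qed.

Lemma prim_norm_le f x y : continuous f -> 0 <= x -> x <= y -> y <= 1 ->
  `|prim f y - prim f x| <= int01 (fun z => `|f z|).
Proof.
move=> cf x0 xy y1; have cn := continuous_norm cf.
apply: le_trans (int01_ge_prim cn (fun z _ => normr_ge0 _) x0 xy y1).
have H g : continuous g -> (forall z, g z <= `|f z|) ->
    prim g y - prim g x <= prim (fun z => `|f z|) y - prim (fun z => `|f z|) x.
  move=> cg gf; have D z := is_derive1B (is_derive_prim z cn) (is_derive_prim z cg).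
  have := derive_ge0_le xy (fun z _ => D z) (continuous_subspaceT
    (fun z => is_derive_continuous (D z))) (fun z _ => _).
  by move=> /(_ (fun z => ltac:(rewrite subr_ge0; exact: gf))); lra.
have cN : continuous (fun u => - f u) by move=> u; exact: cvgN (cf u).
have Ef z : prim (fun u => - f u) z = - prim f z.
  have dN (u : R) : is_derive u 1 (fun z => - prim f z) (- f u).
    exact: is_derive1N (is_derive_prim u cf).
  by rewrite (prim_unique z dN cN) prim0 oppr0 subr0.
have h1 := H f cf (fun z => ler_norm _).
have h2 := H (fun u => - f u) cN
  (fun z => ltac:(rewrite -normrN; exact: ler_norm)).
rewrite !Ef in h2; rewrite ler_norml; apply/andP; split; last exact: h1.
rewrite lerNl; apply: le_trans h2; lra.
Qed.

(** With zero mean, [F x] is the average of [F x - F y] over [y], and each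
    difference is at most the mass of [f]. *)
Lemma norm_le_int01_derive F f x : continuous F -> continuous f ->
  (forall y, 0 < y < 1 -> is_derive y 1 F (f y)) -> int01 F = 0 ->
  0 <= x <= 1 -> `|F x| <= int01 (fun y => `|f y|).
Proof.
move=> cF cf dF F0 x01.
have FE y : 0 <= y <= 1 -> F y = F 0 + prim f y.
  move=> /andP[y0 y1]; pose G z := F z - prim f z.
  suff : G y = G 0 by rewrite /G prim0; lra.
  have [z||c _] := @MVT_segment _ G (fun=> 0) 0 y y0.
  - rewrite in_itv /= => /andP[z0 zy].
    apply: (is_derive_eq (is_derive1B (dF z _) (is_derive_prim z cf))).
      by apply/andP; split; lra.
    by rewrite subrr.
  - apply: continuous_subspaceT => z.
    exact: (continuousB (cF z) (is_derive_continuous (is_derive_prim z cf))).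
  - by rewrite mul0r => /eqP; rewrite subr_eq0 => /eqP.
have -> : F x = int01 (fun y => F x - F y).
  rewrite int01B ?F0 ?int01_cst ?subr0//.
  by move=> ?; exact: cvg_cst.
have cd : continuous (fun y => F x - F y).
  by move=> y; exact: (cvgB (cvg_cst _) (cF y)).
apply: le_trans (ler_norm_int01 cd) _.
rewrite -[leRHS]int01_cst; apply: ler_int01.
- exact: continuous_norm.
- by move=> ?; exact: cvg_cst.
- move=> y y01; rewrite (FE x)// (FE y)//.
  rewrite opprD addrACA subrr add0r.
  have [xy|xy] := boolP (x <= y).
    rewrite distrC; apply: prim_norm_le => //; by [case/andP: x01|case/andP: y01].
  apply: prim_norm_le => //; [by case/andP: y01|by rewrite ltW// ltNge|by case/andP: x01].
Qed.

(** [E t * expR (- C * t)] is nonincreasing. *)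
Lemma gronwall (E dE : R -> R) C t1 : continuous E -> E 0 <= 0 ->
  (forall t, 0 < t < t1 -> is_derive t 1 E (dE t)) ->
  (forall t, 0 < t < t1 -> dE t <= C * E t) ->
  forall t, 0 <= t <= t1 -> E t <= 0.
Proof.
move=> cE E0 dEE bE t /andP[t0 tt].
pose F s := - (E s * expR (- C * s)).
have dexp (s : R) : is_derive s 1 (fun s => expR (- C * s)) (expR (- C * s) * - C).
  apply: (is_derive_eq (is_derive1_chain (is_derive_expR _)
    (is_derive1Z (- C) (is_derive1_id s)))).
  by rewrite mulr1.
have : F 0 <= F t.
  apply: (@derive_ge0_le _ F (fun s => - (dE s * expR (- C * s) +
     E s * (expR (- C * s) * - C))) 0 t t0).
  - move=> s; rewrite in_itv /= => /andP[s0 st].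
    apply: is_derive1N; apply: is_derive1M (dexp s).
    by apply: dEE; apply/andP; split; lra.
  - apply: continuous_subspaceT => s; apply: cvgN; apply: cvgM; first exact: cE.
    exact: is_derive_continuous (dexp s).
  - move=> s; rewrite in_itv /= => /andP[s0 st].
    have b := bE s ltac:(apply/andP; split; lra).
    have e0 := expR_gt0 (- C * s).
    rewrite (_ : - _ = expR (- C * s) * (C * E s - dE s)); last by ring.
    by apply: mulr_ge0; [exact: ltW|rewrite subr_ge0].
rewrite /F mulr0 expR0 mulr1 lerN2 => h.
by have := le_trans h E0; rewrite pmulr_lle0// expR_gt0.
Qed.

(** A classical solution on the slab [0, 1] x [0, t1], with [p] for the space
    derivative of [u].  The source [I] is an arbitrary function of time, so that
    solutions with different nonlocal terms can be compared. *)
Record strong lambda kappa t1 (u p px pt r rx rt : R -> R -> R) (I : R -> R) :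
    Prop := Strong {
  strong_cu : continuous2 u;
  strong_cp : continuous2 p;
  strong_cpx : continuous2 px;
  strong_cpt : continuous2 pt;
  strong_cr : continuous2 r;
  strong_crx : continuous2 rx;
  strong_crt : continuous2 rt;
  strong_ux : forall x t : R, 0 < x < 1 -> 0 < t < t1 ->
    is_derive x 1 (u ^~ t) (p x t);
  strong_px : forall x t : R, 0 < x < 1 -> 0 < t < t1 ->
    is_derive x 1 (p ^~ t) (px x t);
  strong_rx : forall x t : R, 0 < x < 1 -> 0 < t < t1 ->
    is_derive x 1 (r ^~ t) (rx x t);
  strong_pt : forall x t : R, 0 <= x <= 1 -> 0 < t < t1 ->
    is_derive t 1 (p x) (pt x t);
  strong_rt : forall x t : R, 0 <= x <= 1 -> 0 < t < t1 ->
    is_derive t 1 (r x) (rt x t);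
  strong_per : forall t : R, 0 < t < t1 ->
    [/\ u 0 t = u 1 t, p 0 t = p 1 t & r 0 t = r 1 t];
  strong_eqp : forall x t : R, 0 <= x <= 1 -> 0 < t < t1 ->
    pt x t + u x t * px x t - lambda * p x t ^+ 2 - kappa * r x t ^+ 2 = I t;
  strong_eqr : forall x t : R, 0 <= x <= 1 -> 0 < t < t1 ->
    rt x t + u x t * rx x t = 2 * lambda * r x t * p x t }.

(** The estimate at a fixed time: [z], [a], [e] are the differences of the
    velocities, of their space derivatives and of the densities.  Transport by
    [u] costs only a multiple of the energy after integration by parts, [z] is
    controlled by [a] because its mean vanishes, and the difference [I] of the
    sources drops out because [a] has mean zero. *)
Lemma energy_estimate lambda kappa M (u z p b r s bx sx a ax at' e ex et : R -> R) I :
  continuous u -> continuous z -> continuous p -> continuous b ->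
  continuous r -> continuous s -> continuous bx -> continuous sx ->
  continuous a -> continuous ax -> continuous at' ->
  continuous e -> continuous ex -> continuous et -> 0 <= M ->
  (forall x, 0 <= x <= 1 -> [/\ `|p x| <= M, `|b x| <= M, `|r x| <= M &
     [/\ `|s x| <= M, `|bx x| <= M & `|sx x| <= M]]) ->
  (forall x : R, 0 < x < 1 -> is_derive x 1 u (p x)) ->
  (forall x : R, 0 < x < 1 -> is_derive x 1 z (a x)) ->
  (forall x : R, 0 < x < 1 -> is_derive x 1 a (ax x)) ->
  (forall x : R, 0 < x < 1 -> is_derive x 1 e (ex x)) ->
  u 0 = u 1 -> z 0 = z 1 -> a 0 = a 1 -> e 0 = e 1 -> int01 z = 0 ->
  (forall x, 0 <= x <= 1 -> at' x = - (u x * ax x) - z x * bx x +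
     lambda * (p x + b x) * a x + kappa * (r x + s x) * e x + I) ->
  (forall x, 0 <= x <= 1 -> et x = - (u x * ex x) - z x * sx x +
     2 * lambda * (e x * p x + s x * a x)) ->
  int01 (fun x => 2 * (a x * at' x + e x * et x)) <=
  2 * (M * (3 + 3 * `|lambda| + `|kappa|)) *
    int01 (fun x => a x ^+ 2 + e x ^+ 2).
Proof.
move=> cu cz cp cb cr cs cbx csx ca cax cat ce cex cet M0 bM du dz da de.
move=> pu pz pa pe mz eqa eqe.
set A1 := int01 (fun x => `|a x|); set E1 := int01 (fun x => `|e x|).
have ca2 := continuous_sqr ca; have ce2 := continuous_sqr ce.
have cae := continuous_add ca2 ce2.
have zA x : 0 <= x <= 1 -> `|z x| <= A1.
  by move=> x01; exact: (norm_le_int01_derive cz ca dz mz x01).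
(* integration by parts of the transport term *)
pose G1 x := u x * (a x * ax x + e x * ex x) + 2^-1 * (p x * (a x ^+ 2 + e x ^+ 2)).
have cG1 : continuous G1.
  apply: continuous_add; first apply: continuous_mul => //.
    by apply: continuous_add; exact: continuous_mul.
  apply: continuous_mul; first exact: continuous_cst.
  exact: continuous_mul.
have IG1 : int01 G1 = 0.
  have dG x : 0 < x < 1 -> is_derive x 1
      (fun x => 2^-1 * (u x * (a x * a x + e x * e x))) (G1 x).
    move=> x01; have dax := da x x01; have dex := de x x01.
    apply: (is_derive_eq (is_derive1Z 2^-1 (is_derive1M (du x x01) (is_derive1D
      (is_derive1M dax dax) (is_derive1M dex dex))))).
    by rewrite /G1 !expr2; field.
  have cG : continuous (fun x => 2^-1 * (u x * (a x * a x + e x * e x))).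
    apply: continuous_mul; first exact: continuous_cst.
    by apply: continuous_mul => //; apply: continuous_add; exact: continuous_mul.
  by rewrite (int01_FTC cG1 cG dG) pu pa pe subrr.
have Ia : int01 a = 0 by rewrite (int01_FTC ca cz dz) pz subrr.
pose K := M * (2^-1 + 3 * `|lambda| + `|kappa|).
have cmaj1 : continuous (fun x => A1 * M * (`|a x| + `|e x|)).
  apply: continuous_mul; first exact: continuous_cst.
  by apply: continuous_add; exact: continuous_norm.
have cmaj2 : continuous (fun x => K * (a x ^+ 2 + e x ^+ 2)).
  by apply: continuous_mul => //; exact: continuous_cst.
have cIa : continuous (fun x => I * a x).
  by apply: continuous_mul => //; exact: continuous_cst.
have clhs : continuous (fun x => a x * at' x + e x * et x).
  by apply: continuous_add; exact: continuous_mul.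
have key : int01 (fun x => a x * at' x + e x * et x) <=
    A1 * M * (A1 + E1) + K * int01 (fun x => a x ^+ 2 + e x ^+ 2).
  have -> : A1 * M * (A1 + E1) + K * int01 (fun x => a x ^+ 2 + e x ^+ 2) =
      int01 (fun x => A1 * M * (`|a x| + `|e x|) + K * (a x ^+ 2 + e x ^+ 2)).
    rewrite (int01D cmaj1 cmaj2) (int01Z _ cae) int01Z.
      by rewrite (int01D (continuous_norm ca) (continuous_norm ce)).
    by apply: continuous_add; exact: continuous_norm.
  have -> : int01 (fun x => a x * at' x + e x * et x) =
      int01 (fun x => (a x * at' x + e x * et x + G1 x) - I * a x).
    rewrite (int01B (continuous_add clhs cG1) cIa) (int01D clhs cG1).
    by rewrite (int01Z _ ca) IG1 Ia mulr0 subr0 addr0.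
  apply: ler_int01.
  - exact: continuous_sub (continuous_add clhs cG1) cIa.
  - exact: continuous_add.
  move=> x x01; have [Hp Hb Hr [Hs Hbx Hsx]] := bM x x01.
  rewrite eqa// eqe// /G1.
  have -> : a x * (- (u x * ax x) - z x * bx x + lambda * (p x + b x) * a x +
       kappa * (r x + s x) * e x + I) + e x * (- (u x * ex x) - z x * sx x +
       2 * lambda * (e x * p x + s x * a x)) +
       (u x * (a x * ax x + e x * ex x) + 2^-1 * (p x * (a x ^+ 2 + e x ^+ 2))) -
       I * a x =
     - (z x * bx x * a x) - z x * sx x * e x +
     (lambda * (p x + b x) * a x ^+ 2 + kappa * (r x + s x) * (a x * e x) +
      2 * lambda * p x * e x ^+ 2 + 2 * lambda * s x * (a x * e x) +
      2^-1 * (p x * (a x ^+ 2 + e x ^+ 2))) by rewrite !expr2; ring.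
  have Hz := zA x x01.
  have t1 (y w : R) : `|y| <= M -> - (z x * y * w) <= A1 * M * `|w|.
    move=> yM; apply: le_trans (ler_norm _) _; rewrite normrN !normrM.
    by rewrite ler_wpM2r// ler_pM.
  have sq0 (w : R) : 0 <= w ^+ 2 := sqr_ge0 w.
  have t2 (l y w : R) : `|y| <= M -> 0 <= w -> l * y * w <= `|l| * M * w.
    move=> yM w0; rewrite ler_wpM2r//; apply: le_trans (ler_norm _) _.
    by rewrite normrM ler_wpM2l.
  have ae : `|a x * e x| <= 2^-1 * (a x ^+ 2 + e x ^+ 2).
    have := sqr_ge0 (a x - e x); have := sqr_ge0 (a x + e x).
    by rewrite ler_norml !expr2 => ? ?; apply/andP; split; lra.
  have t3 (l y : R) : `|y| <= M ->
      l * y * (a x * e x) <= `|l| * M * (2^-1 * (a x ^+ 2 + e x ^+ 2)).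
    move=> yM; apply: le_trans (ler_norm _) _; rewrite !normrM -[`|a x| * _]normrM.
    by rewrite ler_pM// ?mulr_ge0// ler_wpM2l.
  have h1 := t1 _ (a x) Hbx; have h2 := t1 _ (e x) Hsx.
  have h3 := t2 lambda _ _ Hp (sq0 (a x)).
  have h4 := t2 lambda _ _ Hb (sq0 (a x)).
  have h5 := t3 kappa _ Hr; have h6 := t3 kappa _ Hs.
  have h7 := t2 lambda _ _ Hp (sq0 (e x)).
  have h8 := t3 lambda _ Hs.
  have h9 := t2 1 _ _ Hp (addr_ge0 (sq0 (a x)) (sq0 (e x))).
  rewrite normr1 !mul1r in h9.
  have lM : 0 <= `|lambda| * M by rewrite mulr_ge0.
  have hx := mulr_ge0 lM (sq0 (e x)).
  rewrite /K; lra.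
have hA : A1 ^+ 2 <= int01 (fun x => a x ^+ 2) by exact: sqr_int01_norm.
have hE : E1 ^+ 2 <= int01 (fun x => e x ^+ 2) by exact: sqr_int01_norm.
rewrite (int01Z _ clhs) -mulrA ler_pM2l//; apply: le_trans key _.
have hAE : A1 * (A1 + E1) <= 2 * int01 (fun x => a x ^+ 2 + e x ^+ 2).
  rewrite (int01D ca2 ce2).
  have i1 : 0 <= int01 (fun x => e x ^+ 2).
    by apply: int01_ge0 => x _; exact: sqr_ge0.
  have i2 : 0 <= int01 (fun x => a x ^+ 2).
    by apply: int01_ge0 => x _; exact: sqr_ge0.
  by have := sqr_ge0 (A1 - E1); move: hA hE; rewrite !expr2; lra.
have := ler_wpM2l M0 hAE.
have i3 : 0 <= M * int01 (fun x => a x ^+ 2 + e x ^+ 2).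
  by rewrite mulr_ge0//; apply: int01_ge0 => x _; rewrite addr_ge0// sqr_ge0.
by rewrite /K; lra.
Qed.

End Energy.

Section Uniqueness.
Context {R : realType}.
Implicit Types (x y t : R).

(** The mean velocities have to agree, since the equations do not see them; then
    the energy of the difference vanishes initially and satisfies Gronwall's
    inequality. *)
Theorem strong_unique lambda kappa t1 u p px pt r rx rt I v b bx bt s sx st J :
  @strong R lambda kappa t1 u p px pt r rx rt I ->
  @strong R lambda kappa t1 v b bx bt s sx st J ->
  (forall t, 0 < t < t1 -> int01 (u ^~ t) = int01 (v ^~ t)) ->
  (forall x, 0 <= x <= 1 -> p x 0 = b x 0 /\ r x 0 = s x 0) ->
  forall x t, 0 <= x <= 1 -> 0 <= t <= t1 -> p x t = b x t /\ r x t = s x t.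
Proof.
move=> [cu cp cpx cpt cr crx crt ux pX rX pT rT per eqp eqr].
move=> [cv cb cbx cbt cs csx cst vx bX sX bT sT pev eqb eqs] mean init.
pose a x t := p x t - b x t; pose e x t := r x t - s x t.
pose at' x t := pt x t - bt x t; pose et x t := rt x t - st x t.
have ca : continuous2 a by exact: continuous_sub.
have ce : continuous2 e by exact: continuous_sub.
have cat : continuous2 at' by exact: continuous_sub.
have cet : continuous2 et by exact: continuous_sub.
pose E t := int01 (fun x => a x t * a x t + e x t * e x t).
pose dE t := int01 (fun x => 2 * (a x t * at' x t + e x t * et x t)).
have cae : continuous2 (fun x t => a x t * a x t + e x t * e x t).
  by apply: continuous_add; exact: continuous_mul.
have cE : continuous E.
  exact: (continuous_int01 cae).
have cdae : continuous2 (fun x t => 2 * (a x t * at' x t + e x t * et x t)).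
  apply: continuous_mul; first exact: continuous_cst.
  by apply: continuous_add; exact: continuous_mul.
have dEE t : 0 < t < t1 -> is_derive t 1 E (dE t).
  move=> t01.
  apply: (@is_derive_int01 _ (fun x t => a x t * a x t + e x t * e x t)
    (fun x t => 2 * (a x t * at' x t + e x t * et x t))).
  - by near=> t' => x; exact: continuous_pair_l (cae (x, t')).
  - by move=> x; exact: cdae.
  - have N : \forall t' \near t, 0 < t' < t1.
      move: t01 => /andP[? ?]; near=> t'; apply/andP; split; near: t'.
        exact: lt_nbhsr.
      exact: lt_nbhsl.
    apply: filterS N => t' t'01 x x01.
    have da := is_derive1B (pT x t' x01 t'01) (bT x t' x01 t'01).
    have de := is_derive1B (rT x t' x01 t'01) (sT x t' x01 t'01).
    apply: (is_derive_eq (is_derive1D (is_derive1M da da) (is_derive1M de de))).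
    by rewrite /a /e /at' /et; ring.
have [M [M0 HM]] : exists M, 0 <= M /\ forall x t, 0 <= x <= 1 -> 0 <= t <= t1 ->
    [/\ `|p x t| <= M, `|b x t| <= M, `|r x t| <= M &
     [/\ `|s x t| <= M, `|bx x t| <= M & `|sx x t| <= M]].
  have [M1 [? h1]] := bounded_rectangle t1 cp.
  have [M2 [? h2]] := bounded_rectangle t1 cb.
  have [M3 [? h3]] := bounded_rectangle t1 cr.
  have [M4 [? h4]] := bounded_rectangle t1 cs.
  have [M5 [? h5]] := bounded_rectangle t1 cbx.
  have [M6 [? h6]] := bounded_rectangle t1 csx.
  exists (M1 + M2 + M3 + M4 + M5 + M6); split; first by lra.
  move=> x t x01 t01; have := h1 x t x01 t01; have := h2 x t x01 t01.
  have := h3 x t x01 t01; have := h4 x t x01 t01; have := h5 x t x01 t01.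
  have := h6 x t x01 t01 => *; split; [| | |split]; lra.
have sl H t : continuous2 H -> continuous (H ^~ t).
  by move=> cH x; exact: continuous_pair_l (cH (x, t)).
have bound t : 0 < t < t1 ->
    dE t <= 2 * (M * (3 + 3 * `|lambda| + `|kappa|)) * E t.
  move=> t01; have t01' : 0 <= t <= t1 by case/andP: t01 => /ltW -> /ltW ->.
  have [pu pp pr] := per t t01; have [pv pb ps] := pev t t01.
  have -> : E t = int01 (fun x => a x t ^+ 2 + e x t ^+ 2) by [].
  apply: (@energy_estimate _ lambda kappa M (u ^~ t) (fun x => u x t - v x t)
    (p ^~ t) (b ^~ t) (r ^~ t) (s ^~ t) (bx ^~ t) (sx ^~ t) (a ^~ t)
    (fun x => px x t - bx x t) (at' ^~ t) (e ^~ t) (fun x => rx x t - sx x t)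
    (et ^~ t) (I t - J t)); try exact: sl.
  - exact: (continuous_sub (sl _ t cu) (sl _ t cv)).
  - exact: (continuous_sub (sl _ t cpx) (sl _ t cbx)).
  - exact: (continuous_sub (sl _ t crx) (sl _ t csx)).
  - exact: M0.
  - by move=> x x01; exact: HM.
  - by move=> x x01; exact: ux.
  - by move=> x x01; exact: is_derive1B (ux x t x01 t01) (vx x t x01 t01).
  - by move=> x x01; exact: is_derive1B (pX x t x01 t01) (bX x t x01 t01).
  - by move=> x x01; exact: is_derive1B (rX x t x01 t01) (sX x t x01 t01).
  - exact: pu.
  - by rewrite pu pv.
  - by rewrite /a pp pb.
  - by rewrite /e pr ps.
  - by rewrite (int01B (sl _ t cu) (sl _ t cv)) mean// subrr.
  - move=> x x01; have := eqp x t x01 t01; have := eqb x t x01 t01.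
    by rewrite /at' /a /e !expr2 => h1 h2; rewrite -h1 -h2; ring.
  - move=> x x01; have h1 := eqr x t x01 t01; have h2 := eqs x t x01 t01.
    have -> : et x t = (rt x t + u x t * rx x t) - (st x t + v x t * sx x t) -
      u x t * rx x t + v x t * sx x t by rewrite /et; ring.
    by rewrite h1 h2 /a /e; ring.
have E0 : E 0 <= 0.
  rewrite /E (@eq_int01 _ _ (fun=> 0)) ?int01_cst// => x x01.
  by have [h1 h2] := init x x01; rewrite /a /e h1 h2 !subrr mulr0 addr0.
move=> x t x01 t01; have Et := gronwall cE E0 dEE bound t01.
have := int01_eq0 (sl _ t cae) _ Et x01 => /=.
have sq y z : 0 <= z * z + y * y :> R by rewrite -!expr2 addr_ge0// sqr_ge0.
move=> /(_ (fun y _ => sq _ _)) /eqP.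
rewrite paddr_eq0 -?expr2 ?sqr_ge0// !sqrf_eq0 => /andP[/eqP h1 /eqP h2].
by split; apply/eqP; rewrite -subr_eq0; apply/eqP.
Unshelve. all: by end_near. Qed.

End Uniqueness.

Section Transfer.
Context {R : realType}.
Implicit Types (f : R -> R) (H : R -> R -> R) (x y t : R).

(** Composing with [clamp] extends a function from a slab to the plane without
    changing it inside, and turns relative continuity into continuity. *)
Definition clamp t1 t : R := Num.max 0 (Num.min t t1).

Lemma clamp_itv t1 t : 0 <= t1 -> 0 <= clamp t1 t <= t1.
Proof. by move=> t10; rewrite /clamp le_max lexx /= ge_max t10 ge_min lexx orbT. Qed.

Lemma clampK t1 t : 0 <= t <= t1 -> clamp t1 t = t.
Proof. by move=> /andP[t0 tt]; rewrite /clamp (min_idPl tt) (max_idPr t0). Qed.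

Lemma continuous_clamp t1 : continuous (clamp t1).
Proof.
move=> t; apply: (@continuous_max R R (fun=> 0) (fun s => Num.min s t1) t).
  exact: cvg_cst.
apply: (@continuous_min R R id (fun=> t1) t); first exact: cvg_id.
exact: cvg_cst.
Qed.

Lemma near_clampK t1 t : 0 < t < t1 -> \forall s \near t, clamp t1 s = s.
Proof.
move=> /andP[t0 tt]; near=> s; apply: clampK; apply/andP; split; apply: ltW; near: s.
  exact: lt_nbhsr.
exact: lt_nbhsl.
Unshelve. all: by end_near. Qed.

Lemma continuous2_clamp H T t1 : 0 <= t1 -> t1 < T ->
  {within `[0, 1] `*` `[0, T[, continuous (fun z : R * R => H z.1 z.2)} ->
  continuous2 (fun x t => H (clamp 1 x) (clamp t1 t)).
Proof.
move=> t10 tT /subspace_continuousP cH [x t] /=.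
have inA (w : R * R) : (`[0, 1] `*` `[0, T[)%classic (clamp 1 w.1, clamp t1 w.2).
  split; rewrite /= in_itv /= ?clamp_itv//.
  by have /andP[-> h] := clamp_itv w.2 t10; exact: le_lt_trans h tT.
have c1 : {for (x, t), continuous (fun w : R * R => clamp 1 w.1)}.
  apply: (@continuous_comp _ _ _ fst (clamp 1)); first exact: cvg_fst.
  exact: continuous_clamp.
have c2 : {for (x, t), continuous (fun w : R * R => clamp t1 w.2)}.
  apply: (@continuous_comp _ _ _ snd (clamp t1)); first exact: cvg_snd.
  exact: continuous_clamp.
move=> P /(cH _ (inA (x, t))) wP.
change (nbhs (clamp 1 x, clamp t1 t)
  (fun z : R * R => (`[0, 1] `*` `[0, T[)%classic z -> P (H z.1 z.2))) in wP.
have N : \forall w \near (x, t), (`[0, 1] `*` `[0, T[)%classic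
    (clamp 1 w.1, clamp t1 w.2) -> P (H (clamp 1 w.1) (clamp t1 w.2)).
  exact: (cvg_pair c1 c2 wP).
by apply: (filterS _ N) => w; apply; exact: inA.
Qed.

Lemma int01_shift f c : continuous f -> (forall x, f (x + 1) = f x) ->
  int01 (fun x => f (x - c)) = int01 f.
Proof.
move=> cf pf; have D (y : R) : is_derive y 1 (fun x => prim f (x - c)) (f (y - c)).
  have d1 : is_derive y 1 (fun x => x - c) 1.
    by apply: (is_derive_eq (is_derive1B (is_derive1_id y) (is_derive1_cst c y)));
      rewrite subr0.
  apply: (is_derive_eq (is_derive1_chain (f := prim f) (g := fun x => x - c)
    (is_derive_prim (y - c) cf) d1)).
  by rewrite mulr1.
have cfc : continuous (fun x => f (x - c)).
  move=> x; apply: (@continuous_comp _ _ _ (fun x => x - c) f); last exact: cf.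
  by apply: cvgB; [exact: cvg_id|exact: cvg_cst].
rewrite (int01_FTC cfc (fun x => is_derive_continuous (D x)) (fun x _ => D x)).
have -> : 1 - c = (0 - c) + 1 by ring.
by rewrite prim_periodic// int01E addrC addKr.
Qed.

Lemma strong_solution lambda kappa (u0 rho0 : R -> R) T u rho t1 :
  is_solution lambda kappa u0 rho0 T u rho -> 0 < t1 -> t1 < T ->
  let cl (H : R -> R -> R) := fun x t => H (clamp 1 x) (clamp t1 t) in
  strong lambda kappa t1 (cl u) (cl (dx u)) (cl (dx (dx u))) (cl (dt (dx u)))
    (cl rho) (cl (dx rho)) (cl (dt rho)) (nonlocal lambda kappa u rho).
Proof.
move=> [su sr per _ equ eqr] t10 tT cl.
have t10' := ltW t10.
have [cu [du [cp [dp [cpx _] [cpt _]]] _]] := su 2.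
have [cr [dr [crx _] [crt _]]] := sr 1.
have x01W x : 0 < x < 1 -> x \in `[0, 1].
  by rewrite in_itv /= => /andP[/ltW -> /ltW ->].
have t01W t : 0 < t < t1 -> t \in `[0, T[.
  by rewrite in_itv /= => /andP[/ltW -> /lt_trans]; apply.
have t01W' t : 0 < t < t1 -> t \in `]0, T[.
  by rewrite in_itv /= => /andP[-> /lt_trans]; apply.
have clE H x t : 0 <= x <= 1 -> 0 < t < t1 -> cl H x t = H x t.
  move=> x01 /andP[/ltW ta /ltW tb]; rewrite /cl !clampK//.
  by rewrite ta.
have oc x : 0 < x < 1 -> 0 <= x <= 1 by case/andP => /ltW -> /ltW ->.
have DX H x t : 0 < x < 1 -> 0 < t < t1 ->
    derivable_within `[0, 1] (fun y => H y t) x ->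
    is_derive x 1 (cl H ^~ t) (cl (dx H) x t).
  move=> x01 t01 dH; rewrite clE ?oc//.
  have n01 : nbhs x (`[0, 1]%classic : set R).
    move: x01 => /andP[x0 x1].
    apply: filterS2 (lt_nbhsr x0) (lt_nbhsl x1) => y y0 y1.
    by rewrite /= in_itv /= !ltW.
  apply: near_eq_is_derive (is_derive_within n01 dH).
  apply: filterS (near_clampK x01) => y yE.
  by rewrite /cl yE clampK//; move: t01 => /andP[/ltW -> /ltW ->].
have DT H x t : 0 <= x <= 1 -> 0 < t < t1 ->
    derivable_within `[0, +oo[ (fun s => H x s) t ->
    is_derive t 1 (cl H x) (cl (dt H) x t).
  move=> x01 t01 dH; rewrite clE//.
  have n0 : nbhs t (`[0, +oo[%classic : set R).
    move: t01 => /andP[t0 _].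
    by apply: filterS (lt_nbhsr t0) => s s0; rewrite /= in_itv /= ltW.
  apply: near_eq_is_derive (is_derive_within n0 dH).
  by apply: filterS (near_clampK t01) => s sE; rewrite /cl sE clampK.
have z01 : 0 <= (0 : R) <= 1 by rewrite lexx ler01.
have o01 : 0 <= (1 : R) <= 1 by rewrite lexx ler01.
split.
- exact: (continuous2_clamp t10' tT cu).
- exact: (continuous2_clamp t10' tT cp).
- exact: (continuous2_clamp t10' tT cpx).
- exact: (continuous2_clamp t10' tT cpt).
- exact: (continuous2_clamp t10' tT cr).
- exact: (continuous2_clamp t10' tT crx).
- exact: (continuous2_clamp t10' tT crt).
- by move=> x t x01 t01; apply: DX => //; exact: (du x t (x01W x x01) (t01W t t01)).1.
- by move=> x t x01 t01; apply: DX => //; exact: (dp x t (x01W x x01) (t01W t t01)).1.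
- by move=> x t x01 t01; apply: DX => //; exact: (dr x t (x01W x x01) (t01W t t01)).1.
- by move=> x t x01 t01; apply: DT => //; apply: (dp x t _ (t01W t t01)).2; rewrite in_itv.
- by move=> x t x01 t01; apply: DT => //; apply: (dr x t _ (t01W t t01)).2; rewrite in_itv.
- by move=> t t01; rewrite !clE//; exact: per (t01W t t01).
- by move=> x t x01 t01; rewrite !clE//; apply: equ (t01W' t t01); rewrite in_itv.
- by move=> x t x01 t01; rewrite !clE//; apply: eqr (t01W' t t01); rewrite in_itv.
Qed.

Lemma eul_init a H x : eul a H x 0 = H x 0.
Proof. by rewrite /eul param0 label0. Qed.

Local Opaque eul.

(** Galilean invariance: in the frame moving with velocity [bd] the explicit
    solution is again a solution, whose mean velocity can be prescribed through
    [bd]. *)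
Lemma strong_shifted lambda kappa a sigma t1 (bd : R -> R) :
  a != 0 -> lambda = (2 * a)^-1 -> kappa * (sigma * sigma) = 2 * a ->
  0 < t1 -> t1 < Tmax a -> continuous bd ->
  exists bx bt sx st J, strong lambda kappa t1
    (fun x t => eul a (vel a) (x - prim bd t) (clamp t1 t) + bd t)
    (fun x t => eul a (grad a) (x - prim bd t) (clamp t1 t)) bx bt
    (fun x t => eul a (dens a sigma) (x - prim bd t) (clamp t1 t)) sx st J.
Proof.
move=> a0 la ka t10 tT cbd.
have [GX [GT [tGX tGT dGX dGT]]] := tame_eul_derive a (tame_grad a).
have [DX [DT [tDX tDT dDX dDT]]] := tame_eul_derive a (tame_dens a sigma).
have Dc t : lifespan a (clamp t1 t).
  apply: lifespanW => //; have /andP[-> h] := clamp_itv t (ltW t10).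
  exact: le_lt_trans h tT.
have Dt t : 0 < t < t1 -> lifespan a t.
  by move=> /andP[/ltW u v]; apply: lifespanW => //; rewrite u (lt_trans v).
have cprim : continuous (prim bd).
  by move=> t; exact: is_derive_continuous (is_derive_prim t cbd).
have cH H : tame H -> continuous2 (fun y t => eul a H y (clamp t1 t)).
  move=> tH [y t].
  have cc : {for (y, t), continuous (fun w : R * R => clamp t1 w.2)}.
    apply: (@continuous_comp _ _ _ snd (clamp t1)); first exact: cvg_snd.
    exact: continuous_clamp.
  exact: (continuous2_cvg _ (continuous_eul (x := y) (tame_continuous tH) (Dc t))
    cvg_fst cc).
have cS H : tame H ->
    continuous2 (fun x t => eul a H (x - prim bd t) (clamp t1 t)).
  move=> tH.
  apply: (@continuous2_comp _ _ (fun y t => eul a H y (clamp t1 t))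
    (fun w : R * R => w.1 - prim bd w.2) snd (cH _ tH)).
    move=> w; apply: cvgB; first exact: cvg_fst.
    by apply: (@continuous_comp _ _ _ snd (prim bd)); [exact: cvg_snd|exact: cprim].
  exact: continuous_snd.
have cbd2 : continuous (fun w : R * R => bd w.2).
  by move=> w; apply: (@continuous_comp _ _ _ snd bd); [exact: cvg_snd|exact: cbd].
have clE t : 0 < t < t1 -> clamp t1 t = t.
  by move=> /andP[u v]; rewrite clampK// !ltW.
have SX H HX x t : (forall x t, is_derive x 1 (eul a H ^~ t) (eul a HX x t)) ->
    is_derive x 1 (fun x => eul a H (x - prim bd t) (clamp t1 t))
      (eul a HX (x - prim bd t) (clamp t1 t)).
  move=> dH; have d1 : is_derive x 1 (fun x => x - prim bd t) 1.
    by apply: (is_derive_eq (is_derive1B (is_derive1_id x) (is_derive1_cst _ x)));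
      rewrite subr0.
  apply: (is_derive_eq (is_derive1_chain (f := eul a H ^~ (clamp t1 t))
    (g := fun x => x - prim bd t) (dH _ _) d1)).
  by rewrite mulr1.
have ST H HX HT x t : 0 < t < t1 -> tame HX ->
    (forall x t, is_derive x 1 (eul a H ^~ t) (eul a HX x t)) ->
    (forall x t, lifespan a t -> is_derive t 1 (eul a H x) (eul a HT x t)) ->
    is_derive t 1 (fun t => eul a H (x - prim bd t) (clamp t1 t))
      (eul a HX (x - prim bd t) (clamp t1 t) * - bd t +
       eul a HT (x - prim bd t) (clamp t1 t)).
  move=> t01 tHX dHX dHT.
  have d1 : is_derive t 1 (fun t => x - prim bd t) (- bd t).
    by apply: (is_derive_eq (is_derive1B (is_derive1_cst x t) (is_derive_prim t cbd)));
      rewrite sub0r.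
  have d2 : is_derive t 1 (fun s => eul a H (x - prim bd t) (clamp t1 s))
      (eul a HT (x - prim bd t) (clamp t1 t)).
    rewrite (clE t t01); have dd := dHT (x - prim bd t) t (Dt t t01).
    apply: near_eq_is_derive dd; apply: filterS (near_clampK t01) => s sE.
    by rewrite sE.
  exact: (is_derive_chain2 (H := fun y t => eul a H y (clamp t1 t))
    (H1 := fun y t => eul a HX y (clamp t1 t)) (B := fun t => x - prim bd t)
    (cH _ tHX) (fun y s => dHX y (clamp t1 s)) d2 d1).
have per H x t : (forall al s, H (al + 1) s = H al s) -> eul a H (0 - x) t = eul a H (1 - x) t.
  by move=> pH; rewrite -(eulD1 a (0 - x) t pH); congr (eul _ _ _ _); ring.
exists (fun x t => eul a GX (x - prim bd t) (clamp t1 t)),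
  (fun x t => eul a GX (x - prim bd t) (clamp t1 t) * - bd t +
              eul a GT (x - prim bd t) (clamp t1 t)),
  (fun x t => eul a DX (x - prim bd t) (clamp t1 t)),
  (fun x t => eul a DX (x - prim bd t) (clamp t1 t) * - bd t +
              eul a DT (x - prim bd t) (clamp t1 t)),
  (fun t => source a (param a (clamp t1 t))).
have cbt H K : tame H -> tame K -> continuous2 (fun x t =>
    eul a H (x - prim bd t) (clamp t1 t) * - bd t +
    eul a K (x - prim bd t) (clamp t1 t)).
  move=> tH tK; apply: continuous_add; last exact: (cS _ tK).
  apply: continuous_mul; first exact: (cS _ tH).
  by move=> w; apply: cvgN; exact: cbd2.
split.
- by apply: continuous_add => //; exact: (cS _ (tame_vel a)).
- exact: (cS _ (tame_grad a)).
- exact: (cS _ tGX).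
- exact: cbt.
- exact: (cS _ (tame_dens a sigma)).
- exact: (cS _ tDX).
- exact: cbt.
- move=> x t _ _; have := SX _ _ x t (is_derive_vel a) => dv.
  by apply: (is_derive_eq (is_derive1D dv (is_derive1_cst (bd t) x))); rewrite addr0.
- by move=> x t _ _; exact: SX.
- by move=> x t _ _; exact: SX.
- by move=> x t _ t01; exact: ST.
- by move=> x t _ t01; exact: ST.
- move=> t _; rewrite (per _ _ _ (velD1 a)) (per _ _ _ (gradD1 a)).
  by rewrite (per _ _ _ (densD1 a sigma)).
- move=> x t _ t01; rewrite clE//.
  rewrite -(grad_eulerian a0 la ka (Dt t t01) (dGX (x - prim bd t) t)
    (dGT (x - prim bd t) t (Dt t t01))).
  set A := eul _ GX _ _; set B := eul _ GT _ _; set V := eul _ (vel a) _ _.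
  set P := lambda * _; set Q := kappa * _.
  have fin (b : R) : A * - b + B + (V + b) * A - P - Q = B + V * A - P - Q by ring.
  exact: fin.
- move=> x t _ t01; rewrite clE//.
  rewrite -(dens_eulerian a0 la (Dt t t01) (dDX (x - prim bd t) t)
    (dDT (x - prim bd t) t (Dt t t01))).
  set A := eul _ DX _ _; set B := eul _ DT _ _; set V := eul _ (vel a) _ _.
  have fin (b : R) : A * - b + B + (V + b) * A = B + V * A by ring.
  exact: fin.
Qed.

(** Every solution with the chosen data is a translate in space of the explicit
    one: a change of Galilean frame, driven by the difference of the mean
    velocities, is the only freedom left by the equations. *)
Theorem solution_shift lambda kappa a sigma u rho t :
  a != 0 -> lambda = (2 * a)^-1 -> kappa * (sigma * sigma) = 2 * a ->
  is_solution lambda kappa (fun=> 0) (fun x => sigma * cos (2 * pi * x)) (Tmax a)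
    u rho ->
  0 <= t < Tmax a -> exists c, forall x, 0 <= x <= 1 ->
    dx u x t = eul a (grad a) (x - c) t /\
    rho x t = eul a (dens a sigma) (x - c) t.
Proof.
move=> a0 la ka sol /andP[t0 tT].
(* any time strictly between t and the end of the lifespan *)
pose t1 := (t + Tmax a) / 2.
have t10 : 0 < t1 by rewrite /t1; lra.
have t1T : t1 < Tmax a by rewrite /t1; lra.
have tt1 : t <= t1 by rewrite /t1; lra.
have S1 := strong_solution sol t10 t1T.
pose uc x s := u (clamp 1 x) (clamp t1 s).
pose vc x s := eul a (vel a) x (clamp t1 s).
have Dc s : lifespan a (clamp t1 s).
  apply: lifespanW => //; have /andP[-> h] := clamp_itv s (ltW t10).
  exact: le_lt_trans h t1T.
have cvc : continuous2 vc.
  move=> [y s].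
  have cc : {for (y, s), continuous (fun w : R * R => clamp t1 w.2)}.
    apply: (@continuous_comp _ _ _ snd (clamp t1)); first exact: cvg_snd.
    exact: continuous_clamp.
  exact: (continuous2_cvg _ (continuous_eul (x := y)
    (tame_continuous (tame_vel a)) (Dc s)) cvg_fst cc).
have cuc : continuous2 uc := strong_cu S1.
pose bd s := int01 (uc ^~ s) - int01 (vc ^~ s).
have cbd : continuous bd.
  exact: continuous_sub (continuous_int01 cuc) (continuous_int01 cvc).
have [bx [bt [sx [st [J S2]]]]] := strong_shifted a0 la ka t10 t1T cbd.
exists (prim bd t) => x x01.
have cl0 : clamp t1 0 = 0 by rewrite clampK// lexx ltW.
have [|||h1 h2] := strong_unique S1 S2 _ _ x01 (_ : 0 <= t <= t1).
- move=> s s01; have cs : continuous (vc ^~ s).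
    by move=> y; exact: continuous_pair_l (cvc (y, s)).
  have csh : continuous (fun y => vc (y - prim bd s) s).
    move=> y; apply: (@continuous_comp _ _ _ (fun y => y - prim bd s) (vc ^~ s)).
      by apply: cvgB; [exact: cvg_id|exact: cvg_cst].
    exact: cs.
  rewrite (int01D csh (@continuous_cst _ _ _)) int01_cst.
  rewrite (int01_shift _ cs) => [|y]; last by rewrite /vc eulD1//; exact: velD1.
  by rewrite /bd addrC subrK.
- move=> y y01; rewrite !cl0 prim0 subr0 clampK//; split.
    have E0 z : z \in `[0, 1] -> u z 0 = eul a (vel a) z 0.
      rewrite in_itv /= => z01; have [-> _] := sol_init sol z01.
      by rewrite eul_init vel0.
    have y01' : y \in `[0, 1] by rewrite in_itv.
    by have [_ ->] := eul_dx (fun x => is_derive_vel a x 0) E0 y01'.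
  have [_ ->] := sol_init sol y01.
  by rewrite eul_init dens0.
- by rewrite t0.
- by move: h1 h2; rewrite !clampK// t0.
Qed.

End Transfer.

(** * Growth rates and finite-time blowup *)

Section Growth.
Context {R : realType}.
Implicit Types (x y s t al e p : R).

Local Notation S al := (sin (2 * pi * al)).
Local Notation C al := (cos (2 * pi * al)).

Lemma le_powR e x y : 0 <= e -> 0 < x -> x <= y -> x `^ e <= y `^ e.
Proof.
move=> e0 x0 xy; apply: (ge0_ler_powR e0) => //; rewrite nnegrE ltW//.
exact: lt_le_trans x0 xy.
Qed.

Lemma le_powRN e x y : e <= 0 -> 0 < x -> x <= y -> y `^ e <= x `^ e.
Proof.
move=> e0 x0 xy; rewrite -[e]opprK !(powRN _ (- e)).
rewrite lef_pV2 ?posrE ?powR_gt0//; last exact: lt_le_trans x0 xy.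
by apply: le_powR => //; lra.
Qed.

Lemma powR_pos_neq0 e x : 0 < x -> (e == 0) ==> (x != 0).
Proof. by move=> x0; rewrite (gt_eqF x0) implybT. Qed.

Lemma powR_D e1 e2 x : 0 < x -> x `^ (e1 + e2) = x `^ e1 * x `^ e2.
Proof. by move=> x0; rewrite powRD// powR_pos_neq0. Qed.

Lemma sqrS al : S al * S al = 1 - C al * C al.
Proof. by rewrite -!expr2 sin2cos2. Qed.

Lemma sqrS_le1 al : S al * S al <= 1.
Proof. by rewrite sqrS -expr2; have := sqr_ge0 (C al); lra. Qed.

(** The maximum of [q] over the labels. *)
Definition r2 s : R := 1 + s * s.

Lemma r2_gt0 s : 0 < r2 s. Proof. exact: sq1_gt0. Qed.

Lemma q_le_r2 al s : q al s <= r2 s.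
Proof.
rewrite /q /r2 lerD2l ler_piMr ?sqrS_le1//.
by rewrite -expr2 sqr_ge0.
Qed.

Lemma is_derive_q_label al s : is_derive al 1 (q ^~ s)
  (s * s * (2 * (2 * pi * C al) * S al)).
Proof.
apply: (is_derive_eq (is_derive1D (is_derive1_cst 1 al) (is_derive1Z (s * s)
  (is_derive1M (is_derive1_sin2pi al) (is_derive1_sin2pi al))))).
by ring.
Qed.

Lemma continuous_q s : continuous (fun al => q al s).
Proof. by move=> al; exact: is_derive_continuous (is_derive_q_label al s). Qed.

Lemma continuous_S : continuous (fun al : R => S al).
Proof. by move=> al; exact: is_derive_continuous (is_derive1_sin2pi al). Qed.

Lemma continuous_C : continuous (fun al : R => C al).
Proof. by move=> al; exact: is_derive_continuous (is_derive1_cos2pi al). Qed.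

(** For [e < 1/2] the singularity of [q `^ (- e)] stays integrable as [s] grows.
    This follows without local analysis: [S * C * q `^ (- e)] is periodic, so its
    derivative has zero mean, and [s ^+ 2 * S ^+ 2 <= q] bounds that derivative
    below by a multiple of [((1 - 2 * e) - (2 - 2 * e) * S ^+ 2) * q `^ (- e)]. *)
Lemma int_qpow_le e s : 0 <= e -> e < 1 / 2 -> 1 <= s ->
  int01 (fun al => q al s `^ (- e)) <= (4 - 4 * e) / (1 - 2 * e) * r2 s `^ (- e).
Proof.
move=> e0 e2 s1.
pose F al := S al * C al * q al s `^ (- e).
pose f al := 2 * pi * ((C al * C al - S al * S al) -
  2 * e * (s * s * (S al * S al)) * (C al * C al) / q al s) * q al s `^ (- e).
have dF al : is_derive al 1 F (f al).
  have q0 := q_gt0 al s.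
  apply: (is_derive_eq (is_derive1M (is_derive1M (is_derive1_sin2pi al)
    (is_derive1_cos2pi al)) (is_derive1_pow (- e) (is_derive_q_label al s) q0))).
  rewrite (powRB1 _ q0) /f; field.
  by rewrite gt_eqF.
have cqe := @continuous_qpow R (- e) s.
have cS2 : continuous (fun al : R => S al * S al) := continuous_mul (@continuous_S) (@continuous_S).
have cC2 : continuous (fun al : R => C al * C al) := continuous_mul (@continuous_C) (@continuous_C).
have cst c : continuous (fun _ : R => c : R) := @continuous_cst _ _ c.
have cqV : continuous (fun al => (q al s)^-1).
  by move=> al; apply: cvgV; [rewrite gt_eqF ?q_gt0|exact: continuous_q].
have cf : continuous f.
  rewrite /f; apply: (continuous_mul _ cqe); apply: (continuous_mul (cst _)).
  apply: continuous_sub; first exact: (continuous_sub cC2 cS2).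
  apply: (continuous_mul _ cqV); apply: (continuous_mul _ cC2).
  apply: (continuous_mul (cst _)).
  exact: (continuous_mul (cst (s * s)) cS2).
have If : int01 f = 0.
  have cF : continuous F by move=> al; exact: is_derive_continuous (dF al).
  rewrite (int01_FTC cf cF (fun al _ => dF al)) /F.
  have := sin2piD1 (0 : R); rewrite add0r mulr0 sin0 => ->.
  by rewrite !mul0r subrr.
pose g al := 2 * pi * ((1 - 2 * e) * q al s `^ (- e) -
  (2 - 2 * e) * (S al * S al * q al s `^ (- e))).
have cg1 := continuous_mul (cst (1 - 2 * e)) cqe.
have cg2' := continuous_mul cS2 cqe.
have cg2 := continuous_mul (cst (2 - 2 * e)) cg2'.
have cg : continuous g.
  exact: (continuous_mul (cst (2 * pi)) (continuous_sub cg1 cg2)).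
have gf al : g al <= f al.
  have q0 := q_gt0 al s.
  rewrite /g /f -[leRHS]mulrA ler_pM2l ?mulr_gt0 ?pi_gt0//.
  rewrite [X in _ - X]mulrA -mulrBl ler_pM2r ?powR_gt0//.
  have : s * s * (S al * S al) / q al s <= 1.
    by rewrite ler_pdivrMr// mul1r /q lerDr.
  have C0 : 0 <= 2 * e * (C al * C al).
    by apply: mulr_ge0; [lra|rewrite -expr2 sqr_ge0].
  move=> /(ler_wpM2l C0); rewrite mulr1.
  have -> : 2 * e * (s * s * (S al * S al)) * (C al * C al) / q al s =
    2 * e * (C al * C al) * (s * s * (S al * S al) / q al s) by ring.
  by move: (s * s * _ / _) => X; rewrite sqrS; lra.
have := ler_int01 cg cf (fun al _ => gf al); rewrite If.
rewrite (int01Z _ (continuous_sub cg1 cg2)) (int01B cg1 cg2) (int01Z _ cqe) (int01Z _ cg2').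
rewrite pmulr_rle0 ?mulr_gt0 ?pi_gt0// subr_le0 => h.
have s2 : r2 s <= 2 * (s * s) by rewrite /r2; nra.
have hb : int01 (fun al => S al * S al * q al s `^ (- e)) <= 2 * r2 s `^ (- e).
  rewrite -[leRHS]int01_cst; apply: ler_int01 => // al _.
  have q0 := q_gt0 al s; have r0 := r2_gt0 s.
  have hS : S al * S al <= 2 * (q al s / r2 s).
    rewrite mulrA ler_pdivlMr//.
    have : s * s * (S al * S al) <= q al s by rewrite /q lerDr.
    have S0 : 0 <= S al * S al by rewrite -expr2 sqr_ge0.
    by have := ler_wpM2l S0 s2; nra.
  apply: le_trans (ler_wpM2r (powR_ge0 _ _) hS) _.
  have pw x : 0 < x -> x * x `^ (- e) = x `^ (1 - e).
    by move=> x0; rewrite powR_D// powRr1 ?ltW.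
  rewrite -mulrA ler_pM2l// mulrAC ler_pdivrMr// [leRHS]mulrC !pw//.
  by apply: le_powR => //; [lra|exact: q_le_r2].
have e2' : 0 < 1 - 2 * e by lra.
rewrite mulrAC ler_pdivlMr// mulrC; apply: le_trans h _.
have e3 : 0 <= 2 - 2 * e by lra.
by have := ler_wpM2l e3 hb; lra.
Qed.

Section Rates.
Variable a : R.
Hypothesis a_neq0 : a != 0.
Local Notation k := (k a).

(** [k `^ a^-1] decays at least like the power [- rate] of [r2]. *)
Definition rate : R := if 0 < a then (2 * a + 1)^-1 else 1.

Lemma rate_gt0 : 0 < rate.
Proof. by rewrite /rate; case: ifPn => // a0; rewrite invr_gt0; lra. Qed.

(** For positive exponents: [y `^ b >= L `^ b * (1 - L `^ (1/4) * y `^ (-1/4))]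
    turns the upper bound on the mean of [q `^ (-1/4)] into a lower bound. *)
Lemma int_qpow_ge b : 0 < b -> exists2 c, 0 < c &
  forall s, 1 <= s -> c * r2 s `^ b <= int01 (fun al => q al s `^ b).
Proof.
move=> b0; pose D : R := (4 - 4 * (1 / 4)) / (1 - 2 * (1 / 4)).
have D6 : D = 6 by rewrite /D; field.
pose y0 : R := 12 `^ (- 4).
have y00 : 0 < y0 by rewrite powR_gt0.
exists (2^-1 * y0 `^ b); first by rewrite mulr_gt0// powR_gt0.
move=> s s1; have r0 := r2_gt0 s; pose L := y0 * r2 s.
have L0 : 0 < L by rewrite mulr_gt0.
have H := @int_qpow_le (1 / 4) s ltac:(lra) ltac:(lra) s1.
rewrite -/D D6 in H.
have c4 := @continuous_qpow R (- (1 / 4)) s.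
have c1 : continuous (fun al => L `^ (1 / 4) * q al s `^ (- (1 / 4))).
  exact: continuous_mul (@continuous_cst _ _ _) c4.
have c2 : continuous (fun al => 1 - L `^ (1 / 4) * q al s `^ (- (1 / 4))).
  exact: continuous_sub (@continuous_cst _ _ _) c1.
apply: (@le_trans _ _
    (int01 (fun al => L `^ b * (1 - L `^ (1 / 4) * q al s `^ (- (1 / 4)))))).
  rewrite (int01Z _ c2) (int01B (@continuous_cst _ _ 1) c1) (int01Z _ c4) int01_cst.
  have LE : L `^ b = y0 `^ b * r2 s `^ b by rewrite /L powRM ?ltW.
  rewrite -mulrA -LE [leLHS]mulrC ler_pM2l ?powR_gt0//.
  have : L `^ (1 / 4) * int01 (fun al => q al s `^ (- (1 / 4))) <= 2^-1.
    apply: le_trans (ler_wpM2l (powR_ge0 _ _) H) _.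
    have -> : L `^ (1 / 4) = 12^-1 * r2 s `^ (1 / 4).
      rewrite /L powRM ?ltW// /y0 -powRrM.
      by rewrite (_ : - 4 * (1 / 4) = - 1) ?powRN1//; field.
    rewrite mulrACA [X in _ * X](_ : _ = 1); first by lra.
    by rewrite -powR_D// subrr powRr0.
  by lra.
apply: ler_int01.
- exact: continuous_mul (@continuous_cst _ _ _) c2.
- exact: continuous_qpow.
move=> al _; have q0 := q_gt0 al s.
have Lq : L `^ (1 / 4) * q al s `^ (- (1 / 4)) = (L / q al s) `^ (1 / 4).
  by rewrite powRM ?invr_ge0 ?ltW// -(powRN1 q0) -powRrM mulN1r.
have [qL|qL] := leP L (q al s).
  apply: le_trans (le_powR (ltW b0) L0 qL).
  rewrite ler_piMr ?powR_ge0//.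
  have : 0 <= L `^ (1 / 4) * q al s `^ (- (1 / 4)) by rewrite mulr_ge0 ?powR_ge0.
  by lra.
apply: (@le_trans _ _ 0); last exact: powR_ge0.
rewrite mulr_ge0_le0 ?powR_ge0// subr_le0 Lq.
have h : 1 <= L / q al s by rewrite ler_pdivlMr// mul1r ltW.
have : 1 `^ (1 / 4) <= (L / q al s) `^ (1 / 4) by apply: le_powR => //; lra.
by rewrite powR1.
Qed.

(** For [a < 0] this is [int_qpow_ge].  For [a > 0] the exponent [- a] may exceed
    the range of [int_qpow_le]; since [q >= 1] it can be weakened to [- th], and
    [th = a / (2 * a + 1)] always lies below 1/2. *)
Lemma k_rate : exists2 c, 0 < c & forall s, 1 <= s ->
  k s `^ a^-1 <= c * r2 s `^ (- rate).
Proof.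
rewrite /rate; case: ifPn => a0; last first.
  have b0 : 0 < - a by rewrite oppr_gt0; case: ltgtP a0 a_neq0.
  have [c c0 H] := int_qpow_ge b0.
  exists (c `^ a^-1); first exact: powR_gt0.
  move=> s s1; have r0 := r2_gt0 s.
  have -> : c `^ a^-1 * r2 s `^ (- 1) = (c * r2 s `^ (- a)) `^ a^-1.
    by rewrite powRM ?powR_ge0 ?ltW// -powRrM mulNr divff.
  apply: le_powRN; [by rewrite invr_le0; lra|by rewrite mulr_gt0 ?powR_gt0|].
  exact: H.
pose th := a / (2 * a + 1).
have a1 : 0 < 2 * a + 1 by lra.
have th0 : 0 < th by rewrite divr_gt0.
have th2 : th < 1 / 2 by rewrite ltr_pdivrMr//; lra.
have tha : th <= a by rewrite ler_pdivrMr//; nra.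
pose D := (4 - 4 * th) / (1 - 2 * th).
have D0 : 0 < D by rewrite divr_gt0//; lra.
exists (D `^ a^-1); first exact: powR_gt0.
move=> s s1; have r0 := r2_gt0 s.
have -> : D `^ a^-1 * r2 s `^ (- (2 * a + 1)^-1) = (D * r2 s `^ (- th)) `^ a^-1.
  rewrite (powRM _ (ltW D0) (powR_ge0 _ _)) -powRrM; congr (_ * _ `^ _).
  by rewrite /th; field; rewrite a_neq0 gt_eqF.
apply: le_powR; [by rewrite invr_ge0 ltW|exact: k_gt0|].
apply: le_trans (int_qpow_le (ltW th0) th2 s1).
apply: ler_int01; try exact: continuous_qpow.
move=> al _; apply: ler_powR; first exact: q_ge1.
by lra.
Qed.

Lemma r2_ge s : s * s <= r2 s. Proof. by rewrite /r2; lra. Qed.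

(** Finite-time blowup: by [k_rate] the integrand [tau_s] decays like the power
    [- 1 - 2 * rate] of the parameter. *)
Lemma tau_bounded : has_ubound (range (tau a)).
Proof.
have [c c0 H] := k_rate; have rt0 := rate_gt0.
pose ep := 2 * rate; have ep0 : 0 < ep by rewrite mulr_gt0.
(* the bound is the integral of the majorant over [1, +oo[ *)
exists (tau a 1 + c / ep) => _ [s _ <-].
have ce : 0 < c / ep by rewrite divr_gt0.
have [s1|s1] := leP s 1.
  have : tau a s <= tau a 1.
    move: s1; rewrite le_eqVlt => /predU1P[->//|s1].
    by apply: ltW; rewrite tau_incr.
  by lra.
pose F x := - (c / ep * x `^ (- ep)) - tau a x.
have dF x : 0 < x -> is_derive x 1 F
    (- (c / ep * (- ep * x `^ (- ep - 1))) - tau_s a x).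
  move=> x0; apply: is_derive1B; last exact: is_derive_tau.
  by apply: is_derive1N; apply: is_derive1Z; exact: is_derive1_powR.
have : F 1 <= F s.
  apply: (derive_ge0_le (ltW s1)
    (dF := fun x => - (c / ep * (- ep * x `^ (- ep - 1))) - tau_s a x)).
  - by move=> x; rewrite in_itv /= => /andP[x1 _]; apply: dF; lra.
  - apply: derivable_within_continuous => x; rewrite in_itv /= => /andP[x1 _].
    by have [] := dF x ltac:(lra).
  - move=> x; rewrite in_itv /= => /andP[x1 _].
    rewrite mulNr mulrN opprK mulrA divfK ?gt_eqF// subr_ge0.
    have x0 : 0 < x by lra.
    have r0 := r2_gt0 x.
    rewrite /tau_s -/(r2 x).
    apply: le_trans (ler_wpM2l (powR_ge0 _ _) (H x (ltW x1))) _.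
    rewrite mulrCA ler_pM2l// -powR_D//.
    have -> : x `^ (- ep - 1) = (x * x) `^ (- 2^-1 - rate).
      rewrite -expr2 -powR_mulrn ?ltW// -powRrM; congr (_ `^ _).
      by rewrite /ep; field.
    apply: le_powRN; [by lra|by rewrite mulr_gt0|exact: r2_ge].
rewrite /F powR1 mulr1.
have : 0 <= c / ep * s `^ (- ep) by rewrite mulr_ge0 ?powR_ge0// ltW.
by lra.
Qed.

Lemma k_growth p : 0 < a + p -> exists2 c, 0 < c & forall s, 1 <= s ->
  c * r2 s `^ (rate * (a + p)) <= k s `^ (- 1 - p / a).
Proof.
move=> ap; have [c c0 H] := k_rate.
exists (c `^ (- (a + p))); first exact: powR_gt0.
move=> s s1; have k0 := k_gt0 a s; have r0 := r2_gt0 s.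
have -> : k s `^ (- 1 - p / a) = (k s `^ a^-1) `^ (- (a + p)).
  by rewrite -powRrM; congr (_ `^ _); field.
have -> : c `^ (- (a + p)) * r2 s `^ (rate * (a + p)) =
    (c * r2 s `^ (- rate)) `^ (- (a + p)).
  by rewrite powRM ?powR_ge0 ?ltW// -powRrM mulrNN.
by apply: le_powRN; [lra|exact: powR_gt0|exact: H].
Qed.

End Rates.
End Growth.

(** * Lower bounds for the norms *)

Section Norms.
Context {R : realType}.
Implicit Types (x y s t al e p : R).

Local Notation S al := (sin (2 * pi * al)).
Local Notation C al := (cos (2 * pi * al)).

Lemma derive_ge0_leT (F dF : R -> R) x y : x <= y ->
  (forall z : R, is_derive z 1 F (dF z)) -> (forall z, x < z < y -> 0 <= dF z) ->
  F x <= F y.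
Proof.
move=> xy D F0; apply: (derive_ge0_le xy (fun z _ => D z)).
  by apply: continuous_subspaceT => z; exact: is_derive_continuous (D z).
by move=> z; rewrite in_itv /=; exact: F0.
Qed.

Lemma continuous_normp p : 0 < p -> continuous (fun x : R => `|x| `^ p).
Proof.
move=> p0 x; have [->|x0] := eqVneq x 0.
  apply/cvgrPdist_lt => e e0; rewrite normr0 powR0 ?gt_eqF//.
  have e1 : 0 < e `^ p^-1 by exact: powR_gt0.
  have N : \forall y \near (0 : R), `|y| < e `^ p^-1 by exact: nbhs0_lt.
  apply: filterS N => y ye; rewrite sub0r normrN ger0_norm ?powR_ge0//.
  have -> : e = (e `^ p^-1) `^ p by rewrite -powRrM mulVf ?gt_eqF// powRr1// ltW.
  by apply: gt0_ltr_powR => //; rewrite ?nnegrE ?normr_ge0 ?(ltW e1).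
apply: (@continuous_comp _ _ _ (fun y : R => `|y|) (@powR R ^~ p)).
  exact: norm_continuous.
by apply: is_derive_continuous (is_derive1_powR p _); rewrite normr_gt0.
Qed.

Lemma continuous_normp_comp p (f : R -> R) : 0 < p -> continuous f ->
  continuous (fun x => `|f x| `^ p).
Proof.
move=> p0 cf x.
by apply: (@continuous_comp _ _ _ f (fun y : R => `|y| `^ p)); [exact: cf|exact: continuous_normp].
Qed.

Lemma sin_bounds y : 0 <= y <= 1 -> y / 2 <= sin y <= y.
Proof.
have sle (z : R) : 0 <= z -> sin z <= z.
  move=> z0; have D (x : R) : is_derive x 1 (fun x => x - sin x) (1 - cos x).
    exact: is_derive1B (is_derive1_id x) (is_derive_sin x).
  have := derive_ge0_leT z0 D (fun x _ => _); rewrite sin0 subrr subr_ge0; apply.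
  by move=> x; rewrite subr_ge0 cos_le1.
move=> /andP[y0 y1]; rewrite sle// andbT.
have D (x : R) : is_derive x 1 (fun x => sin x - 2^-1 * x) (cos x - 2^-1 * 1).
  exact: is_derive1B (is_derive_sin x) (is_derive1Z _ (is_derive1_id x)).
have H x : 0 < x < y -> 0 <= cos x - 2^-1 * 1.
  move=> /andP[x0 xy].
  have -> : cos x = 1 - 2 * (sin (x / 2) * sin (x / 2)).
    have := cos_mulr2n (x / 2); rewrite (_ : x / 2 *+ 2 = x); last by rewrite mulr2n; lra.
    by move=> ->; rewrite cos2sin2 mulr2n expr2; lra.
  have s1 := sle (x / 2) ltac:(lra).
  have s0 : 0 <= sin (x / 2).
    by apply: sin_ge0_pi; have := pi_ge2 R; move=> ?; apply/andP; split; lra.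
  by nra.
have := derive_ge0_leT y0 D H.
by rewrite sin0 mulr0 subr0; lra.
Qed.

(** A label [al] at the scale [1 / s] of the concentration, in terms of
    [y = 2 * pi * s * al]. *)
Lemma q_near_0 al s : 1 <= s -> 0 <= al -> 2 * pi * (s * al) <= 1 ->
  (2 * pi * (s * al) / 2) ^+ 2 <= q al s - 1 <= (2 * pi * (s * al)) ^+ 2.
Proof.
move=> s1 al0; set y := 2 * pi * (s * al) => y1.
have p0 := pi_gt0 R.
have w0 : 0 <= 2 * pi * al by rewrite !mulr_ge0// ltW.
have yw : y = s * (2 * pi * al) by rewrite /y; ring.
have w1 : 2 * pi * al <= 1 by rewrite yw in y1; nra.
have /andP[h1 h2] : 2 * pi * al / 2 <= S al <= 2 * pi * al.
  by apply: sin_bounds; rewrite w0 w1.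
have -> : q al s - 1 = (s * S al) ^+ 2 by rewrite /q expr2; ring.
have sS : s * (2 * pi * al / 2) <= s * S al by rewrite ler_pM2l//; lra.
have sS' : s * S al <= s * (2 * pi * al) by rewrite ler_pM2l//; lra.
have s0 : 0 <= s * (2 * pi * al / 2) by rewrite mulr_ge0//; lra.
rewrite yw; apply/andP; split.
  by rewrite -[X in X ^+ 2]mulrA; rewrite ler_pXn2r ?nnegrE//; lra.
by rewrite ler_pXn2r ?nnegrE//; lra.
Qed.

Lemma absC_ge al : `|S al| <= 1 / 2 -> 1 / 2 <= `|C al|.
Proof.
move=> h; have := sqrS al; have := normr_ge0 (C al).
have : S al * S al <= (1 / 2) * (1 / 2).
  by rewrite -expr2 -real_normK ?num_real// expr2 ler_pM.
have -> : C al * C al = `|C al| * `|C al|.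
  by rewrite -normrM ger0_norm// -expr2 sqr_ge0.
by nra.
Qed.

Lemma powR_12 e x : 1 <= x <= 2 -> Num.min 1 (2 `^ e) <= x `^ e.
Proof.
move=> /andP[x1 x2]; have [e0|e0] := leP 0 e.
  rewrite ge_min; apply/orP; left.
  have : 1 `^ e <= x `^ e by apply: le_powR.
  by rewrite powR1.
rewrite ge_min; apply/orP; right.
by apply: le_powRN; [exact: ltW|lra|].
Qed.

Section Sigma.
Variables (a sigma : R).
Hypothesis a_neq0 : a != 0.
Hypothesis sigma_neq0 : sigma != 0.
Local Notation k := (k a).
Local Notation jac := (jac a).

(** The p-th powers of the norms of the density and of the velocity gradient,
    in Lagrangian variables. *)
Definition dens_int p s := int01 (fun al => `|dens a sigma al s| `^ p * jac al s).

Definition grad_int p s := int01 (fun al => `|grad a al s| `^ p * jac al s).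

Lemma dens_intE p s : 0 < p -> dens_int p s =
  `|sigma| `^ p * k s `^ (- 1 - p / a) *
    int01 (fun al => `|C al| `^ p * q al s `^ (- p - a)).
Proof.
move=> p0; have k0 := k_gt0 a s; rewrite -int01Z; last first.
  apply: continuous_mul; last exact: continuous_qpow.
  exact: (continuous_normp_comp p0 (@continuous_C R)).
apply: eq_int01 => al _; have q0 := q_gt0 al s.
rewrite /dens jacE !normrM !(ger0_norm (powR_ge0 _ _)).
rewrite !powRM ?mulr_ge0 ?powR_ge0// -!powRrM.
rewrite (powR_D _ _ k0) (_ : - (p / a) = - a^-1 * p); last by field.
rewrite (powR_D _ _ q0) mulN1r; ring.
Qed.

(** With [1 / q] in place of the squared sine, the velocity gradient becomes a
    multiple of the deviation of [1 / q] from its weighted mean [shiftB]. *)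
Definition shiftB s := 1 + m a s * s / (2 * a).

Lemma gradE al s : 0 < s ->
  `|grad a al s| = speed a s * (2 * `|a| / s) * `|(q al s)^-1 - shiftB s|.
Proof.
move=> s0; have q0 := q_gt0 al s.
have -> : grad a al s = speed a s * (2 * a / s * ((q al s)^-1 - shiftB s)).
  rewrite /grad /strain powRN1// /shiftB.
  have -> : q_s al s = 2 / s * (q al s - 1).
    by rewrite /q_s /q; field; rewrite gt_eqF.
  by field; rewrite a_neq0 !gt_eqF.
rewrite normrM (gtr0_norm (speed_gt0 _ _)) !normrM normfV (gtr0_norm s0) normr_nat.
by rewrite -!mulrA.
Qed.

Lemma continuous_qshift s : continuous (fun al => (q al s)^-1 - shiftB s).
Proof.
apply: continuous_sub; last exact: continuous_cst.
by move=> al; apply: cvgV; [rewrite gt_eqF ?q_gt0|exact: continuous_q].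
Qed.

Lemma grad_intE p s : 0 < p -> 0 < s -> grad_int p s =
  (speed a s * (2 * `|a| / s)) `^ p * k s `^ (-1) *
    int01 (fun al => `|(q al s)^-1 - shiftB s| `^ p * q al s `^ (- a)).
Proof.
move=> p0 s0; rewrite -int01Z; last first.
  apply: continuous_mul; last exact: continuous_qpow.
  exact: (continuous_normp_comp p0 (@continuous_qshift s)).
apply: eq_int01 => al _; rewrite gradE// jacE powRM//; last first.
  by rewrite mulr_ge0 ?(ltW (speed_gt0 _ _))// divr_ge0 ?mulr_ge0// ltW.
ring.
Qed.

Lemma speed_ge p s : 0 < p -> 0 < s ->
  (2 * `|a|) `^ p * k s `^ (- (p / a)) <= (speed a s * (2 * `|a| / s)) `^ p.
Proof.
move=> p0 s0; have k0 := k_gt0 a s.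
have a0 : 0 < 2 * `|a| by rewrite mulr_gt0// normr_gt0.
have -> : (2 * `|a|) `^ p * k s `^ (- (p / a)) = (2 * `|a| * k s `^ (- a^-1)) `^ p.
  rewrite (powRM _ (ltW a0) (powR_ge0 (k s) (- a^-1))) -powRrM.
  by congr (_ * _ `^ _); field.
apply: le_powR; [exact: ltW|by rewrite mulr_gt0 ?powR_gt0|].
have h : s <= (1 + s * s) `^ 2^-1.
  rewrite -{1}(powRr1 (ltW s0)) (_ : s `^ 1 = (s * s) `^ 2^-1).
    by apply: le_powR; rewrite ?mulr_gt0//; lra.
  by rewrite powRM ?ltW// -powR_D//; congr (_ `^ _); field.
rewrite /speed.
have -> : (1 + s * s) `^ 2^-1 * k s `^ (- a^-1) * (2 * `|a| / s) =
   (2 * `|a| * k s `^ (- a^-1)) * ((1 + s * s) `^ 2^-1 / s) by ring.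
by rewrite ler_peMr ?mulr_ge0 ?powR_ge0// ler_pdivlMr// mul1r.
Qed.

(** The labels within a distance [w / s] of 0, where [1 <= q <= 2] and the cosine
    is at least 1/2, contribute this much. *)
Lemma dens_int_ge p : 0 < p -> exists2 c, 0 < c & forall s, 1 <= s ->
  c * k s `^ (- 1 - p / a) / s <= dens_int p s.
Proof.
move=> p0; have pi0 := pi_gt0 R.
pose w : R := (16 * pi)^-1; have w0 : 0 < w by rewrite invr_gt0 mulr_gt0.
pose c1 := (1 / 2) `^ p * Num.min 1 (2 `^ (- p - a)).
have c10 : 0 < c1 by rewrite mulr_gt0 ?powR_gt0// lt_min ltr01 powR_gt0.
have sg : 0 < `|sigma| `^ p by rewrite powR_gt0// normr_gt0.
exists (`|sigma| `^ p * (c1 * w)); first by rewrite !mulr_gt0.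
move=> s s1; have s0 : 0 < s by lra.
have k0 := k_gt0 a s.
rewrite dens_intE//.
have -> : `|sigma| `^ p * (c1 * w) * k s `^ (-1 - p / a) / s =
  `|sigma| `^ p * k s `^ (-1 - p / a) * (c1 * (w / s - 0)) by ring.
rewrite ler_pM2l; last by rewrite mulr_gt0// powR_gt0.
have ws : w / s <= 1.
  rewrite ler_pdivrMr// mul1r; apply: le_trans s1.
  rewrite /w invf_le1 ?mulr_gt0//; have := pi_ge2 R; lra.
apply: int01_ge_itv.
- apply: continuous_mul; last exact: continuous_qpow.
  exact: (continuous_normp_comp p0 (@continuous_C R)).
- by move=> z _; rewrite mulr_ge0 ?powR_ge0.
- exact: lexx.
- by rewrite divr_ge0 ?ltW.
- exact: ws.
move=> al /andP[al0 alw].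
have y8 : 2 * pi * (s * al) <= 1 / 8.
  have sw : s * al <= w by rewrite mulrC -ler_pdivlMr.
  have pw : pi * w = 1 / 16 by rewrite /w invfM mulrCA divff ?gt_eqF// mulr1 div1r.
  by have := ler_wpM2l (ltW pi0) sw; rewrite pw; lra.
have y0 : 0 <= 2 * pi * (s * al).
  by apply: mulr_ge0; apply: mulr_ge0 => //; exact: ltW.
have /andP[q1 q2] := q_near_0 s1 al0 ltac:(lra).
have q12 : 1 <= q al s <= 2.
  by rewrite q_ge1 /=; move: q2; rewrite expr2; nra.
rewrite ler_pM ?powR_ge0//; last exact: powR_12.
apply: le_powR; [exact: ltW|lra|]; apply: absC_ge.
have w0' : 0 <= 2 * pi * al.
  by apply: mulr_ge0 => //; apply: mulr_ge0 => //; exact: ltW.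
have w1 : 2 * pi * al <= 1 / 8.
  by have E : 2 * pi * (s * al) = s * (2 * pi * al); [ring|rewrite E in y8; nra].
have /andP[? ?] : 2 * pi * al / 2 <= S al <= 2 * pi * al.
  by apply: sin_bounds; apply/andP; split; lra.
by rewrite ger0_norm; lra.
Qed.

(** Between the scales [y <= 1/8] and [1/2 <= y <= 1] the function [1 / q] drops
    by more than 1/25, so it cannot be close to one constant on both: this
    bounds its deviation from [shiftB s] without estimating [shiftB s]. *)
Lemma grad_int_ge p : 0 < p -> exists2 c, 0 < c & forall s, 1 <= s ->
  c * k s `^ (- 1 - p / a) / s <= grad_int p s.
Proof.
move=> p0; have pi0 := pi_gt0 R.
pose w : R := (16 * pi)^-1; have w0 : 0 < w by rewrite invr_gt0 mulr_gt0.
have pw : pi * w = 1 / 16 by rewrite /w invfM mulrCA divff ?gt_eqF// mulr1 div1r.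
pose c1 := (1 / 50) `^ p * Num.min 1 (2 `^ (- a)).
have c10 : 0 < c1 by rewrite mulr_gt0 ?powR_gt0// lt_min ltr01 powR_gt0.
have aa : 0 < (2 * `|a|) `^ p by rewrite powR_gt0// mulr_gt0// normr_gt0.
exists ((2 * `|a|) `^ p * (c1 * w)); first by rewrite !mulr_gt0.
move=> s s1; have s0 : 0 < s by lra.
have k0 := k_gt0 a s.
rewrite grad_intE//.
have cI : continuous (fun al => `|(q al s)^-1 - shiftB s| `^ p * q al s `^ (- a)).
  apply: continuous_mul; last exact: continuous_qpow.
  exact: (continuous_normp_comp p0 (@continuous_qshift s)).
have I0 z : 0 <= `|(q z s)^-1 - shiftB s| `^ p * q z s `^ (- a).
  by rewrite mulr_ge0 ?powR_ge0.
have main : c1 * (w / s) <=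
    int01 (fun al => `|(q al s)^-1 - shiftB s| `^ p * q al s `^ (- a)).
  have sc al j : al <= j * w / s -> 2 * pi * (s * al) <= j / 8.
    move=> h; have sw : s * al <= j * w by rewrite mulrC -ler_pdivlMr.
    have := ler_wpM2l (ltW pi0) sw.
    by rewrite (mulrCA pi j) pw; lra.
  have sc' al j : j * w / s <= al -> j / 8 <= 2 * pi * (s * al).
    move=> h; have sw : j * w <= s * al by rewrite [leRHS]mulrC -ler_pdivrMr.
    have := ler_wpM2l (ltW pi0) sw.
    by rewrite (mulrCA pi j) pw; lra.
  have ws0 : 0 < w / s by rewrite divr_gt0.
  have ws8 : 8 * w / s <= 1.
    rewrite ler_pdivrMr// mul1r; apply: le_trans s1.
    rewrite /w ler_pdivrMr ?mulr_gt0//; have := pi_ge2 R; lra.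
  have lower al : 1 <= q al s <= 2 -> 1 / 50 <= `|(q al s)^-1 - shiftB s| ->
      c1 <= `|(q al s)^-1 - shiftB s| `^ p * q al s `^ (- a).
    move=> q12 h; have m0 : 0 <= Num.min 1 (2 `^ (- a)).
      by rewrite le_min ler01 powR_ge0.
    have h1 := le_powR (ltW p0) (ltac:(lra) : (0 : R) < 1 / 50) h.
    exact: ler_pM (powR_ge0 _ _) m0 h1 (powR_12 _ q12).
  have [B|B] := leP (shiftB s) (963 / 1000).
    have -> : c1 * (w / s) = c1 * (w / s - 0) by rewrite subr0.
    apply: int01_ge_itv => //.
    - exact: ltW.
    - by move: ws8; rewrite -mulrA; lra.
    move=> al /andP[al0 alw].
    have y8 := sc al 1 ltac:(rewrite mul1r; exact: alw).
    have y0 : 0 <= 2 * pi * (s * al).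
      by apply: mulr_ge0; apply: mulr_ge0 => //; exact: ltW.
    have /andP[_ q2] := q_near_0 s1 al0 ltac:(lra).
    have {}q2 : q al s <= 65 / 64 by rewrite expr2 in q2; nra.
    have q1 := q_ge1 al s.
    apply: lower; first by apply/andP; split; lra.
    have qV : 64 / 65 <= (q al s)^-1.
      have q0 := q_gt0 al s.
      by rewrite -(ler_pM2r q0) mulVf ?gt_eqF//; lra.
    by rewrite ger0_norm; lra.
  apply: (@le_trans _ _ (c1 * (8 * w / s - 4 * w / s))).
    by rewrite ler_pM2l// -!mulrA; lra.
  apply: int01_ge_itv => //.
  - by rewrite -mulrA; lra.
  - by rewrite -!mulrA; lra.
  move=> al /andP[al0 alw].
  have y8 := sc al 8 alw; have y4 := sc' al 4 al0.
  have alp : 0 <= al by move: al0; rewrite -mulrA; lra.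
  have /andP[q1 q2] := q_near_0 s1 alp ltac:(lra).
  have {}q1 : 17 / 16 <= q al s by rewrite expr2 in q1; nra.
  have {}q2 : q al s <= 2 by rewrite expr2 in q2; nra.
  apply: lower; first by apply/andP; split; lra.
  have qV : (q al s)^-1 <= 16 / 17.
    have q0 := q_gt0 al s.
    by rewrite -(ler_pM2r q0) mulVf ?gt_eqF//; lra.
  by rewrite ltr0_norm; lra.
have -> : (2 * `|a|) `^ p * (c1 * w) * k s `^ (-1 - p / a) / s =
    ((2 * `|a|) `^ p * k s `^ (- (p / a)) * k s `^ (-1)) * (c1 * (w / s)).
  by rewrite (powR_D _ _ k0); ring.
apply: ler_pM => //.
- by rewrite !mulr_ge0 ?powR_ge0.
- by rewrite mulr_ge0 ?ltW ?divr_gt0.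
- by rewrite ler_pM2r ?powR_gt0//; exact: speed_ge.
Qed.

(** At the critical exponent the integrand [q `^ (- (1 / 2))] behaves like
    [1 / (1 + 2 * pi * s * al)] near 0, whose integral carries a logarithm. *)
Lemma dens_int_ge_log p : 0 < p -> p + a = 1 / 2 -> exists2 c, 0 < c &
  forall s, 1 <= s -> c * k s `^ (- 1 - p / a) / s * ln (1 + s / 2) <= dens_int p s.
Proof.
move=> p0 pa; have pi0 := pi_gt0 R.
pose w : R := (4 * pi)^-1; have w0 : 0 < w by rewrite invr_gt0 mulr_gt0.
have pw : pi * w = 1 / 4 by rewrite /w invfM mulrCA divff ?gt_eqF// mulr1 div1r.
have w1 : w <= 1 by rewrite /w invf_le1 ?mulr_gt0//; have := pi_ge2 R; lra.
pose c1 : R := (1 / 2) `^ p; have c10 : 0 < c1 by exact: powR_gt0.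
have sg : 0 < `|sigma| `^ p by rewrite powR_gt0// normr_gt0.
exists (`|sigma| `^ p * (c1 / (2 * pi))); first by rewrite !mulr_gt0 ?invr_gt0 ?mulr_gt0.
move=> s s1; have s0 : 0 < s by lra.
have k0 := k_gt0 a s.
rewrite dens_intE// (_ : - p - a = - (1 / 2)); last by lra.
pose f al := `|C al| `^ p * q al s `^ (- (1 / 2)).
have cf : continuous f.
  apply: continuous_mul; last exact: continuous_qpow.
  exact: (continuous_normp_comp p0 (@continuous_C R)).
pose g al := c1 / (2 * pi * s) * ln (1 + 2 * pi * s * al).
have ps0 : 0 < 2 * pi * s by rewrite !mulr_gt0.
have arg0 al : 0 <= al -> 0 < 1 + 2 * pi * s * al.
  by move=> al0; rewrite ltr_pwDl// mulr_ge0// ltW.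
have dg al : 0 <= al -> is_derive al 1 g (c1 / (1 + 2 * pi * s * al)).
  move=> al0.
  have dl : is_derive al 1 (fun x => 1 + 2 * pi * s * x) (2 * pi * s).
    apply: (is_derive_eq (is_derive1D (is_derive1_cst 1 al)
      (is_derive1Z (2 * pi * s) (is_derive1_id al)))).
    by rewrite mulr1 add0r.
  apply: (is_derive_eq (is_derive1Z (c1 / (2 * pi * s))
    (is_derive1_chain (f := @ln R)
    (g := fun x => 1 + 2 * pi * s * x) (is_derive1_ln (arg0 al al0)) dl))).
  have fin (P U : R) : 0 < P -> 0 < U -> c1 / P * (U^-1 * P) = c1 / U.
    by move=> P0 U0; field; rewrite !gt_eqF.
  exact: fin ps0 (arg0 al al0).
have I1 : g w - g 0 <= prim f w - prim f 0.
  have dpg al : 0 <= al -> is_derive al 1 (fun x => prim f x - g x)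
      (f al - c1 / (1 + 2 * pi * s * al)).
    by move=> al0; exact: is_derive1B (is_derive_prim al cf) (dg al al0).
  have := @derive_ge0_le _ (fun x => prim f x - g x)
    (fun al => f al - c1 / (1 + 2 * pi * s * al)) 0 w (ltW w0).
  have H1 x : x \in `]0, w[ -> is_derive x 1 (fun x => prim f x - g x)
      (f x - c1 / (1 + 2 * pi * s * x)).
    by rewrite in_itv /= => /andP[/ltW x0 _]; exact: dpg.
  have H2 : {within `[0, w], continuous (fun x => prim f x - g x)}.
    apply: derivable_within_continuous => x; rewrite in_itv /= => /andP[x0 _].
    by have [] := dpg x x0.
  move=> /(_ H1 H2); have [|H3] := pselect (forall x, x \in `]0, w[ ->
      0 <= f x - c1 / (1 + 2 * pi * s * x)); first by move=> H /(_ H); lra.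
  exfalso; apply: H3 => x; rewrite in_itv /= => /andP[x0 xw].
  have q0 := q_gt0 x s.
  have W1 : 2 * pi * x <= 1 / 2.
    by have := ler_wpM2l (ltW pi0) (ltW xw); rewrite pw; lra.
  have W0 : 0 <= 2 * pi * x by apply: mulr_ge0 (ltW x0); rewrite mulr_ge0// ltW.
  have /andP[S0 S1] : 2 * pi * x / 2 <= S x <= 2 * pi * x.
    by apply: sin_bounds; apply/andP; split; lra.
  rewrite subr_ge0 /f; apply: ler_pM => //.
  - exact: ltW.
  - by rewrite invr_ge0 ltW// arg0 ?ltW.
  - apply: le_powR; [exact: ltW|lra|]; apply: absC_ge.
    by rewrite ger0_norm; lra.
  have u0 := arg0 x (ltW x0).
  have qu : q x s <= (1 + 2 * pi * s * x) ^+ 2.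
    have -> : 2 * pi * s * x = s * (2 * pi * x) by ring.
    have h : s * S x <= s * (2 * pi * x) by rewrite ler_pM2l.
    have h0 : 0 <= s * S x by apply: mulr_ge0; lra.
    have -> : q x s = 1 + (s * S x) * (s * S x) by rewrite /q; ring.
    by rewrite expr2; nra.
  have -> : (1 + 2 * pi * s * x)^-1 = ((1 + 2 * pi * s * x) ^+ 2) `^ (- (1 / 2)).
    rewrite -powR_mulrn ?ltW// -powRrM (_ : 2%:R * - (1 / 2) = - 1) ?powRN1//.
    by field.
  by apply: le_powRN => //; lra.
have I2 := int01_ge_prim cf (fun z _ => mulr_ge0 (powR_ge0 _ _) (powR_ge0 _ _))
  (lexx 0) (ltW w0) w1.
have gw : g w - g 0 = c1 / (2 * pi) / s * ln (1 + s / 2).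
  rewrite /g mulr0 addr0 ln1 mulr0 subr0.
  have -> : 2 * pi * s * w = s / 2 by rewrite mulrAC -[2 * pi * w]mulrA pw; lra.
  by rewrite invfM !mulrA.
have -> : `|sigma| `^ p * (c1 / (2 * pi)) * k s `^ (-1 - p / a) / s * ln (1 + s / 2) =
  `|sigma| `^ p * k s `^ (-1 - p / a) * (c1 / (2 * pi) / s * ln (1 + s / 2)) by ring.
rewrite ler_pM2l -?gw; last by rewrite mulr_gt0// powR_gt0.
exact: le_trans I1 I2.
Qed.

End Sigma.
End Norms.

(** * Limits of the norms in the bounded range *)

Section Limits.
Context {R : realType}.
Implicit Types (x y s t al e p M : R).
Local Notation mu := (@lebesgue_measure R).

Local Notation S al := (sin (2 * pi * al)).
Local Notation C al := (cos (2 * pi * al)).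

(** Contrary to [q], it has a limit as [s] grows: the squared sine. *)
Definition Q al s := q al s / r2 s.

Lemma Q_gt0 al s : 0 < Q al s.
Proof. by rewrite divr_gt0 ?q_gt0 ?r2_gt0. Qed.

Lemma Q_le1 al s : Q al s <= 1.
Proof. by rewrite ler_pdivrMr ?r2_gt0// mul1r q_le_r2. Qed.

Lemma QE al s : Q al s = S al * S al + C al * C al / r2 s.
Proof.
have r0 := r2_gt0 s; rewrite /Q -[X in _ = X](mulfK (lt0r_neq0 r0)); congr (_ / _).
rewrite mulrDl divfK ?gt_eqF// /q /r2 -(addrK (S al * S al) (C al * C al)).
have -> : C al * C al + S al * S al = 1 :> R by rewrite -!expr2 cos2Dsin2.
by ring.
Qed.

Lemma continuous_Q s : continuous (fun al => Q al s).
Proof. exact: continuous_mul (@continuous_q R s) (@continuous_cst _ _ _). Qed.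

Lemma continuous_Qpow e s : continuous (fun al => Q al s `^ e).
Proof.
move=> al; apply: (@continuous_comp _ _ _ (fun al => Q al s) (@powR R ^~ e)).
  exact: continuous_Q.
exact: is_derive_continuous (is_derive1_powR e (Q_gt0 _ _)).
Qed.

Lemma Qpow e al s : Q al s `^ e = q al s `^ e * r2 s `^ (- e).
Proof.
have r0 := r2_gt0 s; have q0 := q_gt0 al s.
by rewrite /Q powRM ?invr_ge0 ?ltW// -(powRN1 r0) -powRrM mulN1r.
Qed.

Lemma qpow_Q e al s : q al s `^ e = Q al s `^ e * r2 s `^ e.
Proof.
have r0 := r2_gt0 s.
by rewrite Qpow -mulrA -powR_D// addNr powRr0 mulr1.
Qed.

Lemma Q_anti al s t : 0 <= s -> s <= t -> Q al t <= Q al s.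
Proof.
move=> s0 st; rewrite !QE lerD2l ler_wpM2l//; first by rewrite -expr2 sqr_ge0.
by rewrite lef_pV2 ?posrE ?r2_gt0// /r2; nra.
Qed.

Lemma Q_cvg al : Q al s @[s --> +oo] --> S al * S al.
Proof.
apply/cvgrPdist_le => e e0; near=> s; rewrite QE opprD addNKr normrN.
have s1 : 1 <= s by near: s; apply: nbhs_pinfty_ge; rewrite num_real.
have se : e^-1 <= s by near: s; apply: nbhs_pinfty_ge; rewrite num_real.
have r0 := r2_gt0 s.
rewrite ger0_norm; last by rewrite divr_ge0 ?(ltW r0)// -expr2 sqr_ge0.
rewrite ler_pdivrMr//; apply: (@le_trans _ _ 1).
  by have := cos2Dsin2 (2 * pi * al); rewrite !expr2; have := sqr_ge0 (S al); rewrite expr2; lra.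
have : 1 <= e * s by rewrite -ler_pdivrMl// mulr1.
by rewrite /r2; nra.
Unshelve. all: by end_near. Qed.

Lemma Qpow_cvg e al : S al != 0 ->
  Q al s `^ e @[s --> +oo] --> (S al * S al) `^ e.
Proof.
move=> S0; have S2 : 0 < S al * S al by rewrite -expr2 exprn_even_gt0.
exact: (cvg_comp _ _ (@Q_cvg al)
  (is_derive_continuous (is_derive1_powR e S2))).
Qed.

Lemma int_Qpow_le e s : 0 <= e -> e < 1 / 2 -> 1 <= s ->
  int01 (fun al => Q al s `^ (- e)) <= (4 - 4 * e) / (1 - 2 * e).
Proof.
move=> e0 e2 s1; have r0 := r2_gt0 s.
rewrite (@eq_int01 _ _ (fun al => r2 s `^ e * q al s `^ (- e))); last first.
  by move=> al _; rewrite Qpow opprK mulrC.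
rewrite int01Z; last exact: continuous_qpow.
apply: le_trans (ler_wpM2l (powR_ge0 _ _) (int_qpow_le e0 e2 s1)) _.
by rewrite mulrCA -powR_D// subrr powRr0 mulr1.
Qed.

Lemma measurable_continuous (f : R -> R) : continuous f -> measurable_fun setT f.
Proof. exact: continuous_measurable_fun. Qed.

Lemma sin2pi_ae : {ae mu, forall x, x \in `[0, 1] -> S x != 0}.
Proof.
have n1 (c : R) : mu.-negligible [set c].
  by apply/negligibleP => //; exact: lebesgue_measure_set1.
have N := negligibleU (negligibleU (n1 0) (n1 (1 / 2))) (n1 1).
apply: negligibleS N => x /=.
move=> /not_implyP[]; rewrite in_itv /= => /andP[x0 x1] /negP.
rewrite negbK => /eqP Sx; have pi0 := pi_gt0 R.
have [->|nx0] := eqVneq x 0; first by left; left.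
have [->|nx1] := eqVneq x 1; first by right.
have [->|nx2] := eqVneq x (1 / 2); first by left; right.
exfalso; have [x2|x2] := ltP x (1 / 2).
  have : 0 < S x.
    apply: sin_gt0_pi; have xx : 0 < x by rewrite lt_neqAle eq_sym nx0.
    by apply/andP; split; [rewrite !mulr_gt0|have := ltr_pM2l pi0; move=> H;
      rewrite mulrAC -[ltRHS]mul1r ltr_pM2r//; lra].
  by rewrite Sx ltxx.
have : 0 < sin (2 * pi * x - pi).
  have x2' : 1 / 2 < x by rewrite lt_neqAle eq_sym nx2.
  have x1' : x < 1 by rewrite lt_neqAle nx1.
  have -> : 2 * pi * x - pi = (2 * x - 1) * pi by ring.
  apply: sin_gt0_pi; apply/andP; split; first by rewrite mulr_gt0//; lra.
  by rewrite -[ltRHS]mul1r ltr_pM2r//; lra.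
have := sinDpi (2 * pi * x - pi); rewrite subrK Sx => /eqP.
by rewrite eq_sym oppr_eq0 => /eqP ->; rewrite ltxx.
Qed.

Lemma EFin_int01 (f : R -> R) : mu.-integrable `[0, 1] (EFin \o f) ->
  (\int[mu]_(x in `[0%R, 1%R]) (f x)%:E = (int01 f)%:E)%E.
Proof. by move=> If; rewrite /int01 /Rintegral fineK//; exact: integrable_fin_num. Qed.

(** The majorants [Q `^ (- e)] increase with [s], so their supremum is integrable
    by monotone convergence and the bound [int_Qpow_le], which is uniform in
    [s].  Dominated convergence then applies. *)
Lemma cvg_int01_dominated (G : R -> R -> R) (g : R -> R) e M :
  0 <= e -> e < 1 / 2 -> 0 <= M ->
  (forall s, 1 <= s -> continuous (G s)) -> measurable_fun setT g ->
  (forall s x, 1 <= s -> `|G s x| <= M * Q x s `^ (- e)) ->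
  (forall x, S x != 0 -> G s x @[s --> +oo] --> g x) ->
  int01 (G s) @[s --> +oo] --> int01 g.
Proof.
move=> e0 e2 M0 cG mg bG Gg.
have mD : measurable (`[0, 1]%classic : set R) by [].
pose h (n : nat) (x : R) : \bar R := (M * Q x n.+1%:R `^ (- e))%:E.
have ch n : continuous (fun x => M * Q x n.+1%:R `^ (- e)).
  exact: continuous_mul (@continuous_cst _ _ _) (@continuous_Qpow _ _).
have mh n : measurable_fun (`[0%R, 1%R]%classic : set R) (h n).
  apply/measurable_EFinP; apply: measurable_funTS.
  exact: measurable_continuous (ch n).
have h0 n x : `[0, 1]%classic x -> (0 <= h n x)%E.
  by move=> _; rewrite lee_fin mulr_ge0// powR_ge0.
have ndh x : `[0, 1]%classic x -> {homo h ^~ x : n n' / (n <= n')%N >-> (n <= n')%E}.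
  move=> _ n n' nn'; rewrite lee_fin ler_wpM2l//.
  apply: le_powRN; [lra|exact: Q_gt0|apply: Q_anti => //].
  by rewrite ler_nat.
have cvh x : `[0, 1]%classic x -> h n x @[n --> \oo] --> limn (h ^~ x).
  by move=> x01; apply: ereal_nondecreasing_is_cvgn; exact: ndh.
pose dom x := limn (h ^~ x).
have hdom n x : `[0, 1]%classic x -> (h n x <= dom x)%E.
  move=> x01; apply: lime_ge; first exact: cvh.
  by near=> n'; apply: ndh => //; near: n'; exact: nbhs_infty_ge.
have mdom : measurable_fun (`[0%R, 1%R]%classic : set R) dom.
  exact: (emeasurable_fun_cvg _ _ mh cvh).
have dom0 x : `[0, 1]%classic x -> (0 <= dom x)%E.
  by move=> x01; apply: le_trans (h0 0%N x x01) (hdom 0%N x x01).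
have Idom : mu.-integrable `[0, 1] dom.
  apply/integrableP; split => //.
  have -> : (\int[mu]_(x in `[0%R, 1%R]) `|dom x| =
      \int[mu]_(x in `[0%R, 1%R]) dom x)%E.
    by apply: eq_integral => x; rewrite inE => x01; rewrite gee0_abs// dom0.
  have cI : (\int[mu]_(x in `[0%R, 1%R]) h n x)%E @[n --> \oo] -->
      (\int[mu]_(x in `[0%R, 1%R]) dom x)%E.
    exact: (@cvg_monotone_convergence _ _ R mu _ mD h mh h0 ndh).
  apply: (@le_lt_trans _ _ (M * ((4 - 4 * e) / (1 - 2 * e)))%:E); last exact: ltry.
  apply: (cvge_to_le cI); near=> n.
  rewrite EFin_int01; last exact: integrable_continuous.
  rewrite lee_fin int01Z; last exact: continuous_Qpow.
  by rewrite ler_wpM2l// int_Qpow_le// ler1n.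
apply/cvg_pinftyP => u uoo.
pose v n := Num.max 1 (u n).
have vu : \forall n \near \oo, v n = u n.
  have N : \forall x \near +oo%R, (1 : R) <= x.
    by apply: nbhs_pinfty_ge; rewrite num_real.
  have N' : \forall n \near \oo, 1 <= u n := uoo _ N.
  by apply: filterS N' => n un; rewrite /v (max_idPr un).
have v1 n : 1 <= v n by rewrite le_max lexx.
have voo : v n @[n --> \oo] --> +oo.
  by apply: cvg_trans uoo; apply: near_eq_cvg; apply: filterS vu => n ->.
pose f (n : nat) (x : R) : \bar R := (G (v n) x)%:E.
have mf n : measurable_fun (`[0%R, 1%R]%classic : set R) (f n).
  apply/measurable_EFinP; apply: measurable_funTS.
  by apply: measurable_continuous; exact: cG.
have mg' : measurable_fun (`[0%R, 1%R]%classic : set R) (EFin \o g).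
  by apply/measurable_EFinP; exact: measurable_funTS.
have fg : {ae mu, forall x, `[0, 1]%classic x -> f n x @[n --> \oo] --> (g x)%:E}.
  apply: negligibleS sin2pi_ae => x /= H1 Sx; apply: H1 => x01.
  apply: cvg_EFin; first by near=> n.
  exact: (@cvg_comp _ _ _ v (fun s => G s x) _ _ _ voo (Gg x (Sx x01))).
have fdom : {ae mu, forall x n, `[0, 1]%classic x -> (`|f n x| <= dom x)%E}.
  apply: aeW => x n x01; have [N vN] : exists N : nat, v n <= N.+1%:R.
    exists (Num.bound (v n)); apply: ltW; apply: lt_le_trans (archi_boundP _) _.
      by apply: le_trans (v1 n).
    by rewrite ler_nat.
  apply: le_trans (hdom N x x01); rewrite /f abse_EFin lee_fin.
  apply: le_trans (bG _ _ (v1 n)) _; rewrite ler_wpM2l//.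
  apply: le_powRN; [lra|exact: Q_gt0|apply: Q_anti => //].
  by apply: le_trans (v1 n).
have [Ig _ cI] := @dominated_convergence _ _ R mu _ mD f (EFin \o g) dom
  mf mg' fg Idom fdom.
have cI' : (int01 (G (v n)))%:E @[n --> \oo] --> (int01 g)%:E.
  rewrite -EFin_int01//; apply: cvg_trans cI; apply: near_eq_cvg; near=> n.
  rewrite /= /f EFin_int01//; apply: integrable_continuous; exact: cG.
have cI2 : int01 (G (v n)) @[n --> \oo] --> int01 g by exact: fine_cvg cI'.
apply/cvgrPdist_lt => eps eps0; have /cvgrPdist_lt H' := cI2.
by apply: filterS2 vu (H' eps eps0) => n ->.
Unshelve. all: by end_near. Qed.

End Limits.

Section Bounded.
Context {R : realType}.
Implicit Types (x y s t al e p M : R).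

Local Notation S al := (sin (2 * pi * al)).
Local Notation C al := (cos (2 * pi * al)).

Lemma Qpow_le e x s : Q x s `^ (- e) <= Q x s `^ (- Num.max 0 e).
Proof.
have Q0 := Q_gt0 x s; have Q1 := Q_le1 x s.
have h : 0 <= Num.max 0 e - e by rewrite subr_ge0 le_max lexx orbT.
have -> : - e = - Num.max 0 e + (Num.max 0 e - e) by lra.
rewrite powR_D// ler_piMr ?powR_ge0//.
have : Q x s `^ (Num.max 0 e - e) <= 1 `^ (Num.max 0 e - e) by exact: le_powR.
by rewrite powR1.
Qed.

Lemma max0_lt e : e < 1 / 2 -> Num.max 0 e < 1 / 2.
Proof. by move=> e2; rewrite gt_max e2 andbT; lra. Qed.

Lemma cvg_int01_Qpow (w : R -> R -> R) (w' : R -> R) e M : e < 1 / 2 ->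
  (forall s, 1 <= s -> continuous (w s)) -> measurable_fun setT w' ->
  (forall s x, 1 <= s -> `|w s x| <= M) ->
  (forall x, S x != 0 -> w s x @[s --> +oo] --> w' x) ->
  int01 (fun x => w s x * Q x s `^ (- e)) @[s --> +oo] -->
    int01 (fun x => w' x * (S x * S x) `^ (- e)).
Proof.
move=> e2 cw mw bw ww.
have M0 : 0 <= M by apply: le_trans (bw 1 0 (lexx _)).
have m0 : 0 <= Num.max 0 e by rewrite le_max lexx.
apply: (@cvg_int01_dominated _ (fun s x => w s x * Q x s `^ (- e)) _ _ _ m0
  (max0_lt e2) M0).
- by move=> s s1; exact: continuous_mul (cw s s1) (@continuous_Qpow _ _ s).
- apply: measurable_funM => //.
  apply: (measurableT_comp (measurable_powR _)).
  exact: measurable_continuous (continuous_mul (@continuous_S R) (@continuous_S R)).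
- move=> s x s1; rewrite normrM (ger0_norm (powR_ge0 _ _)).
  by apply: ler_pM => //; [exact: powR_ge0|exact: bw|exact: Qpow_le].
- by move=> x Sx; apply: cvgM; [exact: ww|exact: Qpow_cvg].
Qed.

Lemma cvg_int01_Qpow1 e : e < 1 / 2 ->
  int01 (fun x => Q x s `^ (- e)) @[s --> +oo] -->
    int01 (fun x : R => (S x * S x) `^ (- e)).
Proof.
move=> e2; have := @cvg_int01_Qpow (fun _ _ => 1) (fun _ => 1) e 1 e2.
have -> : (fun s => int01 (fun x => 1 * Q x s `^ (- e))) =
    (fun s => int01 (fun x => Q x s `^ (- e))).
  by apply/funext => s; apply: eq_int01 => x _; rewrite mul1r.
rewrite (@eq_int01 _ (fun x => 1 * _) (fun x => (S x * S x) `^ (- e))); last first.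
  by move=> x _; rewrite mul1r.
apply => //.
- by move=> s _; exact: continuous_cst.
- by move=> s x _; rewrite normr1.
- by move=> x _; exact: cvg_cst.
Qed.

Lemma int01_Qpow_bound e : e < 1 / 2 -> exists2 M, 0 <= M &
  forall s, 1 <= s -> 0 <= int01 (fun x => Q x s `^ (- e)) <= M.
Proof.
move=> e2; have m0 : 0 <= Num.max 0 e by rewrite le_max lexx.
have m2 := max0_lt e2.
exists ((4 - 4 * Num.max 0 e) / (1 - 2 * Num.max 0 e)).
  by rewrite divr_ge0//; lra.
move=> s s1; apply/andP; split.
  by apply: int01_ge0 => x _; exact: powR_ge0.
apply: le_trans (int_Qpow_le m0 m2 s1).
by apply: ler_int01; [exact: continuous_Qpow|exact: continuous_Qpow|
  move=> x _; exact: Qpow_le].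
Qed.

Lemma r2_sqrt_cvg (c : R) : 0 <= c -> (r2 s `^ 2^-1 * (c / s)) @[s --> +oo] --> c.
Proof.
move=> c0.
have h : (1 + (s * s)^-1) @[s --> +oo] --> (1 : R).
  apply/cvgrPdist_le => e e0; near=> s.
  have s1 : 1 <= s by near: s; apply: nbhs_pinfty_ge; rewrite num_real.
  have se : e^-1 <= s by near: s; apply: nbhs_pinfty_ge; rewrite num_real.
  have s2 : 0 < s * s by nra.
  rewrite opprD addNKr normrN ger0_norm ?invr_ge0 ?(ltW s2)//.
  rewrite -[(s * s)^-1]div1r ler_pdivrMr//.
  have : 1 <= e * s by rewrite -ler_pdivrMl// mulr1.
  by nra.
have h2 : ((1 + (s * s)^-1) `^ 2^-1 * c) @[s --> +oo] --> 1 `^ 2^-1 * c.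
  have h3 := cvg_comp _ _ h (is_derive_continuous (is_derive1_powR 2^-1 ltr01)).
  exact: cvgM h3 (cvg_cst c).
rewrite powR1 mul1r in h2.
apply: cvg_trans h2; apply: near_eq_cvg; near=> s.
have s0 : 0 < s by near: s; apply: nbhs_pinfty_gt; rewrite num_real.
have -> : r2 s = (1 + (s * s)^-1) * (s * s).
  by rewrite /r2 mulrDl mul1r mulVf 1?addrC// gt_eqF// mulr_gt0.
rewrite powRM ?addr_ge0 ?invr_ge0 ?mulr_ge0 ?(ltW s0)//.
rewrite (_ : (s * s) `^ 2^-1 = s); last first.
  rewrite -expr2 -powR_mulrn ?(ltW s0)// -powRrM (_ : 2%:R * 2^-1 = 1) ?powRr1 ?ltW//.
  by field.
by rewrite -mulrA; congr (_ * _); field; rewrite gt_eqF.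
Unshelve. all: by end_near. Qed.

Section Sigma.
Variables (a sigma p : R).
Hypothesis a_lt0 : a < 0.
Hypothesis p1 : 1 <= p.
Hypothesis pa : p + a < 1 / 2.
Local Notation k := (k a).

Let a_neq0 : a != 0. Proof. by rewrite lt_eqF. Qed.

Let K0 s := int01 (fun x => Q x s `^ (- a)).
Let B1 s := int01 (fun x => Q x s `^ (- (1 + a))).

Let int_qpow_Q (w : R -> R) e s : continuous w ->
  int01 (fun x => w x * q x s `^ e) = r2 s `^ e * int01 (fun x => w x * Q x s `^ e).
Proof.
move=> cw; rewrite -int01Z; last exact: continuous_mul cw (@continuous_Qpow _ _ s).
by apply: eq_int01 => x _; rewrite qpow_Q; ring.
Qed.

Let int_qpow_Q1 e s :
  int01 (fun x => q x s `^ e) = r2 s `^ e * int01 (fun x => Q x s `^ e).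
Proof.
rewrite -int01Z; last exact: continuous_Qpow.
by apply: eq_int01 => x _; rewrite qpow_Q; ring.
Qed.

Let kE s : k s = r2 s `^ (- a) * K0 s. Proof. exact: int_qpow_Q1. Qed.

Let K0_ge : exists2 c : R, 0 < c & forall s, 1 <= s -> c <= K0 s.
Proof.
have b0 : 0 < - a by rewrite oppr_gt0.
have [c c0 H] := int_qpow_ge b0.
exists c => // s s1; have := H s s1; rewrite int_qpow_Q1 mulrC ler_pM2l//.
by rewrite powR_gt0// r2_gt0.
Qed.

Let K0_gt0 s : 0 < K0 s.
Proof.
by have := k_gt0 a s; rewrite kE pmulr_rgt0// powR_gt0// r2_gt0.
Qed.

Let K0_cvg : exists2 l : R, 0 < l & K0 s @[s --> +oo] --> l.
Proof.
have a2 : a < 1 / 2 by move: a_lt0; lra.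
have h := cvg_int01_Qpow1 a2.
exists (int01 (fun x : R => (S x * S x) `^ (- a))) => //.
have [c c0 H] := K0_ge; apply: lt_le_trans c0 _.
apply: (cvgr_to_ge h); near=> s; apply: H.
by near: s; apply: nbhs_pinfty_ge; rewrite num_real.
Unshelve. all: by end_near. Qed.

Let kpow s : k s `^ (- 1 - p / a) = r2 s `^ (a + p) * K0 s `^ (- 1 - p / a).
Proof.
rewrite kE powRM ?powR_ge0 ?(ltW (K0_gt0 s))// -powRrM.
by congr (_ `^ _ * _); field.
Qed.

Let K0pow_cvg : exists l : R, K0 s `^ (- 1 - p / a) @[s --> +oo] --> l.
Proof.
have [l l0 h] := K0_cvg; exists (l `^ (- 1 - p / a)).
exact: (cvg_comp _ _ h (is_derive_continuous (is_derive1_powR _ l0))).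
Qed.

(** All powers of [r2] cancel when [q] is expressed by [Q]; what remains converges
    by domination because [p + a < 1 / 2]. *)
Lemma dens_int_cvg : exists l : R, dens_int a sigma p s @[s --> +oo] --> l.
Proof.
have p0 : 0 < p by apply: lt_le_trans p1.
have [l lK] := K0pow_cvg.
have cC := continuous_normp_comp p0 (@continuous_C R).
have := @cvg_int01_Qpow (fun _ x => `|C x| `^ p) (fun x => `|C x| `^ p)
  (p + a) 1 pa (fun _ _ => cC) (measurable_continuous cC).
move=> H; have {}H := H _ (fun x _ => @cvg_cst _ _ _ _ _).
have [l' lD] : exists l' : R, int01 (fun x => `|C x| `^ p * Q x s `^ (- (p + a)))
    @[s --> +oo] --> l'.
  eexists; apply: H => s x _; rewrite ger0_norm ?powR_ge0//.
  have : `|C x| `^ p <= 1 `^ p.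
    apply: (ge0_ler_powR (ltW p0)); rewrite ?nnegrE// ler_norml cos_geN1 ?cos_le1//.
  by rewrite powR1.
exists (`|sigma| `^ p * l * l').
apply: cvg_trans (cvgM (cvgM (cvg_cst _) lK) lD); apply: near_eq_cvg; near=> s.
rewrite (dens_intE _ a_neq0 _ p0) kpow (int_qpow_Q _ _ cC).
have -> : r2 s `^ (a + p) = (r2 s `^ (- p - a))^-1.
  by rewrite -powRN; congr (_ `^ _); lra.
rewrite [- (p + a)]opprD /=; field.
by rewrite gt_eqF// powR_gt0// r2_gt0.
Unshelve. all: by end_near. Qed.

Let B0 s := B1 s / K0 s.

Let shiftB_Q s : 0 < s -> shiftB a s = B0 s / r2 s.
Proof.
move=> s0; have r0 := r2_gt0 s; have K00 := K0_gt0 s; have k0 := k_gt0 a s.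
have cA := @continuous_qpow R (- a) s.
have cB := @continuous_qpow R (- a - 1) s.
have ks : k_s a s = - (2 * a / s) * (k s - int01 (fun x => q x s `^ (- a - 1))).
  rewrite -(int01B cA cB) -int01Z; last exact: continuous_sub cA cB.
  apply: eq_int01 => x _; have q0 := q_gt0 x s.
  have -> : q_s x s = 2 / s * (q x s - 1).
    by rewrite /q_s /q; field; rewrite gt_eqF.
  have -> : q x s `^ (- a) = q x s `^ (- a - 1) * q x s.
    by rewrite -{3}(powRr1 (ltW q0)) -powR_D// subrK.
  by ring.
have E : int01 (fun x => q x s `^ (- a - 1)) = k s * B0 s / r2 s.
  rewrite int_qpow_Q1 kE /B0 /B1 (_ : - a - 1 = - (1 + a)); last by lra.
  rewrite (_ : r2 s `^ (- (1 + a)) = r2 s `^ (- a) / r2 s).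
    by field; rewrite !gt_eqF.
  by rewrite -(powRN1 r0) -powR_D//; congr (_ `^ _); lra.
rewrite /shiftB /m ks E powRN1//.
by field; rewrite a_neq0 !gt_eqF.
Qed.

Let grad_int_Q s : 0 < s -> grad_int a p s =
  (r2 s `^ 2^-1 * (2 * `|a| / s)) `^ p * K0 s `^ (- 1 - p / a) *
    int01 (fun x => `|1 - B0 s * Q x s| `^ p * Q x s `^ (- (p + a))).
Proof.
move=> s0; have p0 : 0 < p by apply: lt_le_trans p1.
have r0 := r2_gt0 s; have k0 := k_gt0 a s.
have cw : continuous (fun x => `|1 - B0 s * Q x s| `^ p).
  apply: (continuous_normp_comp p0); apply: continuous_sub; first exact: continuous_cst.
  exact: continuous_mul (@continuous_cst _ _ _) (@continuous_Q _ s).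
rewrite (grad_intE a_neq0 p0 s0).
have -> : int01 (fun x => `|(q x s)^-1 - shiftB a s| `^ p * q x s `^ (- a)) =
    int01 (fun x => r2 s `^ (- (p + a)) *
      (`|1 - B0 s * Q x s| `^ p * Q x s `^ (- (p + a)))).
  apply: eq_int01 => x _; have q0 := q_gt0 x s; rewrite (shiftB_Q s0).
  have -> : (q x s)^-1 - B0 s / r2 s = (1 - B0 s * Q x s) * (q x s)^-1.
    by rewrite /Q; field; rewrite !gt_eqF.
  rewrite normrM powRM// normfV (gtr0_norm q0) -(powRN1 q0) -powRrM mulN1r.
  rewrite -mulrA -(powR_D _ _ q0) qpow_Q -[- p - a]opprD; ring.
rewrite int01Z; last exact: continuous_mul cw (@continuous_Qpow _ _ s).
have fin (A B D Z J : R) : A * B * D = Z -> A * B * (D * J) = Z * J.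
  by move=> <-; rewrite mulrA.
apply: fin.
have -> : speed a s * (2 * `|a| / s) =
    (r2 s `^ 2^-1 * (2 * `|a| / s)) * k s `^ (- a^-1).
  by rewrite /speed -/(r2 s); ring.
have x0 : 0 <= r2 s `^ 2^-1 * (2 * `|a| / s).
  by apply: mulr_ge0; [exact: powR_ge0|rewrite divr_ge0// ltW].
rewrite (powRM _ x0 (powR_ge0 _ _)) -powRrM.
move: (_ `^ p) => X; rewrite -[X * _ * _]mulrA -(powR_D _ _ k0) -mulrA.
have -> : - a^-1 * p + - 1 = - 1 - p / a by field.
rewrite kpow.
have E : r2 s `^ (a + p) * r2 s `^ (- (p + a)) = 1.
  by rewrite -powR_D// (addrC p) subrr powRr0.
by move: (K0 s `^ _) => Y; rewrite mulrAC E mul1r.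
Qed.

(** The weight [B0] tends to a constant, as [1 + a <= p + a < 1 / 2]. *)
Lemma grad_int_cvg : exists l : R, grad_int a p s @[s --> +oo] --> l.
Proof.
have p0 : 0 < p by apply: lt_le_trans p1.
have [l lK] := K0pow_cvg.
have [K K_gt0 hK] := K0_cvg.
have a2 : 1 + a < 1 / 2 by move: p1 pa; lra.
have hB := cvg_int01_Qpow1 a2.
have [M M0 HM] := int01_Qpow_bound a2.
have [c c0 Hc] := K0_ge.
pose b := int01 (fun x : R => (S x * S x) `^ (- (1 + a))) / K.
have hB0 : B0 s @[s --> +oo] --> b.
  by apply: cvgM hB _; apply: cvgV => //; rewrite gt_eqF.
have B0b s : 1 <= s -> 0 <= B0 s <= M / c.
  move=> s1; have /andP[B10 B1M] := HM s s1; have K00 := K0_gt0 s.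
  apply/andP; split; first by rewrite divr_ge0// ltW.
  by apply: ler_pM => //; rewrite ?invr_ge0 ?(ltW K00)// lef_pV2 ?posrE ?Hc.
have cw s : continuous (fun x => `|1 - B0 s * Q x s| `^ p).
  apply: (continuous_normp_comp p0); apply: continuous_sub; first exact: continuous_cst.
  exact: continuous_mul (@continuous_cst _ _ _) (@continuous_Q _ s).
have cw' : continuous (fun x : R => `|1 - b * (S x * S x)| `^ p).
  apply: (continuous_normp_comp p0); apply: continuous_sub; first exact: continuous_cst.
  apply: continuous_mul; first exact: continuous_cst.
  exact: (continuous_mul (@continuous_S R) (@continuous_S R)).
have bw s x : 1 <= s -> `|(`|1 - B0 s * Q x s| `^ p)| <= (1 + M / c) `^ p.
  move=> s1; have /andP[B00 B0M] := B0b s s1.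
  rewrite ger0_norm ?powR_ge0//; apply: (ge0_ler_powR (ltW p0)); rewrite ?nnegrE//.
    by rewrite addr_ge0// divr_ge0// ltW.
  apply: le_trans (ler_normB _ _) _; rewrite normr1 lerD2l normrM.
  have Q0 := Q_gt0 x s; rewrite (ger0_norm B00) (gtr0_norm Q0).
  by have := Q_le1 x s; nra.
have ww x : S x != 0 -> `|1 - B0 s * Q x s| `^ p @[s --> +oo] -->
    `|1 - b * (S x * S x)| `^ p.
  move=> _.
  have h : (1 - B0 s * Q x s) @[s --> +oo] --> 1 - b * (S x * S x).
    by apply: cvgB; [exact: cvg_cst|apply: cvgM => //; exact: Q_cvg].
  apply: (@cvg_comp _ _ _ (fun s => 1 - B0 s * Q x s) (fun y => `|y| `^ p) _ _ _ h).
  exact: continuous_normp.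
have lN := @cvg_int01_Qpow (fun s x => `|1 - B0 s * Q x s| `^ p) _ (p + a) _ pa
  (fun s _ => cw s) (measurable_continuous cw') bw ww.
have c2 := @r2_sqrt_cvg (2 * `|a|) ltac:(rewrite mulr_ge0//).
have aa : 0 < 2 * `|a| by rewrite mulr_gt0// normr_gt0.
have c2p := cvg_comp _ _ c2 (is_derive_continuous (is_derive1_powR p aa)).
eexists; apply: cvg_trans (cvgM (cvgM c2p lK) lN); apply: near_eq_cvg; near=> s.
have s0 : 0 < s by near: s; apply: nbhs_pinfty_gt; rewrite num_real.
by rewrite (grad_int_Q s0).
Unshelve. all: by end_near. Qed.

End Sigma.
End Bounded.

(** * Divergence of the norms *)

Section Divergence.
Context {R : realType}.
Implicit Types (x y s t al e p M : R).
Variables (a sigma p : R).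
Hypothesis a_neq0 : a != 0.
Hypothesis sigma_neq0 : sigma != 0.
Hypothesis p_gt0 : 0 < p.
Hypothesis ap : 0 < a + p.

Lemma ge_k_cvgy (f : R -> R) (c : R) : 1 < 2 * rate a * (a + p) -> 0 < c ->
  (forall s, 1 <= s -> c * k a s `^ (- 1 - p / a) / s <= f s) ->
  f s @[s --> +oo] --> +oo.
Proof.
move=> h c0 H; have [c' c'0 Hk] := k_growth a_neq0 ap.
pose d := 2 * rate a * (a + p) - 1; have d0 : 0 < d by rewrite /d subr_gt0.
apply/cvgryPge => A; near=> s.
have s1 : 1 <= s by near: s; apply: nbhs_pinfty_ge; rewrite num_real.
have s0 : 0 < s by lra.
have sA : (Num.max 1 A / (c * c')) `^ d^-1 <= s.
  by near: s; apply: nbhs_pinfty_ge; rewrite num_real.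
apply: le_trans (H s s1).
have cc : 0 < c * c' by rewrite mulr_gt0.
have m0 : 0 < Num.max 1 A by rewrite lt_max ltr01.
apply: (@le_trans _ _ (c * c' * s `^ d)).
  apply: (@le_trans _ _ (Num.max 1 A)); first by rewrite le_max lexx orbT.
  have y0 : 0 <= Num.max 1 A / (c * c') by rewrite divr_ge0// ltW.
  have := le_powR (ltW d0) _ sA; rewrite -powRrM mulVf ?gt_eqF// powRr1//.
  rewrite powR_gt0 ?divr_gt0// => /(_ isT).
  by rewrite ler_pdivrMr// mulrC.
rewrite -!mulrA ler_pM2l//.
have sd : s `^ d = (s * s) `^ (rate a * (a + p)) / s.
  rewrite -(powRN1 s0) -expr2 -powR_mulrn ?ltW// -powRrM -powR_D//.
  by congr (_ `^ _); rewrite /d; ring.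
rewrite sd mulrA ler_pM2r ?invr_gt0//.
apply: le_trans (Hk s s1); rewrite ler_pM2l//.
apply: le_powR; [|by rewrite mulr_gt0|exact: r2_ge].
by rewrite mulr_ge0 ?ltW ?rate_gt0.
Unshelve. all: by end_near. Qed.

Lemma dens_int_cvgy : 1 < 2 * rate a * (a + p) ->
  dens_int a sigma p s @[s --> +oo] --> +oo.
Proof.
move=> h; have [c c0 H] := dens_int_ge a_neq0 sigma_neq0 p_gt0.
exact: ge_k_cvgy h c0 H.
Qed.

Lemma grad_int_cvgy : 1 < 2 * rate a * (a + p) ->
  grad_int a p s @[s --> +oo] --> +oo.
Proof.
move=> h; have [c c0 H] := grad_int_ge a_neq0 p_gt0.
exact: ge_k_cvgy h c0 H.
Qed.

Lemma dens_int_cvgy_crit : a < 0 -> p + a = 1 / 2 ->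
  dens_int a sigma p s @[s --> +oo] --> +oo.
Proof.
move=> a0 pa; have [c c0 H] := dens_int_ge_log a_neq0 sigma_neq0 p_gt0 pa.
have [c' c'0 Hk] := k_growth a_neq0 ap.
apply/cvgryPge => A; near=> s.
have s1 : 1 <= s by near: s; apply: nbhs_pinfty_ge; rewrite num_real.
have s0 : 0 < s by lra.
have sA : 2 * expR (A / (c * c')) <= s.
  by near: s; apply: nbhs_pinfty_ge; rewrite num_real.
have cc : 0 < c * c' by rewrite mulr_gt0.
apply: le_trans (H s s1).
have l0 : 0 <= ln (1 + s / 2) by apply: ln_ge0; lra.
have lA : A / (c * c') <= ln (1 + s / 2).
  have eA := expR_gt0 (A / (c * c')).
  rewrite -[leLHS]expRK ler_ln ?posrE//; lra.
apply: (@le_trans _ _ (c * c' * ln (1 + s / 2))).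
  by move: lA; rewrite ler_pdivrMr// mulrC.
rewrite ler_wpM2r//.
rewrite -!mulrA ler_pM2l// ler_pdivlMr//.
apply: le_trans (Hk s s1); rewrite ler_pM2l//.
have -> : rate a * (a + p) = 2^-1 by rewrite /rate (lt_gtF a0) mul1r; lra.
have sE : s = (s * s) `^ 2^-1.
  rewrite -expr2 -powR_mulrn ?ltW// -powRrM (_ : 2%:R * 2^-1 = 1) ?powRr1 ?ltW//.
  by field.
rewrite {1}sE.
by apply: le_powR; [rewrite invr_ge0|rewrite mulr_gt0|exact: r2_ge].
Unshelve. all: by end_near. Qed.

End Divergence.

(** * Norms in Eulerian and in Lagrangian variables *)

Section Norms.
Context {R : realType}.
Implicit Types (x y s t al e p M A : R) (f u : R -> R -> R) (g : R -> R).
Local Notation mu := (@lebesgue_measure R).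

Lemma Lp01E p f t g : 0 < p -> continuous g ->
  (forall x, 0 <= x <= 1 -> f x t = g x) ->
  Lp01 p%:E f t = (int01 (fun x => `|g x| `^ p) `^ p^-1)%:E.
Proof.
move=> p0 cg fg; rewrite /Lp01 unlock.
have cgp := continuous_normp_comp p0 cg.
have -> : (\int[mu]_x `| ((EFin \o f^~ t) \_ `[0%R, 1%R]) x| `^ p =
    \int[mu]_(x in `[0%R, 1%R]) (`|g x| `^ p)%:E)%E.
  rewrite [RHS]integral_mkcond; apply: eq_integral => x _; rewrite !patchE.
  case: ifPn => // x01; last by rewrite /= normr0 powR0 ?gt_eqF.
  rewrite /= fg//; move: x01; rewrite inE /= in_itv /=; exact.
by rewrite EFin_int01//; exact: integrable_continuous.
Qed.

Lemma lebesgue_measure01 : mu `[0%R, 1%R] = 1%E.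
Proof. by rewrite lebesgue_measure_itv /= lte_fin ltr01 oppr0 adde0. Qed.

Lemma lebesgue_measureT_gt0 : (0 < mu [set: R])%E.
Proof.
apply: (@lt_le_trans _ _ (mu `[0%R, 1%R])).
  by rewrite lebesgue_measure01 lte_fin ltr01.
by apply: le_measure => //; rewrite inE.
Qed.

(** If the essential supremum were below [A], then the mean of [`|g| `^ p] would be
    at most [A `^ p]. *)
Lemma Lp01_le_Linfty p f t g A : 0 < p -> continuous g ->
  (forall x, 0 <= x <= 1 -> f x t = g x) ->
  A < int01 (fun x => `|g x| `^ p) `^ p^-1 -> (A%:E <= Lp01 +oo%E f t)%E.
Proof.
move=> p0 cg fg; apply: contraTT; rewrite -ltNge -leNgt => LA.
have cgp := continuous_normp_comp p0 cg.
have mD : measurable (`[0, 1]%classic : set R) by [].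
have H : {ae mu, forall x, `[0, 1]%classic x -> `|g x| <= A}.
  have : {ae mu, forall x, (`|((EFin \o f^~ t) \_ `[0%R, 1%R]) x| <= A%:E)%E}.
    apply/ess_supP; apply: ltW; move: LA; rewrite /Lp01 unlock /=.
    by rewrite lebesgue_measureT_gt0.
  apply: negligibleS => x /= H1 H2; apply: H1 => x01.
  by move: H2; rewrite patchE mem_set//= lee_fin fg//.
have A0 : 0 <= A.
  have := Lnorm_ge0 mu +oo%E ((EFin \o f^~ t) \_ `[0%R, 1%R]).
  by move=> /le_lt_trans /(_ LA); rewrite lte_fin => /ltW.
have I : (int01 (fun x => `|g x| `^ p))%:E = (\int[mu]_(x in `[0%R, 1%R]) (`|g x| `^ p)%:E)%E.
  by rewrite EFin_int01//; exact: integrable_continuous.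
have le : int01 (fun x => `|g x| `^ p) <= A `^ p.
  rewrite -lee_fin I.
  have -> : (A `^ p)%:E = (\int[mu]_(x in `[0%R, 1%R]) (cst (A `^ p)%:E) x)%E.
    have := @integral_cst _ _ _ mu _ mD (A `^ p)%:E => ->.
    by rewrite [X in (_ * X)%E]lebesgue_measure01 mule1.
  apply: (@ae_ge0_le_integral _ _ _ mu _ mD).
  - by move=> x _; rewrite lee_fin powR_ge0.
  - apply/measurable_EFinP; apply: measurable_funTS; exact: measurable_continuous.
  - by move=> x _; rewrite lee_fin powR_ge0.
  - exact: measurable_cst.
  - apply: negligibleS H => x /= H1 H2; apply: H1 => x01.
    by rewrite lee_fin; apply: (ge0_ler_powR (ltW p0)); rewrite ?nnegrE//; exact: H2.
rewrite (_ : A = (A `^ p) `^ p^-1); last by rewrite -powRrM divff ?gt_eqF// powRr1.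
apply: (ge0_ler_powR (ltW _)) => //; rewrite ?invr_gt0// nnegrE ?powR_ge0//.
by apply: int01_ge0 => x _; exact: powR_ge0.
Qed.

End Norms.

Section Transfer.
Context {R : realType}.
Implicit Types (x y s t al e p M A : R) (f u H : R -> R -> R) (g : R -> R).
Variable a : R.
Hypothesis tau_bounded : has_ubound (range (tau a)).
Local Notation T := (Tmax a).

Lemma int01_flow (h : R -> R) s : continuous h ->
  int01 (fun x => h (label a x s)) = int01 (fun al => h al * jac a al s).
Proof.
move=> ch.
have cj : continuous (jac a ^~ s).
  by move=> al; apply: (continuous2_l (tame_continuous (tame_jac a))).
have chj : continuous (fun al => h al * jac a al s) := continuous_mul ch cj.
have cl : continuous (label a ^~ s).
  by move=> x; have := is_derive_label a x s; exact: is_derive_continuous.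
have chl : continuous (fun x => h (label a x s)).
  by move=> x; apply: (@continuous_comp _ _ _ (label a ^~ s) h); [exact: cl|exact: ch].
have D1 al : is_derive al 1 (fun al => prim (fun x => h (label a x s)) (flow a al s))
    (h al * jac a al s).
  have := is_derive1_chain (f := prim (fun x => h (label a x s))) (g := flow a ^~ s)
    (is_derive_prim (flow a al s) chl) (is_derive_flow a al s).
  by rewrite label_unique.
have cD : continuous (fun al => prim (fun x => h (label a x s)) (flow a al s)).
  by move=> al; exact: is_derive_continuous (D1 al).
rewrite (int01_FTC chj cD (fun al _ => D1 al)) flow1 flow0 prim0 subr0.
have cP : continuous (prim (fun x => h (label a x s))).
  by move=> x; exact: is_derive_continuous (is_derive_prim x chl).
by rewrite (int01_FTC chl cP (fun x _ => is_derive_prim x chl)) prim0 subr0.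
Qed.

Lemma param_cvgy : param a t @[t --> T^'-] --> +oo.
Proof.
apply/cvgryPge => A; near=> t.
have tT : t < T by near: t; exact: nbhs_left_lt.
have t0 : 0 <= t by near: t; apply: nbhs_left_ge; exact: Tmax_gt0.
have tA : tau a A < t by near: t; apply: nbhs_left_gt; exact: tau_lt_Tmax.
have lt : lifespan a t by apply: lifespanW => //; rewrite t0.
by rewrite -(paramK lt) tau_incr in tA; exact: ltW.
Unshelve. all: by end_near. Qed.

Lemma near_param (P : set R) : (\forall s \near +oo, P s) ->
  \forall t \near T^'-, P (param a t).
Proof. by move=> HP; exact: param_cvgy HP. Qed.

Section Norm.
Variables (H f : R -> R -> R).
Hypothesis tH : tame H.
Hypothesis HD1 : forall al s, H (al + 1) s = H al s.
Hypothesis fH : forall t, 0 <= t < T -> exists c, forall x, 0 <= x <= 1 ->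
  f x t = eul a H (x - c) t.

Let I p s := int01 (fun al => `|H al s| `^ p * jac a al s).

Let cH s : continuous (H ^~ s).
Proof. by move=> al; apply: (continuous2_l (tame_continuous tH)). Qed.

Let norm_shift p t : 0 < p -> 0 <= t < T -> exists2 g : R -> R, continuous g &
  (forall x, 0 <= x <= 1 -> f x t = g x) /\
  int01 (fun x => `|g x| `^ p) = I p (param a t).
Proof.
move=> p0 tT; have [c fc] := fH tT; exists (fun x => eul a H (x - c) t).
  have cl : continuous (label a ^~ (param a t)).
    by move=> x; have := is_derive_label a x (param a t); exact: is_derive_continuous.
  have ce : continuous (eul a H ^~ t).
    by move=> x; apply: (@continuous_comp _ _ _ (label a ^~ (param a t)) (H ^~ (param a t)));
      [exact: cl|exact: cH].
  move=> x; apply: (@continuous_comp _ _ _ (fun x => x - c) (eul a H ^~ t)); last exact: ce.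
  exact: continuous_sub (fun x => @cvg_id _ (nbhs x)) (@continuous_cst _ _ _) x.
split => //.
have cHp := continuous_normp_comp p0 (@cH (param a t)).
rewrite /I -(int01_flow _ cHp).
have := @int01_shift R (fun x => `|eul a H x t| `^ p) c; apply.
  have cl : continuous (label a ^~ (param a t)).
    by move=> x; have := is_derive_label a x (param a t); exact: is_derive_continuous.
  by move=> x; apply: (@continuous_comp _ _ _ (label a ^~ (param a t))
    (fun al => `|H al (param a t)| `^ p)); [exact: cl|exact: cHp].
by move=> x; rewrite eulD1.
Qed.

Let I_ge0 p s : 0 <= I p s.
Proof.
apply: int01_ge0 => al _; rewrite mulr_ge0 ?powR_ge0// ltW//; exact: jac_gt0.
Qed.

Let near_T : \forall t \near T^'-, 0 <= t < T.
Proof.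
near=> t; apply/andP; split.
  by near: t; apply: nbhs_left_ge; exact: Tmax_gt0.
by near: t; exact: nbhs_left_lt.
Unshelve. all: by end_near. Qed.

Let root_cvgy p : 0 < p -> I p s @[s --> +oo] --> +oo ->
  forall A, \forall t \near T^'-, A < I p (param a t) `^ p^-1.
Proof.
move=> p0 /cvgryPgt Iy A.
have N : \forall t \near T^'-, Num.max 0 A `^ p < I p (param a t).
  exact: (near_param (P := fun s => Num.max 0 A `^ p < I p s)).
apply: filterS N => t; rewrite /= => IA.
have m0 : 0 <= Num.max 0 A by rewrite le_max lexx.
apply: (@le_lt_trans _ _ (Num.max 0 A)); first by rewrite le_max lexx orbT.
rewrite -[ltLHS](powRr1 m0) -(mulfV (lt0r_neq0 p0)) powRrM.
by apply: gt0_ltr_powR => //; rewrite ?invr_gt0// nnegrE ?powR_ge0.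
Qed.

Lemma Lp01_cvgy p : 0 < p -> I p s @[s --> +oo] --> +oo ->
  Lp01 p%:E f t @[t --> T^'-] --> +oo%E.
Proof.
move=> p0 Iy; apply/cvgeyPge => A; near=> t.
have tT : 0 <= t < T by near: t; exact: near_T.
have [g cg [fg gI]] := norm_shift p0 tT.
rewrite (Lp01E p0 cg fg) gI lee_fin; apply: ltW.
by near: t; exact: root_cvgy.
Unshelve. all: by end_near. Qed.

Lemma Linfty_cvgy p : 0 < p -> I p s @[s --> +oo] --> +oo ->
  Lp01 +oo%E f t @[t --> T^'-] --> +oo%E.
Proof.
move=> p0 Iy; apply/cvgeyPge => A; near=> t.
have tT : 0 <= t < T by near: t; exact: near_T.
have [g cg [fg gI]] := norm_shift p0 tT.
apply: (Lp01_le_Linfty p0 cg fg); rewrite gI.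
by near: t; exact: root_cvgy.
Unshelve. all: by end_near. Qed.

Lemma Lp01_has_lim p (l : R) : 0 < p -> I p s @[s --> +oo] --> l ->
  has_finite_lim_left (Lp01 p%:E f) T.
Proof.
move=> p0 Il; exists (`|l| `^ p^-1).
have pV : 0 < p^-1 by rewrite invr_gt0.
have h := cvg_comp _ _ param_cvgy Il.
have h2 : `|I p (param a t)| `^ p^-1 @[t --> T^'-] --> `|l| `^ p^-1.
  apply: (@cvg_comp _ _ _ (fun t => I p (param a t)) (fun y => `|y| `^ p^-1) _ _ _ h).
  exact: continuous_normp.
have h3 : (`|I p (param a t)| `^ p^-1)%:E @[t --> T^'-] --> (`|l| `^ p^-1)%:E.
  by apply: cvg_EFin h2; near=> t.
apply: cvg_trans h3; apply: near_eq_cvg; near=> t.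
have tT : 0 <= t < T by near: t; exact: near_T.
have [g cg [fg gI]] := norm_shift p0 tT.
by rewrite /= (Lp01E p0 cg fg) gI ger0_norm.
Unshelve. all: by end_near. Qed.

End Norm.
End Transfer.

(** * The theorem *)

Section Data.
Context {R : realType}.
Implicit Types (x A B : R).

(** Differentiation maps this family of functions to itself. *)
Lemma smooth01_trig A B :
  smooth01 (fun x => A * cos (2 * pi * x) + B * sin (2 * pi * x)).
Proof.
pose g A B x := A * cos (2 * pi * x) + B * sin (2 * pi * x).
have dg A' B' x : is_derive x 1 (g A' B') (g (B' * (2 * pi)) (- (A' * (2 * pi))) x).
  apply: (is_derive_eq (is_derive1D (is_derive1Z A' (is_derive1_cos2pi x))
    (is_derive1Z B' (is_derive1_sin2pi x)))).
  by rewrite /g; ring.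
have H n : exists A' B', forall x, x \in `[0, 1] ->
    iter n (derive_within `[0, 1]) (g A B) x = g A' B' x.
  elim: n => [|n [A' [B' IH]]]; first by exists A, B.
  exists (B' * (2 * pi)), (- (A' * (2 * pi))) => x x01 /=.
  apply: (proj2 (derive_withinP _ _ _ (dg A' B' x))) => //.
    by apply: proper_within01; move: x01; rewrite in_itv.
  by near=> y; exact: IH.
move=> n x x01; have [A' [B' IH]] := H n.
apply: (proj1 (derive_withinP _ _ _ (dg A' B' x))) => //.
  by apply: proper_within01; move: x01; rewrite in_itv.
by near=> y; exact: IH.
Unshelve. all: by end_near. Qed.

Lemma smooth01_cst0 : smooth01 (fun=> 0 : R).
Proof.
have -> : (fun=> 0) = (fun x => 0 * cos (2 * pi * x) + 0 * sin (2 * pi * x)) :> (R -> R).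
  by apply/funext => x; rewrite !mul0r addr0.
exact: smooth01_trig.
Qed.

Lemma smooth01_cos A : smooth01 (fun x => A * cos (2 * pi * x)).
Proof.
have -> : (fun x => A * cos (2 * pi * x)) =
    (fun x => A * cos (2 * pi * x) + 0 * sin (2 * pi * x)).
  by apply/funext => x; rewrite mul0r addr0.
exact: smooth01_trig.
Qed.

Lemma periodic_data_cos A : periodic_data (fun=> 0) (fun x => A * cos (2 * pi * x)).
Proof.
have d0 x : 0 <= x <= 1 -> derive_within `[0, 1] (fun=> 0) x = 0.
  move=> x01; apply: (proj2 (derive_withinP _ _ _ (is_derive1_cst 0 x))) => //.
    exact: proper_within01.
  by near=> y.
split=> //; first by rewrite !d0 ?lexx ?ler01.
by have := cos2piD1 (0 : R); rewrite add0r => ->.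
Unshelve. all: by end_near. Qed.

End Data.

Section Exponents.
Context {R : realType}.
Variables (a p : R).

Lemma rate_cond_gt0 : 0 < a -> 1 <= p -> 1 < 2 * rate a * (a + p).
Proof.
move=> a0 p1; rewrite /rate a0 -mulrAC ltr_pdivlMr; lra.
Qed.

Lemma rate_cond_lt0 : a < 0 -> 1 / 2 < a + p -> 1 < 2 * rate a * (a + p).
Proof. by move=> a0 ap; rewrite /rate (lt_gtF a0); lra. Qed.

End Exponents.

Theorem theorem1p5 (R : realType) (lambda kappa : R)
    (lambda_neq0 : lambda != 0) (kappa_neq0 : kappa != 0)
    (lambda_kappa_gt0 : 0 < lambda * kappa) :
  exists u0 rho0 : R -> R,
    [/\ smooth01 u0, smooth01 rho0 & periodic_data u0 rho0] /\
    exists ts : R, 0 < ts /\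
      (exists u rho : R -> R -> R, is_solution lambda kappa u0 rho0 ts u rho) /\
      (forall u rho : R -> R -> R, is_solution lambda kappa u0 rho0 ts u rho ->
        Linfty_blowup u rho ts /\
        (forall p : R, 1 < p -> lambda <= - p^-1 \/ 0 < lambda ->
          Lp01 p%:E (dx u) t @[t --> ts^'-] --> +oo%E) /\
        (forall p : R, 1 <= p -> - (2 * p - 1)^-1 < lambda -> lambda < 0 ->
          has_finite_lim_left (Lp01 p%:E (dx u)) ts) /\
        (forall p : R, 1 <= p ->
          lambda <= - (2 * p - 1)^-1 \/ 0 < lambda ->
          Lp01 p%:E rho t @[t --> ts^'-] --> +oo%E) /\
        (forall p : R, 1 <= p -> - (2 * p - 1)^-1 < lambda -> lambda < 0 ->
          has_finite_lim_left (Lp01 p%:E rho) ts)).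
Proof.
(* chosen so that kappa * sigma ^+ 2 = 1 / lambda = 2 * a *)
pose a := (2 * lambda)^-1; pose sigma := (Num.sqrt (lambda * kappa))^-1.
have a_neq0 : a != 0 by rewrite invr_eq0 mulf_neq0.
have al : 2 * a * lambda = 1 by rewrite /a; field.
have sq0 : 0 < Num.sqrt (lambda * kappa) by rewrite sqrtr_gt0.
have sigma_neq0 : sigma != 0 by rewrite invr_eq0 gt_eqF.
have lambdaE : lambda = (2 * a)^-1.
  by rewrite /a; field.
have kappaE : kappa * (sigma * sigma) = 2 * a.
  rewrite /sigma -invfM -expr2 sqr_sqrtr ?ltW// /a; field.
  by rewrite lambda_neq0 kappa_neq0.
have tb := tau_bounded a_neq0.
have a_gt0 : 0 < lambda -> 0 < a by move=> ?; rewrite invr_gt0 mulr_gt0.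
have a_lt0 : lambda < 0 -> a < 0 by move=> ?; rewrite invr_lt0; lra.
exists (fun=> 0), (fun x => sigma * cos (2 * pi * x)); split.
  by split; [exact: smooth01_cst0|exact: smooth01_cos|exact: periodic_data_cos].
exists (Tmax a); split; first exact: Tmax_gt0.
split.
  exists (eul a (vel a)), (eul a (dens a sigma)).
  exact: explicit_solution.
move=> u rho sol.
have shift t : 0 <= t < Tmax a -> exists c, forall x, 0 <= x <= 1 ->
    dx u x t = eul a (grad a) (x - c) t /\ rho x t = eul a (dens a sigma) (x - c) t.
  by move=> tT; exact: (solution_shift a_neq0 lambdaE kappaE sol).
have su t : 0 <= t < Tmax a -> exists c, forall x, 0 <= x <= 1 ->
    dx u x t = eul a (grad a) (x - c) t.
  by move=> /shift[c H]; exists c => x /H[].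
have sr t : 0 <= t < Tmax a -> exists c, forall x, 0 <= x <= 1 ->
    rho x t = eul a (dens a sigma) (x - c) t.
  by move=> /shift[c H]; exists c => x /H[].
have tg := tame_grad a; have td := tame_dens a sigma.
have gD1 := gradD1 a; have dD1 := densD1 a sigma.
have growth p : 1 <= p -> (a < 0 -> 1 / 2 < a + p) ->
    0 < a + p /\ 1 < 2 * rate a * (a + p).
  move=> p1 ap; have [a0|a0|a0] := ltgtP a 0.
  - by split; [have := ap a0; lra|exact: rate_cond_lt0 a0 (ap a0)].
  - by split; [lra|exact: rate_cond_gt0].
  - by rewrite a0 eqxx in a_neq0.
have grad_oo p : 1 <= p -> (a < 0 -> 1 / 2 < a + p) ->
    grad_int a p s @[s --> +oo] --> +oo.
  move=> p1 /(growth _ p1)[ap h]; apply: grad_int_cvgy => //; lra.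
have dens_oo p : 1 <= p -> (a < 0 -> 1 / 2 < a + p) ->
    dens_int a sigma p s @[s --> +oo] --> +oo.
  move=> p1 /(growth _ p1)[ap h]; apply: dens_int_cvgy => //; lra.
(* an exponent for which both norms blow up, whatever the sign of lambda *)
pose P := Num.max 1 (1 - a).
have P1 : 1 <= P by rewrite le_max lexx.
have P0 : 0 < P by lra.
have Pa : a < 0 -> 1 / 2 < a + P.
  move=> _; have : 1 - a <= P by rewrite le_max lexx orbT.
  by lra.
have lneg p : 1 <= p -> lambda < 0 -> - (2 * p - 1)^-1 < lambda -> p + a < 1 / 2.
  move=> p1 l0 lp; have a0 := a_lt0 l0.
  have q0 : 0 < 2 * p - 1 by lra.
  have h : 1 > - lambda * (2 * p - 1) by rewrite -ltr_pdivlMr// div1r; lra.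
  by nra.
split; first by split; [exact: (Linfty_cvgy tb tg gD1 su P0 (grad_oo P P1 Pa))|
  exact: (Linfty_cvgy tb td dD1 sr P0 (dens_oo P P1 Pa))].
split.
  move=> p p1 lp; have p0 : 0 < p by lra.
  apply: (Lp01_cvgy tb tg gD1 su p0); apply: grad_oo; first exact: ltW.
  move=> a0; case: lp => [lp|/a_gt0 a1]; last by lra.
  have l0 : lambda < 0 by apply: le_lt_trans lp _; rewrite oppr_lt0 invr_gt0.
  have h : 1 <= - lambda * p by rewrite -ler_pdivrMr// div1r; lra.
  by nra.
split.
  move=> p p1 lp l0; have p0 : 0 < p by lra.
  have [l hl] := grad_int_cvg (a_lt0 l0) p1 (lneg p p1 l0 lp).
  exact: (Lp01_has_lim tb tg gD1 su p0 hl).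
split.
  move=> p p1 lp; have p0 : 0 < p by lra.
  apply: (Lp01_cvgy tb td dD1 sr p0).
  case: lp => [lp|/a_gt0 a1]; last by apply: dens_oo => //; lra.
  have q0 : 0 < 2 * p - 1 by lra.
  have l0 : lambda < 0 by apply: le_lt_trans lp _; rewrite oppr_lt0 invr_gt0.
  have h : 1 <= - lambda * (2 * p - 1) by rewrite -ler_pdivrMr// div1r; lra.
  have : 1 / 2 <= p + a by have := a_lt0 l0; nra.
  rewrite le_eqVlt => /predU1P[pa|pa]; last by apply: dens_oo => // _; lra.
  by apply: dens_int_cvgy_crit => //; [lra|exact: a_lt0].
move=> p p1 lp l0; have p0 : 0 < p by lra.
have [l hl] := dens_int_cvg sigma (a_lt0 l0) p1 (lneg p p1 l0 lp).
exact: (Lp01_has_lim tb td dD1 sr p0 hl).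
Qed.
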